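(* For every positive constant $b$ there exists a constant $c_b$, depending only on $b$, such that the following holds. Let $\Gamma$ be a finite collection of real algebraic curves in $\mathbb{R}^3$, each of degree at most $b$, and let $J$ be the set of joints formed by $\Gamma$. Then $$\sum_{x\in J} N(x)^{1/2} \leq c_b\cdot |\Gamma|^{3/2}.$$
   Context: A real (resp. complex) algebraic set is the set of common zeros in $\mathbb{R}^n$ (resp. $\mathbb{C}^n$) of finitely many polynomials with real (resp. complex) coefficients; it is irreducible if it is not a union of two non-empty algebraic sets that are proper subsets of it. The dimension of an irreducible algebraic set $V\subseteq\mathbb{K}^n$ is the transcendence degree over $\mathbb{K}$ of $\mathbb{K}[x_1,\dots,x_n]/I(V)$, where $I(V)$ is the ideal of polynomials vanishing on $V$; the dimension of an algebraic set is the maximal dimension of the irreducible varieties contained in it. An algebraic curve is an algebraic set of dimension 1. The degree of a complex algebraic curve in $\mathbb{C}^n$ is the number of points, counted with appropriate multiplicities, in which a generic hyperplane intersects it; the degree of a real algebraic curve in $\mathbb{R}^n$ is the degree of the smallest complex algebraic curve in $\mathbb{C}^n$ containing it. Let $\mathcal{F}$ be the family of all non-empty sets $\gamma\subseteq\mathbb{R}^3$ such that for every $x\in\gamma$ a basic neighbourhood of $x$ in $\gamma$ is either $\{x\}$ or a finite union of parametrised curves, each homeomorphic to a semi-open line segment with one endpoint the point $x$. If there is a parametrisation $f:[0,1)\to\mathbb{R}^3$ of one of these curves with $f(0)=x$ and $f'(0)\neq 0$, then the line through $x$ with direction $f'(0)$ is said to be tangent to $\gamma$ at $x$. Real algebraic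 curves in $\mathbb{R}^3$ belong to $\mathcal{F}$. For $\Gamma\subset\mathcal{F}$, $T_x^{\Gamma}$ denotes the set of directions of all tangent lines at $x$ to the sets of $\Gamma$ passing through $x$ (it may be empty, and a single set may have several tangent lines at $x$). A point $x\in\mathbb{R}^3$ is a joint for (formed by) a collection $\Gamma\subset\mathcal{F}$ if $x$ belongs to at least one of the sets in $\Gamma$ and there exist at least three vectors in $T_x^{\Gamma}$ spanning $\mathbb{R}^3$. The multiplicity $N(x)$ of the joint $x$ is the number of triples of lines in $\mathbb{R}^3$ passing through $x$ whose directions are linearly independent vectors in $T_x^{\Gamma}$. *)

(* Defs.v *)
(* MathComp with MathComp-Analysis. *)
From HB Require Import structures.
From mathcomp Require Import all_boot all_order all_algebra.
From mathcomp Require Import finmap.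
From mathcomp Require Import all_classical all_reals all_analysis.
From mathcomp Require Import complex.
(* Its notations clash with those of MathComp-Analysis. *)
From mathcomp Require Import -(notations) mpoly.

Set Implicit Arguments.
Unset Strict Implicit.
Unset Printing Implicit Defensive.

Import Order.TTheory GRing.Theory Num.Theory.
Import numFieldNormedType.Exports.

Local Open Scope classical_set_scope.
Local Open Scope ring_scope.

Definition peval (K : fieldType) (n : nat) (p : mpoly n K)
    (x : 'rV[K]_n) : K :=
  meval (fun i => x 0 i) p.

Definition algebraic_set (K : fieldType) (n : nat) (V : set 'rV[K]_n) : Prop :=
  exists s : seq (mpoly n K),
    V = [set x | forall p, p \in s -> peval p x = 0].

Definition vanishing_ideal (K : fieldType) (n : nat) (V : set 'rV[K]_n) :
    set (mpoly n K) :=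
  [set p | forall x, V x -> peval p x = 0].

Definition irreducible_algebraic_set (K : fieldType) (n : nat)
    (V : set 'rV[K]_n) : Prop :=
  algebraic_set V /\
  ~ exists A B : set 'rV[K]_n,
      [/\ algebraic_set A, algebraic_set B, A !=set0 /\ B !=set0,
          A `<` V /\ B `<` V & V = A `|` B].

(* The classes of the f_i in K[x_1,...,x_n]/I(V) are algebraically independent
   over K.  When V is empty this fails even for d = 0, so that the empty set
   has no dimension. *)
Definition alg_indep_on (K : fieldType) (n d : nat) (V : set 'rV[K]_n)
    (f : d.-tuple (mpoly n K)) : Prop :=
  forall P : mpoly d K,
    P != 0 -> ~ vanishing_ideal V (comp_mpoly f P).

(* d is the transcendence degree over K of K[x_1,...,x_n]/I(V). *)
Definition irreducible_dim (K : fieldType) (n : nat) (V : set 'rV[K]_n)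
    (d : nat) : Prop :=
  (exists f : d.-tuple (mpoly n K), alg_indep_on V f) /\
  (forall e (f : e.-tuple (mpoly n K)), alg_indep_on V f -> (e <= d)%N).

Definition algebraic_dim (K : fieldType) (n : nat) (V : set 'rV[K]_n)
    (d : nat) : Prop :=
  (exists W : set 'rV[K]_n,
     [/\ irreducible_algebraic_set W, W `<=` V & irreducible_dim W d]) /\
  (forall (W : set 'rV[K]_n) e,
     irreducible_algebraic_set W -> W `<=` V -> irreducible_dim W e ->
     (e <= d)%N).

Definition algebraic_curve (K : fieldType) (n : nat) (V : set 'rV[K]_n) :
    Prop :=
  algebraic_set V /\ algebraic_dim V 1.

Definition hyperplane_poly (K : fieldType) (n : nat) (a : 'rV[K]_n) (c : K) :
    mpoly n K :=
  \sum_(i < n) a 0 i *: mpolyX K (mnm1 i) - mpolyC n c.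

Definition hyperplane (K : fieldType) (n : nat) (a : 'rV[K]_n) (c : K) :
    set 'rV[K]_n :=
  [set z | \sum_(i < n) a 0 i * z 0 i = c].

(* The preimage in K[x_1,...,x_n] of the ideal generated by I(V) and h in the
   local ring K[x_1,...,x_n]_p of polynomial fractions defined at p. *)
Definition local_ideal (K : fieldType) (n : nat) (V : set 'rV[K]_n)
    (h : mpoly n K) (p : 'rV[K]_n) : set (mpoly n K) :=
  [set f | exists s g u : mpoly n K,
     [/\ peval s p != 0, vanishing_ideal V g & s * f = g + u * h]].

(* k is the intersection multiplicity of V and {h = 0} at p, i.e. the
   K-dimension of K[x_1,...,x_n]_p / (I(V), h).  At an isolated point p of the
   intersection, some power of the maximal ideal of K[x_1,...,x_n]_p lies in
   (I(V), h), so K[x_1,...,x_n] surjects onto this quotient with kernel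
   local_ideal V h p; the condition says that e_1, ..., e_k is a basis of
   K[x_1,...,x_n] modulo that kernel. *)
Definition intersection_mult (K : fieldType) (n : nat) (V : set 'rV[K]_n)
    (h : mpoly n K) (p : 'rV[K]_n) (k : nat) : Prop :=
  exists e : 'I_k -> mpoly n K,
    forall q : mpoly n K, exists! c : 'rV[K]_k,
      local_ideal V h p (q - \sum_(i < k) c 0 i *: e i).

Definition intersection_number (K : fieldType) (n : nat) (V : set 'rV[K]_n)
    (a : 'rV[K]_n) (c : K) (d : nat) : Prop :=
  finite_set (V `&` hyperplane a c) /\
  exists m : 'rV[K]_n -> nat,
    (forall p, (V `&` hyperplane a c) p ->
       intersection_mult V (hyperplane_poly a c) p (m p)) /\
    \sum_(p \in V `&` hyperplane a c) m p = d.

(* A generic hyperplane a.z = c is one whose coefficients (a, c) lie outside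
   the zero set of some fixed non-zero polynomial G. *)
Definition complex_curve_degree (R : realType) (n : nat)
    (V : set 'rV[R[i]]_n) (d : nat) : Prop :=
  exists2 G : mpoly (n + 1) R[i], G != 0 &
    forall (a : 'rV[R[i]]_n) (c : R[i]),
      a != 0 -> peval G (row_mx a (const_mx c)) != 0 ->
      intersection_number V a c d.

Definition complexify (R : realType) (n : nat) (x : 'rV[R]_n) :
    'rV[R[i]]_n :=
  map_mx (real_complex R) x.

Definition smallest_complex_curve (R : realType) (n : nat)
    (g : set 'rV[R]_n) (V : set 'rV[R[i]]_n) : Prop :=
  [/\ algebraic_curve V, @complexify R n @` g `<=` V &
      forall W : set 'rV[R[i]]_n,
        algebraic_curve W -> @complexify R n @` g `<=` W -> V `<=` W].

Definition real_curve_degree (R : realType) (n : nat) (g : set 'rV[R]_n)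
    (d : nat) : Prop :=
  exists2 V : set 'rV[R[i]]_n,
    smallest_complex_curve g V & complex_curve_degree V d.

(* f restricts to a homeomorphism from [0, 1) onto C sending 0 to x. *)
Definition arc_parametrisation (R : realType) (x : 'rV[R]_3)
    (C : set 'rV[R]_3) (f : R -> 'rV[R]_3) : Prop :=
  [/\ f 0 = x, {within `[0, 1[, continuous f}, f @` `[0, 1[ = C &
      exists2 g : 'rV[R]_3 -> R,
        {in `[0, 1[, cancel f g} & {within C, continuous g}].

Definition arc_from (R : realType) (x : 'rV[R]_3) (C : set 'rV[R]_3) : Prop :=
  exists f, arc_parametrisation x C f.

(* The curves C in B form a neighbourhood of x in g.  Cutting each of them
   close to x yields arbitrarily small neighbourhoods of the same form. *)
Definition arc_neighbourhood (R : realType) (g : set 'rV[R]_3) (x : 'rV[R]_3)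
    (B : set (set 'rV[R]_3)) : Prop :=
  [/\ finite_set B, forall C, B C -> arc_from x C,
      \bigcup_(C in B) C `<=` g &
      within g (nbhs x) (\bigcup_(C in B) C)].

(* v = f'(0) (one-sided derivative) for a parametrisation f of one of the
   curves making up a neighbourhood of x in g. *)
Definition tangent_direction (R : realType) (g : set 'rV[R]_3)
    (x v : 'rV[R]_3) : Prop :=
  [/\ g x, v != 0 &
  exists B : set (set 'rV[R]_3), arc_neighbourhood g x B /\
  exists (C : set 'rV[R]_3) (f : R -> 'rV[R]_3),
    [/\ B C, arc_parametrisation x C f &
        h^-1 *: (f h - f 0) @[h --> (0 : R)^'+] --> v]].

Definition tangent_directions (R : realType) (G : set (set 'rV[R]_3))
    (x : 'rV[R]_3) : set 'rV[R]_3 :=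
  [set v | exists2 g, G g & tangent_direction g x v].

Definition joint (R : realType) (G : set (set 'rV[R]_3)) : set 'rV[R]_3 :=
  [set x | (exists2 g, G g & g x) /\
     exists u v w, [/\ tangent_directions G x u, tangent_directions G x v,
       tangent_directions G x w & <<[:: u; v; w]>>%VS = fullv]].

Definition line (R : realType) (x v : 'rV[R]_3) : set 'rV[R]_3 :=
  [set x + t *: v | t in [set: R]].

Definition joint_triples (R : realType) (G : set (set 'rV[R]_3))
    (x : 'rV[R]_3) : set (set (set 'rV[R]_3)) :=
  [set L | exists u v w, [/\ tangent_directions G x u,
     tangent_directions G x v, tangent_directions G x w, free [:: u; v; w] &
     L = [set line x u] `|` [set line x v] `|` [set line x w]]].

(* Number of unordered triples; +oo if there are infinitely many. *)
Definition joint_mult (R : realType) (G : set (set 'rV[R]_3))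
    (x : 'rV[R]_3) : \bar R :=
  counting (joint_triples G x).

(* Main.v *)
(* Polynomial method with handicaps, after Tidor, Yu and Zhao.

   To a curve g attach the ideal I_g of the real polynomials that vanish on the
   beginning of every arc in g with one of the finitely many relevant tangents.
   A generic projection shows that the polynomials of degree < n have dimension
   at most d^2 n + O(1) modulo I_g, where d is the degree of g.

   Give each joint p a handicap beta(p), and filter the polynomials of degree < n
   by the order, modulo I_g, to which they vanish at all joints at once, the order
   at p lagging behind by beta(p).  The drops of dimension that occur when the
   order at p increases define share(g, p); these add up over p to at most the
   dimension above.  If every p has three branches with independent tangents, on
   curves g_1(p), g_2(p), g_3(p), then sum_p prod_i share(g_i(p), p) is at least
   the dimension of all polynomials of degree < n: otherwise some f != 0 would
   satisfy too many vanishing conditions along the branches.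

   Raising beta(p) lowers the shares of p and raises those of the other joints.
   Hence the handicaps can be balanced so that, for every p and every independent
   triple of branches at p, the product of the shares is about n^3 N(p)^{1/2} / S
   up to a constant, where S = sum_p N(p)^{1/2}.  Summing over the N(p) triples
   gives n N(p)^{1/2} / S^{1/3} <= const * sum_g share(g, p), and summing over p
   gives S^{2/3} <= const * |Gamma|. *)

Require Import Defs.
From HB Require Import structures.
From mathcomp Require Import all_boot all_order all_algebra.
From mathcomp Require Import finmap.
From mathcomp Require Import all_classical all_reals all_analysis.
From mathcomp Require Import complex separable.
(* Its notations clash with those of MathComp-Analysis. *)
From mathcomp Require Import -(notations) mpoly.
From mathcomp Require Import ring zify.

Set Implicit Arguments.
Unset Strict Implicit.
Unset Printing Implicit Defensive.

Import Order.TTheory GRing.Theory Num.Theory.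
Import numFieldNormedType.Exports.

Local Open Scope classical_set_scope.
Local Open Scope ring_scope.

(** * Polynomials and directional derivatives *)

(** The exponent 1/2 is what lets the last summation close: with w(p) = N(p)^{1/2}, a lower bound c
    w(p) for the product over each of w(p)^2 triples adds up to c w(p)^3, a cube, and the cube roots
    can then be summed over p. Three obstacles shape the rest. A curve may have several tangents at
    one point; the dimension bound itself limits them to d^2. The degree of a curve is defined
    through complex hyperplane sections, so the dimension bound is proved over the complex numbers
    and descends by taking real and imaginary parts; its d^2 comes from two plane projections (u, w)
    and (u, z), each of degree at most d in the second variable. Finally, raising a handicap is
    compensated by multiplication with a polynomial that separates the joints, which costs degree.
    As Hilbert functions of curves grow at most linearly, suitable arbitrarily large n keep this
    cost at O(1) per share, hence O(n^2) per product, negligible against n^3. Handicaps are integers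
    that differ modulo the number of joints, so each step of the filtration tightens the condition
    at one joint at most. *)

Section Peval.
Variables (K : fieldType) (n : nat).
Implicit Types (x p y v : 'rV[K]_n) (f g : mpoly n K).

Lemma pevalD f g x : peval (f + g) x = peval f x + peval g x.
Proof. exact: mevalD. Qed.
Lemma pevalB f g x : peval (f - g) x = peval f x - peval g x.
Proof. exact: mevalB. Qed.
Lemma pevalM f g x : peval (f * g) x = peval f x * peval g x.
Proof. exact: mevalM. Qed.
Lemma pevalZ c f x : peval (c *: f) x = c * peval f x.
Proof. exact: mevalZ. Qed.
Lemma peval0 x : peval 0 x = 0.
Proof. exact: meval0. Qed.
Lemma pevalC c x : peval (mpolyC n c) x = c.
Proof. exact: mevalC. Qed.
Lemma peval1 x : peval 1 x = 1.
Proof. exact: meval1. Qed.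
Lemma pevalXU i x : peval (mpolyX K (mnm1 i)) x = x 0 i.
Proof. exact: mevalXU. Qed.
Lemma peval_sum (I : Type) (r : seq I) (P : pred I) (F : I -> mpoly n K) x :
  peval (\sum_(i <- r | P i) F i) x = \sum_(i <- r | P i) peval (F i) x.
Proof. exact: raddf_sum. Qed.
Lemma peval_prod (I : Type) (r : seq I) (P : pred I) (F : I -> mpoly n K) x :
  peval (\prod_(i <- r | P i) F i) x = \prod_(i <- r | P i) peval (F i) x.
Proof. exact: rmorph_prod. Qed.

(** The restriction of [f] to the line through [p] with direction [y]. Its coefficients are the
    values at [y] of the homogeneous parts of [f] at [p], that is, iterated derivatives at [p] up to
    factorials ([coef_line]). *)
Definition line_poly p y f : {poly K} :=
  mmap (@polyC K) (fun i => (p 0 i)%:P + y 0 i *: 'X) f.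

HB.instance Definition _ p y := GRing.RMorphism.copy (line_poly p y)
  (mmap (@polyC K) (fun i => (p 0 i)%:P + y 0 i *: 'X)).

Lemma line_polyZ p y c f : line_poly p y (c *: f) = c *: line_poly p y f.
Proof. by rewrite /line_poly mmapZ mul_polyC. Qed.

Lemma line_polyC p y c : line_poly p y (mpolyC n c) = c%:P.
Proof. by rewrite /line_poly mmapC. Qed.

Lemma line_polyX p y i :
  line_poly p y (mpolyX K (mnm1 i)) = (p 0 i)%:P + y 0 i *: 'X.
Proof. by rewrite /line_poly mmapX mmap1U. Qed.

Lemma mpoly_ringind (P : mpoly n K -> Prop) :
  (forall c, P (mpolyC n c)) -> (forall i, P (mpolyX K (mnm1 i))) ->
  (forall f g, P f -> P g -> P (f + g)) ->
  (forall f g, P f -> P g -> P (f * g)) -> forall f, P f.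
Proof.
move=> PC PX PD PM f; rewrite [f]mpolyE.
apply: (big_ind P) => //; first by rewrite -(mpolyC0 n K); apply: PC.
move=> m _; rewrite -mul_mpolyC; apply: (PM) => //; rewrite mpolyXE_id.
apply: (big_ind P) => [||i _]; [by rewrite -(mpolyC1 n K); apply: PC|by move=> f1 f2; apply: (PM)|].
elim: (m i) => [|k IH]; first by rewrite expr0 -(mpolyC1 n K); apply: PC.
by rewrite exprS; apply: PM.
Qed.

Lemma horner_line p y f t : (line_poly p y f).[t] = peval f (p + t *: y).
Proof.
move: f; apply: mpoly_ringind => [c|i|f g Hf Hg|f g Hf Hg].
- by rewrite line_polyC hornerC pevalC.
- by rewrite line_polyX pevalXU !hornerE !mxE mulrC.
- by rewrite rmorphD hornerD pevalD Hf Hg.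
- by rewrite rmorphM hornerM pevalM Hf Hg.
Qed.

Definition dird v f : mpoly n K := \sum_i v 0 i *: mderiv i f.

Lemma dird_is_linear v : linear (dird v).
Proof.
move=> a f g; rewrite /dird scaler_sumr -big_split /=; apply: eq_bigr => i _.
by rewrite mderivD mderivZ scalerDr !scalerA mulrC.
Qed.
HB.instance Definition _ v := GRing.isLinear.Build K (mpoly n K) (mpoly n K) _
  (dird v) (dird_is_linear v).

Lemma dirdDv v w f : dird (v + w) f = dird v f + dird w f.
Proof. by rewrite /dird -big_split /=; apply: eq_bigr => i _; rewrite mxE scalerDl. Qed.
Lemma dirdZv c v f : dird (c *: v) f = c *: dird v f.
Proof. by rewrite /dird scaler_sumr; apply: eq_bigr => i _; rewrite mxE scalerA. Qed.
Lemma dird0v f : dird 0 f = 0.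
Proof. by rewrite /dird big1 // => i _; rewrite mxE scale0r. Qed.
Lemma dird_delta i f : dird (delta_mx 0 i) f = mderiv i f.
Proof.
rewrite /dird (bigD1 i) //= big1 ?addr0 => [|j ji]; rewrite mxE !eqxx ?scale1r //=.
by rewrite (negPf ji) scale0r.
Qed.

Lemma dirdM v f g : dird v (f * g) = dird v f * g + f * dird v g.
Proof.
rewrite /dird mulr_suml mulr_sumr -big_split /=; apply: eq_bigr => i _.
by rewrite mderivM scalerDr scalerAl scalerAr.
Qed.

Lemma dird_comm v w f : dird v (dird w f) = dird w (dird v f).
Proof.
rewrite /dird.
under eq_bigr => i _ do rewrite (linear_sum (mderiv i)) scaler_sumr.
under [RHS]eq_bigr => i _ do rewrite (linear_sum (mderiv i)) scaler_sumr.
rewrite exchange_big /=; apply: eq_bigr => j _; apply: eq_bigr => i _.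
by rewrite !mderivZ !scalerA mulrC mderiv_comm.
Qed.

Lemma msizeP f k : reflect (forall m, mcoeff m f != 0 -> (mdeg m < k)%N)
  (msize f <= k)%N.
Proof.
rewrite [X in (X <= _)%N]msizeE; apply: (iffP (bigmax_leqP_seq _ _ _ _)) => H m.
  by rewrite -mcoeff_msupp => Hm; apply: H.
by move=> Hm _; apply: H; rewrite -mcoeff_msupp.
Qed.

Lemma msize_deriv i f k : (msize f <= k)%N -> (msize (mderiv i f) <= k.-1)%N.
Proof.
move=> /msizeP Hf; apply/msizeP => m; rewrite mcoeff_deriv => H.
have : mcoeff (mnm_add m (mnm1 i)) f != 0.
  by apply: contra_neq H => ->; rewrite mul0rn.
by move/Hf; rewrite mdegD mdeg1; lia.
Qed.

Lemma msize_scale c f k : (msize f <= k)%N -> (msize (c *: f) <= k)%N.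
Proof. by move=> H; apply: leq_trans (mmeasureZ_le _ _ _) H. Qed.

Lemma msize_add f g k : (msize f <= k)%N -> (msize g <= k)%N -> (msize (f + g) <= k)%N.
Proof.
by move=> Hf Hg; apply: leq_trans (mmeasureD_le _ _ _) _; rewrite geq_max Hf.
Qed.

Lemma msize_sum (I : Type) (r : seq I) (P : pred I) (F : I -> mpoly n K) k :
  (forall i, P i -> (msize (F i) <= k)%N) -> (msize (\sum_(i <- r | P i) F i) <= k)%N.
Proof.
move=> H; apply: (big_ind (fun f => msize f <= k)%N) => //; first by rewrite mmeasure0.
by move=> f g; apply: msize_add.
Qed.

Lemma msize_dird v f k : (msize f <= k)%N -> (msize (dird v f) <= k.-1)%N.
Proof.
by move=> Hf; apply: msize_sum => i _; apply/msize_scale/msize_deriv.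
Qed.

(** Vanishing to order at least [k] at [p]; in characteristic zero, membership in the [k]-th power
    of the maximal ideal at [p]. The recursion makes each derivative lose one order by
    definition. *)
Fixpoint ordge (p : 'rV[K]_n) k f : Prop :=
  if k is k'.+1 then peval f p = 0 /\ forall v, ordge p k' (dird v f) else True.

Lemma ordge0 p k : ordge p k 0.
Proof.
elim: k => //= k IH; split; first exact: peval0.
by move=> v; rewrite linear0.
Qed.

Lemma ordge_lin p k a f g : ordge p k f -> ordge p k g -> ordge p k (a *: f + g).
Proof.
elim: k f g => //= k IH f g [f0 Hf] [g0 Hg]; split.
  by rewrite pevalD pevalZ f0 g0 mulr0 addr0.
by move=> v; rewrite (linearP (dird v)); apply: (IH _ _ (Hf v) (Hg v)).
Qed.

Lemma ordgeD p k f g : ordge p k f -> ordge p k g -> ordge p k (f + g).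
Proof. by move=> Hf Hg; rewrite -[f]scale1r; apply: ordge_lin. Qed.
Lemma ordgeZ p k a f : ordge p k f -> ordge p k (a *: f).
Proof. by move=> H; rewrite -[_ *: _]addr0; apply/ordge_lin/ordge0. Qed.
Lemma ordgeN p k f : ordge p k f -> ordge p k (- f).
Proof. by rewrite -scaleN1r; apply: ordgeZ. Qed.
Lemma ordgeB p k f g : ordge p k f -> ordge p k g -> ordge p k (f - g).
Proof. by move=> Hf /ordgeN; apply: ordgeD. Qed.

Lemma ordge_leq p k l f : (l <= k)%N -> ordge p k f -> ordge p l f.
Proof.
elim: l k f => [|l IH] [|k] f //= lk [f0 Hf]; split=> // v.
exact: IH (Hf v).
Qed.

Lemma ordge_mull p k f g : ordge p k f -> ordge p k (g * f).
Proof.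
elim: k f g => //= k IH f g [f0 Hf]; split; first by rewrite pevalM f0 mulr0.
move=> v; rewrite dirdM; apply: ordgeD; last exact: IH.
by apply/IH/(@ordge_leq p k.+1) => //=; split.
Qed.

Lemma ordge_mulS p k f g : peval g p = 0 -> ordge p k f -> ordge p k.+1 (g * f).
Proof.
move=> g0; elim: k f => [|k IH] f Hf.
  by split=> //; rewrite pevalM g0 mul0r.
split; first by rewrite pevalM g0 mul0r.
move=> v; rewrite dirdM; apply: ordgeD; first exact: ordge_mull.
by apply: IH; case: Hf => _ /(_ v).
Qed.

Lemma ordge_exp p k g : peval g p = 0 -> ordge p k (g ^+ k).
Proof.
by move=> g0; elim: k => // k IH; rewrite exprS; apply: ordge_mulS.
Qed.

Lemma ordge_dird p k v f : ordge p k f -> ordge p k.-1 (dird v f).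
Proof. by case: k => //= k []. Qed.

Lemma ordge_iter_dird p k j v f :
  ordge p k f -> ordge p (k - j)%N (iter j (dird v) f).
Proof.
by elim: j k => [|j IH] k Hf; rewrite ?subn0 //= subnS; apply/ordge_dird/IH.
Qed.

Lemma dird_comm_iter v w j f : dird v (iter j (dird w) f) = iter j (dird w) (dird v f).
Proof. by elim: j => //= j <-; rewrite dird_comm. Qed.

Lemma iter_dird_linear v j : linear (iter j (dird v)).
Proof. by elim: j => // j IH a f g /=; rewrite IH linearP. Qed.
HB.instance Definition _ v j := GRing.isLinear.Build K (mpoly n K) (mpoly n K) _
  (iter j (dird v)) (iter_dird_linear v j).

Lemma deriv_line p v f : (line_poly p v f)^`() = line_poly p v (dird v f).
Proof.
move: f; apply: mpoly_ringind => [c|i|f g Hf Hg|f g Hf Hg].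
- rewrite line_polyC derivC /dird big1 ?rmorph0 // => i _.
  by rewrite mderivC scaler0.
- rewrite line_polyX derivD derivC derivZ derivX add0r /dird rmorph_sum /=.
  rewrite (bigD1 i) //= big1 ?addr0 => [|j ji]; rewrite line_polyZ mderivX mnm1E.
    by rewrite eqxx scale1r -{1}[mnm1 i]add0m addmK mpolyX0 rmorph1.
  by rewrite eq_sym (negPf ji) scale0r rmorph0 scaler0.
- by rewrite !rmorphD derivD Hf Hg linearD rmorphD.
- by rewrite rmorphM derivM Hf Hg dirdM rmorphD !rmorphM.
Qed.

Lemma derivn_line p v f k : (line_poly p v f)^`(k) = line_poly p v (iter k (dird v) f).
Proof. by elim: k => // k IH; rewrite derivnS IH deriv_line. Qed.

Lemma coef_line p v f k :
  (line_poly p v f)`_k *+ k`! = peval (iter k (dird v) f) p.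
Proof.
have := coef_derivn k (line_poly p v f) 0.
rewrite derivn_line addn0 ffactnn => <-.
by rewrite -horner_coef0 horner_line scale0r addr0.
Qed.

Lemma size_line p v f k : (msize f <= k)%N -> (size (line_poly p v f) <= k)%N.
Proof.
move=> Hf; rewrite /line_poly /mmap; apply: (leq_trans (size_sum _ _ _)).
apply/bigmax_leqP_seq => m Hm _; rewrite mul_polyC; apply: (leq_trans (size_scale_leq _ _)).
have Hmf : (mdeg m < k)%N by move/msizeP: Hf; apply; rewrite -mcoeff_msupp.
apply: leq_trans Hmf; rewrite /mmap1 mdegE.
apply: (big_rec2 (fun s (q : {poly K}) => size q <= s.+1)%N) => [|i s q _ IH]; first by rewrite size_poly1.
apply: (leq_trans (size_polyMleq _ _)).
set L : {poly K} := (_ + _)%R.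
have HL : (size L <= 2)%N.
  apply: (leq_trans (size_polyD _ _)); rewrite geq_max.
  rewrite (leq_trans (size_polyC_leq1 _)) //.
  by rewrite (leq_trans (size_scale_leq _ _)) // size_polyX.
have : (size (L ^+ m i) <= (m i).+1)%N.
  apply: (leq_trans (size_poly_exp_leq _ _)); rewrite ltnS.
  by move: HL; case: (size L) => [|[|[|]]] //; nia.
by move=> H; rewrite -subn1 leq_subLR; apply: leq_trans (leq_add H IH) _; rewrite addSn addnS.
Qed.

End Peval.

(** * Orders of vanishing in characteristic zero *)

Section Zero.
Variables (K : numFieldType) (n : nat).
Implicit Types (x p y v : 'rV[K]_n) (f g : mpoly n K).

Lemma poly_horner0 (q : {poly K}) : (forall t, q.[t] = 0) -> q = 0.
Proof.
move=> H; apply/eqP; case: eqVneq => // q0.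
have := @max_poly_roots K q [seq i%:R | i <- iota 0 (size q)] q0.
rewrite size_map size_iota ltnn => -> //.
  by apply/allP => t _; rewrite rootE H.
rewrite map_inj_in_uniq ?iota_uniq // => i j _ _ /eqP.
by rewrite eqr_nat => /eqP.
Qed.

Lemma coef_line_eq0 p v f k :
  ((line_poly p v f)`_k == 0) = (peval (iter k (dird v) f) p == 0).
Proof.
by rewrite -coef_line -mulr_natr mulf_eq0 pnatr_eq0 -[_`! == 0%N]leqn0 leqNgt fact_gt0 orbF.
Qed.

Lemma peval_eq0_dird f : (forall x, peval f x = 0) -> forall v x, peval (dird v f) x = 0.
Proof.
move=> f0 v x; have := coef_line_eq0 x v f 1; rewrite /=.
rewrite (_ : line_poly x v f = 0) ?coef0 ?eqxx; first by move/esym/eqP.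
by apply: poly_horner0 => t; rewrite horner_line.
Qed.

Lemma peval_eq0_mderivm m f : (forall x, peval f x = 0) ->
  forall x, peval (mderivm m f) x = 0.
Proof.
move=> f0; rewrite mderivm_foldr.
elim: (flatten _) => //= i s IH x.
by rewrite -dird_delta; apply: peval_eq0_dird.
Qed.

(** Restriction to lines shows that all derivatives of [f] vanish everywhere as well; at the origin
    they are the coefficients of [f] up to non-zero factors. *)
Lemma peval_inj0 f : (forall x, peval f x = 0) -> f = 0.
Proof.
move=> f0; apply/mpolyP => m; rewrite mcoeff0.
have := peval_eq0_mderivm m f0 0.
have -> : peval (mderivm m f) 0 = mcoeff (@mnm0 n) (mderivm m f).
  move: (mderivm m f); apply: mpoly_ringind => [c|i|g h Hg Hh|g h Hg Hh].
  - by rewrite pevalC mcoeffC eqxx mulr1.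
  - by rewrite pevalXU mxE mcoeffX mnm1_eq0.
  - by rewrite pevalD mcoeffD Hg Hh.
  - by rewrite pevalM Hg Hh rmorphM.
rewrite mcoeff_mderivm addm0 => /eqP; rewrite -mulr_natr mulf_eq0 => /orP[/eqP //|].
rewrite pnatr_eq0 => /eqP H; exfalso; move: H; apply/eqP; rewrite -lt0n.
by apply: prodn_gt0 => i; rewrite ffactnn fact_gt0.
Qed.

Lemma ordge_msize p f : ordge p (msize f) f -> f = 0.
Proof.
move=> Hf; apply: peval_inj0 => x.
have -> : x = p + 1 *: (x - p) by rewrite scale1r addrC subrK.
rewrite -horner_line (_ : line_poly _ _ _ = 0) ?horner0 //.
apply/polyP => k; rewrite coef0; case: (leqP (msize f) k) => H.
  by rewrite nth_default // (leq_trans _ H) // size_line.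
apply/eqP; rewrite coef_line_eq0.
have := ordge_iter_dird k (x - p) Hf.
by rewrite -(subnSK H); case=> ->.
Qed.

Lemma coef_line_ordge p v f k j : ordge p k f -> (j < k)%N -> (line_poly p v f)`_j = 0.
Proof.
move=> Hf H; apply/eqP; rewrite coef_line_eq0.
have := ordge_iter_dird j v Hf.
by rewrite -(subnSK H); case=> ->.
Qed.

(** Orders can be tested on derivatives along a spanning family; for a joint, this family will be
    three independent tangents. *)
Lemma ordge_basis (I : finType) (e : I -> 'rV[K]_n) p k f :
  (forall v, exists c : I -> K, v = \sum_i c i *: e i) ->
  (forall s : seq I, (size s < k)%N -> peval (foldr (fun i => dird (e i)) f s) p = 0) ->
  ordge p k f.
Proof.
move=> He; elim: k f => //= k IH f H; split; first exact: (H [::]).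
move=> v; have [c ->] := He v.
suff: ordge p k (\sum_i c i *: dird (e i) f).
  congr (ordge _ _ _); rewrite (big_morph (fun v => dird v f) (fun u w => dirdDv u w f) (dird0v f)).
  by apply: eq_bigr => i _; rewrite dirdZv.
apply: (big_ind (ordge p k)) => [|g h|i _]; [exact: ordge0|exact: ordgeD|].
apply/ordgeZ/IH => s Hs.
by have := H (rcons s i); rewrite size_rcons ltnS foldr_rcons; apply.
Qed.

End Zero.

(** * Polynomials that vanish along an arc *)

Section Arc.
Variables (R : realType) (n : nat).

Lemma cvg_sumr (T : Type) (F : set_system T) {FF : Filter F} (I : Type) (s : seq I)
    (P : pred I) (f : I -> T -> R) (l : I -> R) :
  (forall i, P i -> f i x @[x --> F] --> l i) ->
  \sum_(i <- s | P i) f i x @[x --> F] --> \sum_(i <- s | P i) l i.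
Proof.
move=> H; elim: s => [|i s IH].
  by rewrite big_nil; under eq_fun do rewrite big_nil; apply: cvg_cst.
rewrite big_cons; under eq_fun do rewrite big_cons.
by case: ifP => // Pi; apply: cvgD => //; apply: H.
Qed.

Lemma peval_iter_dird_continuous k (f : mpoly n R) (p : 'rV[R]_n) :
  continuous (fun w : 'rV[R]_n => peval (iter k (dird w) f) p).
Proof.
elim: k f => [|k IH] f /=; first by move=> w; apply: cst_continuous.
have -> : (fun w : 'rV[R]_n => peval (dird w (iter k (dird w) f)) p) =
  (fun w => \sum_i w 0 i * peval (iter k (dird w) (mderiv i f)) p).
  apply/funext => w; rewrite dird_comm_iter /dird linear_sum peval_sum.
  by apply: eq_bigr => i _; rewrite linearZ pevalZ.
move=> w; apply: (@cvg_sumr _ (nbhs w)) => i _; apply: cvgM; last exact: IH.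
exact: coord_continuous.
Qed.

(** Write g h = p + h w(h), so that w(h) tends to v. Then f(g h) is the sum over k of h^k times the
    degree-k part of f at p, taken at w(h). Parts below r are zero; dividing by h^r and letting h
    tend to 0 isolates the part of degree r at v. *)
Lemma arc_coef (p v : 'rV[R]_n) (f : mpoly n R) r (g : R -> 'rV[R]_n) :
  g 0 = p -> h^-1 *: (g h - g 0) @[h --> (0 : R)^'+] --> v ->
  (\forall h \near (0 : R)^'+, peval f (g h) = 0) ->
  ordge p r f -> (line_poly p v f)`_r = 0.
Proof.
move=> g0 gv fg fr; set N := mmeasure mdeg f.
set w := fun h : R => h^-1 *: (g h - g 0).
have cv k : (line_poly p (w h) f)`_k @[h --> (0 : R)^'+] --> (line_poly p v f)`_k.
  have E u : (line_poly p u f)`_k = (k`!%:R)^-1 * peval (iter k (dird u) f) p.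
    by rewrite -coef_line -(mulr_natl (_`_k)) mulKf // pnatr_eq0 -lt0n fact_gt0.
  under eq_fun do rewrite E.
  rewrite E; apply: cvgM; first exact: cvg_cst.
  apply: (@cvg_comp _ _ _ w (fun u => peval (iter k (dird u) f) p)); first exact: gv.
  exact: peval_iter_dird_continuous.
(* For h > 0 this is f(g h) / h^r. *)
set E := fun h : R => \sum_(k < N | (r <= k)%N) (line_poly p (w h) f)`_k * h ^+ (k - r).
have limE : E h @[h --> (0 : R)^'+] -->
    \sum_(k < N | (r <= k)%N) (line_poly p v f)`_k * 0 ^+ (k - r).
  apply: cvg_sumr => k _; apply: cvgM; first exact: cv.
  apply: (@cvg_at_right_filter _ _ (fun h : R => h ^+ (k - r)) 0).
  exact: exprn_continuous.
have E0 : \forall h \near (0 : R)^'+, E h = 0.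
  near=> h; have h0 : h != 0 by rewrite gt_eqF.
  have : h ^+ r * E h = 0.
    have <- : peval f (g h) = 0 by near: h.
    have -> : g h = p + h *: w h by rewrite /w scalerA mulfV // scale1r g0 addrC subrK.
    rewrite -horner_line (horner_coef_wide _ (size_line _ _ (leqnn N))).
    rewrite (bigID (fun k : 'I_N => (r <= k)%N)) /= [X in _ + X]big1 ?addr0.
      rewrite /E mulr_sumr; apply: eq_bigr => k rk.
      by rewrite mulrCA -exprD subnKC.
    by move=> k; rewrite -ltnNge => kr; rewrite (coef_line_ordge _ fr kr) mul0r.
  by move/eqP; rewrite mulf_eq0 expf_eq0 (negPf h0) andbF => /eqP.
have limE0 : E h @[h --> (0 : R)^'+] --> (0 : R) by exact: cvg_near_cst.
rewrite -[RHS](cvg_unique _ limE limE0) //.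
case: (ltnP r N) => rN; last first.
  rewrite big1 ?nth_default // ?(leq_trans (size_line _ _ (leqnn _))) //.
  by move=> k rk; have := ltn_ord k; rewrite ltnNge (leq_trans rN rk).
rewrite (bigD1 (Ordinal rN)) //= subnn expr0 mulr1 big1 ?addr0 // => k /andP[rk kr].
rewrite expr0n subn_eq0 (_ : (k <= r)%N = false) ?mulr0 //.
by apply/negbTE; apply: contraNN kr => kr; rewrite -val_eqE /= eqn_leq kr.
Unshelve. all: by end_near.
Qed.
End Arc.

(** * Algebraic sets of dimension one *)

Lemma nondecreasing_subseq (u : nat -> nat) :
  exists2 f : nat -> nat, {homo f : i j / (i < j)%N} &
    {homo u \o f : i j / (i <= j)%N}.
Proof.
have tail N : exists i, (N <= i)%N /\ forall j, (i <= j)%N -> (u i <= u j)%N.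
  have ex : exists v, `[< exists2 i, (N <= i)%N & u i = v >].
    by exists (u N); apply/asboolP; exists N.
  case: (ex_minnP ex) => v /asboolP[i Ni <-] vmin; exists i; split=> // j ij.
  by apply/vmin/asboolP; exists j => //; apply: leq_trans Ni ij.
have [h Hh] := choice tail.
pose f := fix f k := if k is k'.+1 then h (f k').+1 else h 0.
have fS k : (f k < f k.+1)%N by have [] := Hh (f k).+1.
have fh k : exists N, f k = h N by case: k => [|k]; [exists 0|exists (f k).+1].
exists f; first exact: homo_ltn ltn_trans fS.
move=> i j ij /=; have [N eN] := fh i.
have [_] := Hh N; rewrite -eN; apply.
exact: (ltnW_homo (homo_ltn ltn_trans fS)).
Qed.

(** Successive subsequences make one coordinate after another nondecreasing. *)
Lemma dickson n (m : nat -> multinom n) :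
  exists i j, (i < j)%N /\ forall k, (m i k <= m j k)%N.
Proof.
have H (s : seq 'I_n) : exists2 f : nat -> nat, {homo f : i j / (i < j)%N} &
    forall k, k \in s -> {homo (fun i => m (f i) k) : i j / (i <= j)%N}.
  elim: s => [|k s [f fi fs]]; first by exists id.
  have [g gi gu] := nondecreasing_subseq (fun i => m (f i) k).
  exists (f \o g); first by move=> i j /gi /fi.
  move=> k'; rewrite inE => /orP[/eqP ->|k's] i j ij /=; first exact: gu.
  apply: fs => //; exact: (ltnW_homo gi).
have [f fi fs] := H (enum 'I_n).
exists (f 0%N), (f 1%N); split; first exact: fi.
by move=> k; apply: fs => //; rewrite mem_enum.
Qed.

(** * Descending chains of algebraic sets and algebraic dependence *)

Section Ideals.
Variables (K : fieldType) (n : nat).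
Implicit Types (I J : set (mpoly n K)).

Definition lead_monomials I : set (multinom n) :=
  [set m | exists f, [/\ I f, f != 0 & mlead f = m]].

(** If the leading monomial of [f] already occurs in [I], subtracting a multiple of an element of
    [I] lowers it and leaves [f] in [J] but outside [I]. The monomial order is well-founded, so this
    stops. *)
Lemma new_lead_monomial I J f : I 0 ->
  (forall a g h, J g -> J h -> J (a *: g + h)) ->
  (forall a g h, I g -> I h -> I (a *: g + h)) ->
  I `<=` J -> J f -> ~ I f ->
  exists2 m, lead_monomials J m & ~ lead_monomials I m.
Proof.
move=> I0 Jl Il IJ; move: f.
suff H m f : mlead f = m -> J f -> ~ I f -> exists2 m, lead_monomials J m & ~ lead_monomials I m.
  by move=> f; apply: H.
elim/(well_founded_ind (@ltom_wf n)): m f => m IH f fm Jf If.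
have f0 : f != 0 by apply: contra_notN If => /eqP ->.
have [[g [Ig g0 gm]]|] := pselect (lead_monomials I m); last first.
  by exists m => //; exists f.
pose c := mcoeff m f / mcoeff m g; pose f' := - c *: g + f.
have gm0 : mcoeff m g != 0 by rewrite -gm mleadc_eq0.
have f'm : mcoeff m f' = 0.
  by rewrite mcoeffD mcoeffZ /c mulNr divfK // addNr.
have If' : ~ I f'.
  move=> If'; apply: If.
  have -> : f = c *: g + f' by rewrite /f' scaleNr addrA subrr add0r.
  exact: Il.
have f'0 : f' != 0 by apply: contra_notN If' => /eqP ->.
apply: (IH _ _ f') => //; last exact/Jl/Jf/IJ.
rewrite lt_neqAle; apply/andP; split.
  by apply: contra_eqN f'm => /eqP <-; rewrite mleadc_eq0.
apply: (le_trans (mleadD_le _ _)); rewrite leUx fm lexx andbT.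
by rewrite -gm; apply: mleadZ_le.
Qed.

Lemma vanishing_ideal_lin V a f g : vanishing_ideal V f -> vanishing_ideal V g ->
  vanishing_ideal (K := K) (n := n) V (a *: f + g).
Proof. by move=> Vf Vg x Vx; rewrite pevalD pevalZ Vf // Vg // mulr0 addr0. Qed.

Lemma vanishing_idealM V f g : vanishing_ideal (K := K) (n := n) V g ->
  vanishing_ideal V (f * g).
Proof. by move=> Vg x Vx; rewrite pevalM Vg ?mulr0. Qed.

(** Without a minimal set there is an infinite strictly descending chain. Its vanishing ideals gain
    a new leading monomial at every step, whereas by [dickson] one of these monomials is a multiple
    of an earlier one. *)
Lemma algebraic_set_min (Q : set 'rV[K]_n -> Prop) V : algebraic_set V -> Q V ->
  exists W, [/\ algebraic_set W, Q W, W `<=` V &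
    forall W', algebraic_set W' -> Q W' -> W' `<=` W -> W' = W].
Proof.
move=> aV QV; apply: contrapT => H.
pose X := {W | [/\ algebraic_set W, Q W & W `<=` V]}.
have step (w : X) : exists w' : X, sval w' `<` sval w.
  case: w => W [aW QW WV] /=; apply: contrapT => H'; apply: H; exists W; split=> //.
  move=> W' aW' QW' W'W; apply: contrapT => ne; apply: H'.
  exists (exist _ W' (And3 aW' QW' (subset_trans W'W WV))) => /=.
  by rewrite properEneq; split=> //; apply/eqP.
have [nxt Hn] := choice step.
have V0 : X by exists V; split.
pose s i : X := iter i nxt V0.
pose I i := vanishing_ideal (sval (s i)).
have IS i : I i `<=` I i.+1.
  by move=> f If x Hx; apply: If; apply: (properW (Hn (s i))).
have Imono i j : (i <= j)%N -> I i `<=` I j.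
  by move=> /subnK <-; elim: (j - i)%N => // k IH; apply: subset_trans IH (IS _).
have new i : exists m, lead_monomials (I i.+1) m /\ ~ lead_monomials (I i) m.
  have [f If nIf] : exists2 f, I i.+1 f & ~ I i f.
    have [_ /nonsubset [x [Hx nHx]]] := Hn (s i).
    have [[t Ht] _ _] := svalP (s i.+1).
    move: nHx; rewrite -[nxt (s i)]/(s i.+1) Ht /= => /existsNP [p /not_implyP [pt px]].
    by exists p => [y|Hp]; [rewrite Ht; apply|apply: px; apply: Hp].
  have [m Hm nm] := @new_lead_monomial (I i) (I i.+1) f
    (fun x _ => peval0 x) (fun a g h => @vanishing_ideal_lin _ a g h)
    (fun a g h => @vanishing_ideal_lin _ a g h) (IS i) If nIf.
  by exists m.
have [m Hm] := choice new.
have [i [j [ij mij]]] := dickson m.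
have [_ []] := Hm j.
have [[f [If f0 fm]] _] := Hm i.
set x := mpolyX K (mnm_sub (m j) (m i)).
have x0 : x != 0 by rewrite -mleadc_eq0 mleadXm mcoeffX eqxx oner_eq0.
exists (x * f); split; first exact/vanishing_idealM/(Imono _ _ ij).
  by rewrite mulf_neq0.
by rewrite mleadM // mleadXm fm submK //; apply/mnm_lepP.
Qed.

Lemma mulmx_dep (m k : nat) (A : 'M[K]_(m, k)) : (k < m)%N ->
  exists2 c : 'rV[K]_m, c != 0 & c *m A = 0.
Proof.
move=> km; have : kermx A != 0.
  by rewrite -mxrank_eq0 mxrank_ker -lt0n subn_gt0 (leq_ltn_trans (rank_leq_col _) km).
case/rowV0Pn => c /sub_kermxP cA c0; by exists c.
Qed.

Lemma fun_dep (I J : finType) (A : I -> J -> K) : (#|J| < #|I|)%N ->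
  exists c : I -> K, (exists i, c i != 0) /\ forall j, \sum_i c i * A i j = 0.
Proof.
move=> JI; pose M : 'M[K]_(#|I|, #|J|) := \matrix_(i, j) A (enum_val i) (enum_val j).
have [c c0 cM] := @mulmx_dep _ _ M JI; exists (fun i => c 0 (enum_rank i)); split.
  case/rV0Pn: c0 => i ci; exists (enum_val i); by rewrite enum_valK.
move=> j; have /rowP/(_ (enum_rank j)) := cM; rewrite !mxE => E; rewrite -[RHS]E.
rewrite (reindex _ (onW_bij _ (enum_val_bij I))) /=; apply: eq_bigr => i _.
by rewrite mxE enum_valK enum_rankK.
Qed.

Lemma mpoly_dep (I : finType) (F : I -> mpoly n K) L :
  (forall i, mmeasure mdeg (F i) <= L)%N -> (#|{: bmultinom n L}| < #|I|)%N ->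
  exists c : I -> K, (exists i, c i != 0) /\ \sum_i c i *: F i = 0.
Proof.
move=> FL LI.
have [c [ci cF]] := @fun_dep I (bmultinom n L) (fun i m => mcoeff m (F i)) LI.
exists c; split=> //; apply/mpolyP => m; rewrite mcoeff0 raddf_sum /=.
under eq_bigr do rewrite mcoeffZ.
have [mL|mL] := ltnP (mdeg m) L; first exact: (cF (BMultinom mL)).
rewrite big1 // => i _; rewrite memN_msupp_eq0 ?mulr0 //.
by apply: msize_mdeg_ge; apply: leq_trans (FL i) mL.
Qed.

Lemma card_bmultinom_le L : (#|{: bmultinom n L}| <= L ^ n)%N.
Proof.
pose f (m : bmultinom n L) : {ffun 'I_n -> 'I_L.-1.+1} := [ffun i => inord (m i)].
have [->|L0] := posnP L.
  rewrite eq_card0 // => m.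
  by have := bmdeg m; rewrite ltn0.
have fi : injective f.
  move=> m1 m2 /ffunP E; apply/val_inj/mnmP => i; have := E i; rewrite !ffunE.
  move/(congr1 val) => /=; rewrite !inordK //.
    by rewrite prednK //; apply: leq_ltn_trans (bmdeg m2); rewrite mdegE (bigD1 i) ?leq_addr.
  by rewrite prednK //; apply: leq_ltn_trans (bmdeg m1); rewrite mdegE (bigD1 i) ?leq_addr.
have := leq_card f fi; rewrite card_ffun !card_ord prednK //.
Qed.

Lemma msizeM_leq (f g : mpoly n K) a b : (mmeasure mdeg f <= a.+1)%N ->
  (mmeasure mdeg g <= b.+1)%N -> (mmeasure mdeg (f * g) <= (a + b).+1)%N.
Proof.
move=> fa gb; have [->|f0] := eqVneq f 0; first by rewrite mul0r mmeasure0.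
have [->|g0] := eqVneq g 0; first by rewrite mulr0 mmeasure0.
rewrite msizeM // -subn1 leq_subLR; apply: leq_trans (leq_add fa gb) _.
by rewrite addSn addnS.
Qed.

Lemma msizeX_leq (f : mpoly n K) a k : (mmeasure mdeg f <= a.+1)%N ->
  (mmeasure mdeg (f ^+ k) <= (k * a).+1)%N.
Proof.
move=> fa; elim: k => [|k IH]; first by rewrite expr0 mmeasure1.
by rewrite exprS mulSn; apply: msizeM_leq.
Qed.

(** A counting argument: the N^e monomials in the f_i with exponents below N have degree at most e N
    M, so they live in a space of dimension at most (e N M + 1)^n, which is less than N^e if e > n
    and N is large. The bound guarantees that a transcendence degree exists. *)
Lemma alg_indep_bound (V : set 'rV[K]_n) e (f : e.-tuple (mpoly n K)) :
  alg_indep_on V f -> (e <= n)%N.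
Proof.
move=> fV; rewrite leqNgt; apply/negP => ne.
pose M := \max_(i < e) mmeasure mdeg (tnth f i).
have fM i : (mmeasure mdeg (tnth f i) <= M.+1)%N.
  by apply: leqW; apply: (@leq_bigmax _ (fun i => mmeasure mdeg (tnth f i))).
(* Chosen so that (N (e M + 1))^n < N^(n+1). *)
pose N := ((e * M).+1 ^ n).+1.
pose L := (e * (N * M)).+1.
pose mon (t : {ffun 'I_e -> 'I_N}) : multinom e := Multinom [tuple val (t i) | i < e].
have monE t i : mon t i = t i by rewrite multinomE tnth_mktuple.
have monI : injective mon.
  by move=> t u E; apply/ffunP => i; apply/val_inj => /=; rewrite -!monE E.
pose F t := comp_mpoly f (mpolyX K (mon t)).
have FL t : (mmeasure mdeg (F t) <= L)%N.
  rewrite /F comp_mpolyX; rewrite (_ : L = (\sum_(i < e) N * M).+1)%N; last first.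
    by rewrite sum_nat_const card_ord.
  apply: (big_rec2 (fun (s : nat) (q : mpoly n K) => mmeasure mdeg q <= s.+1)%N).
    by rewrite mmeasure1.
  move=> i s q _ Hq; apply: msizeM_leq => //; rewrite monE.
  apply: leq_trans (msizeX_leq _ (fM i)) _; rewrite ltnS leq_mul2r.
  by rewrite ltnW ?orbT.
have card : (#|{: bmultinom n L}| < #|{ffun 'I_e -> 'I_N}|)%N.
  rewrite card_ffun !card_ord; apply: leq_ltn_trans (card_bmultinom_le _) _.
  apply: leq_trans (leq_pexp2l _ ne) => //; rewrite expnS.
  apply: (@leq_ltn_trans ((N * (e * M).+1) ^ n)%N).
    have LN : (L <= N * (e * M).+1)%N by rewrite /L mulnCA mulnS -add1n leq_add2r.
    by elim: (n) => // k IH; rewrite !expnS leq_mul.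
  by rewrite expnMn mulnC ltn_pmul2r ?expn_gt0.
have [c [[t ct] cF]] := mpoly_dep FL card.
pose P := \sum_t c t *: mpolyX K (mon t).
apply: (fV P); last first.
  move=> x _; rewrite (_ : comp_mpoly f P = 0) ?peval0 // -cF raddf_sum.
  by apply: eq_bigr => u _; rewrite /= linearZ.
apply/eqP => /mpolyP/(_ (mon t)); rewrite mcoeff0 raddf_sum /= (bigD1 t) //=.
rewrite mcoeffZ mcoeffX eqxx mulr1 big1 ?addr0; first by move/eqP; rewrite (negPf ct).
by move=> u ut; rewrite mcoeffZ mcoeffX (inj_eq monI) (negPf ut) mulr0.
Qed.

(** Otherwise take a minimal algebraic set W in V on which the pair is independent. W is
    irreducible, because relations on two proper pieces would multiply to a relation on W; so W is
    an irreducible subset of dimension at least 2. *)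
Lemma curve_dependent (V : set 'rV[K]_n) (f : 2.-tuple (mpoly n K)) :
  algebraic_set V ->
  (forall W e, irreducible_algebraic_set W -> W `<=` V -> irreducible_dim W e -> (e <= 1)%N) ->
  exists2 P, P != 0 & vanishing_ideal V (comp_mpoly f P).
Proof.
move=> aV dV; apply: contrapT => H.
have fV : alg_indep_on V f by move=> P P0 HP; apply: H; exists P.
have [W [aW fW WV Wmin]] := @algebraic_set_min (fun W => alg_indep_on W f) V aV fV.
have irrW : irreducible_algebraic_set W.
  split=> // -[A [B [aA aB _ [AW BW] WAB]]].
  have dep C : algebraic_set C -> C `<` W ->
      exists2 P, P != 0 & vanishing_ideal C (comp_mpoly f P).
    move=> aC [CW nWC]; apply: contrapT => HC; apply: nWC.
    rewrite (Wmin C) // => P P0 HP; by apply: HC; exists P.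
  have [P P0 PA] := dep A aA AW; have [Q Q0 QB] := dep B aB BW.
  apply: (fW (P * Q)); first by rewrite mulf_neq0.
  move=> x; rewrite WAB rmorphM pevalM => -[/PA|/QB] ->; by rewrite ?mul0r ?mulr0.
pose pe e := `[< exists g : e.-tuple (mpoly n K), alg_indep_on W g >].
have pe2 : exists e, pe e by exists 2; apply/asboolP; exists f.
have peb e : pe e -> (e <= n)%N by move/asboolP => [g]; apply: alg_indep_bound.
case: (ex_maxnP pe2 peb) => e /asboolP [g gW] emax.
have : (e <= 1)%N.
  apply: (dV W) => //; split; first by exists g.
  by move=> e' g' Hg'; apply: emax; apply/asboolP; exists g'.
by rewrite leqNgt (leq_trans _ (emax 2 _)) //; apply/asboolP; exists f.
Qed.

End Ideals.

(** * Generic fibres of an integral projection *)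

Section LyingOver.
Variable K : numClosedFieldType.
Implicit Types (c y z : K).

Definition ev2 c y (Q : {poly {poly K}}) : K := (Q.[y%:P]).[c].

Fact ev2_is_additive c y : additive (ev2 c y).
Proof. by move=> P Q; rewrite /ev2 !(hornerD, hornerN). Qed.
Fact ev2_is_multiplicative c y : multiplicative (ev2 c y).
Proof. by split=> [P Q|]; rewrite /ev2 ?hornerM // !hornerC. Qed.
HB.instance Definition _ c y := GRing.isAdditive.Build _ _ (ev2 c y) (ev2_is_additive c y).
HB.instance Definition _ c y := GRing.isMultiplicative.Build _ _ (ev2 c y) (ev2_is_multiplicative c y).

Lemma ev2C c y a : ev2 c y a%:P = a.[c].
Proof. by rewrite /ev2 hornerC. Qed.

Lemma ev2_map c y Q : ev2 c y Q = (map_poly (horner_eval c) Q).[y].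
Proof.
by rewrite /ev2 -[in RHS](hornerC y c) -/(horner_eval c y%:P) horner_map.
Qed.

Definition ev3 c y z (G : {poly {poly {poly K}}}) : K := (map_poly (ev2 c y) G).[z].

Fact ev3_is_additive c y z : additive (ev3 c y z).
Proof. by move=> P Q; rewrite /ev3 rmorphB !(hornerD, hornerN). Qed.
Fact ev3_is_multiplicative c y z : multiplicative (ev3 c y z).
Proof. by split=> [P Q|]; rewrite /ev3 ?rmorphM ?hornerM // rmorph1 hornerC. Qed.
HB.instance Definition _ c y z := GRing.isAdditive.Build _ _ (ev3 c y z) (ev3_is_additive c y z).
HB.instance Definition _ c y z := GRing.isMultiplicative.Build _ _ (ev3 c y z) (ev3_is_multiplicative c y z).

Lemma ev3B c y z P Q : ev3 c y z (P - Q) = ev3 c y z P - ev3 c y z Q.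
Proof. exact: rmorphB. Qed.
Lemma ev3D c y z P Q : ev3 c y z (P + Q) = ev3 c y z P + ev3 c y z Q.
Proof. exact: rmorphD. Qed.
Lemma ev3M c y z P Q : ev3 c y z (P * Q) = ev3 c y z P * ev3 c y z Q.
Proof. exact: rmorphM. Qed.
Lemma ev2B c y P Q : ev2 c y (P - Q) = ev2 c y P - ev2 c y Q.
Proof. exact: rmorphB. Qed.
Lemma ev2D c y P Q : ev2 c y (P + Q) = ev2 c y P + ev2 c y Q.
Proof. exact: rmorphD. Qed.
Lemma ev2M c y P Q : ev2 c y (P * Q) = ev2 c y P * ev2 c y Q.
Proof. exact: rmorphM. Qed.

Lemma ev3C c y z Q : ev3 c y z Q%:P = ev2 c y Q.
Proof. by rewrite /ev3 map_polyC hornerC. Qed.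

Lemma ev3X c y z : ev3 c y z 'X = z.
Proof. by rewrite /ev3 map_polyX hornerX. Qed.

Variable V : K -> K -> K -> Prop.
Definition van3 G := forall c y z, V c y z -> ev3 c y z G = 0.
Definition van2 Q := forall c y z, V c y z -> ev2 c y Q = 0.
Hypothesis V_closed : forall c y z, (forall G, van3 G -> ev3 c y z G = 0) -> V c y z.

(** At (c, y) the ideal of V specialises to an ideal of K[z]. If its generator is not constant, a
    root of it gives the point. If some G specialises to 1, eliminating z from M and a modification
    of G by a resultant yields an element of [van2] that is non-zero at (c, y). *)
Lemma lying_over M c y : M \is monic -> van3 M ->
  (forall N, van2 N -> ev2 c y N = 0) -> exists z, V c y z.
Proof.
move=> monM vM vN; apply: contrapT => noz.
pose sp G := map_poly (ev2 c y) G.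
have spB P Q : sp (P - Q) = sp P - sp Q by exact: rmorphB.
have spD P Q : sp (P + Q) = sp P + sp Q by exact: rmorphD.
have spMu P Q : sp (P * Q) = sp P * sp Q by exact: rmorphM.
have lcM : ev2 c y (lead_coef M) != 0 by rewrite (monicP monM) rmorph1 oner_eq0.
have spM : size (sp M) = size M by apply: size_map_poly_id0.
have monsp : sp M \is monic by apply: monic_map.
have [G vG G1] : exists2 G, van3 G & sp G = 1.
  pose pJ k := `[< exists G, [/\ van3 G, sp G != 0 & size (sp G) = k] >].
  have exJ : exists k, pJ k.
    by exists (size (sp M)); apply/asboolP; exists M; split=> //; apply: monic_neq0.
  case: (ex_minnP exJ) => k /asboolP [G0 [vG0 q0 sq]] kmin.
  set q := sp G0 in q0 sq.
  pose lift (p : {poly K}) : {poly {poly {poly K}}} := map_poly (fun a => a%:P%:P) p.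
  have splift p : sp (lift p) = p.
    rewrite /sp /lift -map_poly_comp; apply: map_poly_id => a _ /=.
    by rewrite ev2C hornerC.
  have qdvd G : van3 G -> q %| sp G.
    move=> vG; apply/eqP; apply: contrapT => /eqP r0.
    have : pJ (size (sp G %% q)).
      apply/asboolP; exists (G - lift (sp G %/ q) * G0).
      have E : sp (G - lift (sp G %/ q) * G0) = sp G %% q.
        by rewrite spB spMu splift -/q {1}[sp G](divp_eq _ q) addrAC subrr add0r.
      split; rewrite ?E // => c' y' z' V'.
      by rewrite ev3B ev3M vG // vG0 // mulr0 subr0.
    by move/kmin; rewrite leqNgt -sq ltn_modp q0.
  have [s1|s1] := eqVneq (size q) 1; last first.
    have /closed_rootP [z /rootP qz] := s1.
    exfalso; apply: noz; exists z; apply: V_closed => G /qdvd /dvdpP [p E].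
    by rewrite /ev3 -/(sp G) E hornerM qz mulr0.
  have /eqP/size_poly1P [a a0 qa] := s1.
  exists ((a^-1)%:P%:P%:P * G0); first by move=> c' y' z' V'; rewrite ev3M vG0 ?mulr0.
  by rewrite spMu -/q qa /sp map_polyC /= ev2C hornerC -polyCM mulVf.
have M1 : (1 < size M)%N.
  rewrite ltnNge; apply/negP => M1.
  have eM : M = 1.
    by have := monicP monM; rewrite (size1_polyC M1) lead_coefC => ->.
  have : ev2 c y 1 = 0.
    by apply: vN => c' y' z' /vM; rewrite eM !rmorph1.
  by rewrite rmorph1 => /eqP; rewrite oner_eq0.
(* Adding this multiple of M makes G' monic in z, so that the resultant commutes with
   specialisation, and keeps its specialisation coprime to that of M. *)
pose k := size G; pose G' := G + 'X^k * M.
have sXM : size ('X^k * M) = (k + size M)%N.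
  by rewrite size_monicM ?monicXn ?monic_neq0 // size_polyXn.
have ltG : (size G < k + size M)%N by rewrite -/k; lia.
have sG' : size G' = (k + size M)%N by rewrite /G' addrC size_polyDl sXM.
have lG' : lead_coef G' = 1.
  by rewrite /G' addrC lead_coefDl ?sXM // lead_coef_Mmonic // lead_coefXn.
have vG' : van3 G' by move=> c' y' z' V'; rewrite /G' ev3D ev3M vG // vM // mulr0 addr0.
have G'1 : (1 < size G')%N by rewrite sG'; lia.
have [uv _ Huv] := resultant_in_ideal M1 G'1.
pose N := resultant M G'.
have vN' : van2 N.
  move=> c' y' z' V'; rewrite -(ev3C _ _ z') Huv ev3D !ev3M.
  by rewrite vM // vG' // !mulr0 addr0.
have := vN _ vN'; rewrite /N map_resultant //; last by rewrite lG' rmorph1 oner_eq0.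
move/eqP; rewrite resultant_eq0 -/(sp M) -/(sp G').
rewrite spD spMu G1.
rewrite ltnNge; move/negP; apply; rewrite leq_eqVlt; apply/orP; left.
rewrite -[_ == _]/(coprimep _ _) coprimep_sym; apply/coprimepP => d.
move=> d1 d2; by rewrite -size_poly_eq1 -dvdp1 -(dvdp_addl _ (dvdp_mull (sp 'X^k) d2)).
Qed.

Variable Q0 : {poly {poly K}}.
Hypotheses (Q0_neq0 : Q0 != 0) (Q0_van : van2 Q0)
  (Q0_min : forall Q, Q != 0 -> van2 Q -> (size Q0 <= size Q)%N).

Lemma ev2Z c y a Q : ev2 c y (a *: Q) = a.[c] * ev2 c y Q.
Proof. by rewrite -mul_polyC ev2M ev2C. Qed.

(** The pseudo-remainder of N by Q0 vanishes on V and has smaller degree, hence is zero by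
    minimality. *)
Lemma min_vanish N c y : van2 N -> (lead_coef Q0).[c] != 0 -> ev2 c y Q0 = 0 ->
  ev2 c y N = 0.
Proof.
move=> vN lc Q0y; have E := Pdiv.Idomain.divp_eq N Q0.
have r0 : N %% Q0 = 0.
  apply/eqP; apply: contrapT => /negP r0.
  have : van2 (N %% Q0).
    move=> c' y' z' V'.
    have -> : N %% Q0 = lead_coef Q0 ^+ scalp N Q0 *: N - N %/ Q0 * Q0.
      by rewrite E addrAC subrr add0r.
    by rewrite ev2B ev2Z ev2M (vN _ _ z') // (Q0_van (z := z')) // !mulr0 subr0.
  by move/(Q0_min r0); rewrite leqNgt ltn_modp Q0_neq0.
move/(congr1 (ev2 c y)): E; rewrite r0 addr0 ev2Z ev2M Q0y mulr0 => /eqP.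
by rewrite mulf_eq0 horner_exp expf_eq0 (negPf lc) andbF => /eqP.
Qed.

(** If y were not a root of h, it would have the same multiplicity m > 0 in g and q, but only m - 1
    in the derivative of q, which g divides. *)
Lemma root_sqfree_part (g h q : {poly K}) y : g != 0 -> q = g * h ->
  g %| q^`() -> root q y -> root h y.
Proof.
move=> g0 qgh gq' qy; apply: contraT => hy.
have [m [g1 g1y eg]] := multiplicity_XsubC g y; rewrite g0 /= in g1y.
case: m => [|m] in eg.
  by move: qy; rewrite qgh eg expr0 mulr1 rootM (negPf g1y) (negPf hy).
have /dvdp_trans/(_ gq') : ('X - y%:P) ^+ m.+1 %| g by rewrite eg dvdp_mull.
rewrite (_ : q^`() = ('X - y%:P) ^+ m.+1 * (g1 * h)^`() +
    ('X - y%:P) ^+ m * (g1 * h *+ m.+1)); last first.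
  have -> : q = (g1 * h) * ('X - y%:P) ^+ m.+1 by rewrite qgh eg mulrAC.
  rewrite (derivM (g1 * h)) (deriv_exp _ m.+1) derivXsubC mul1r /=.
  by rewrite mulrC [in RHS]mulrnAr mulrnAr [_ ^+ m * _]mulrC.
rewrite dvdp_addr; last by rewrite dvdp_mulr.
rewrite exprSr dvdp_mul2l ?expf_neq0 ?polyXsubC_eq0 //.
rewrite dvdp_XsubCl rootE hornerMn hornerM mulrn_eq0 /= mulf_eq0.
by rewrite -!rootE (negPf g1y) (negPf hy).
Qed.

(** Q0 is squarefree in y: otherwise its quotient by the gcd with its derivative would be of smaller
    degree and, up to a factor in x, still vanish on V. *)
Lemma min_resultant : (1 < size Q0)%N -> resultant Q0 Q0^`() != 0.
Proof.
move=> Q01; rewrite resultant_eq0 -leqNgt; apply: contraT; rewrite -ltnNge => G1.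
set G := gcdp _ _ in G1; set H := Q0 %/ G.
have G0 : G != 0 by apply: contraTneq G1 => ->; rewrite size_poly0.
have /eqP E1 : lead_coef G ^+ scalp Q0 G *: Q0 == H * G.
  by rewrite -Pdiv.Idomain.dvdp_eq dvdp_gcdl.
have /eqP E2 : lead_coef G ^+ scalp Q0^`() G *: Q0^`() == Q0^`() %/ G * G.
  by rewrite -Pdiv.Idomain.dvdp_eq dvdp_gcdr.
have lG0 : lead_coef G != 0 by rewrite lead_coef_eq0.
have HG : size (H * G) = size Q0 by rewrite -E1 size_scale ?expf_neq0.
have H0 : H != 0.
  by apply: contraTneq Q01 => H0; rewrite -HG H0 mul0r size_poly0.
have sH : (size H < size Q0)%N.
  rewrite -HG size_mul //; case: (size G) G1 => [|[|k]] // _.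
  by rewrite !addnS /= ltnS leq_addr.
(* The factor covers the values of c at which the leading coefficient of G vanishes; elsewhere G
   specialises to a non-zero polynomial and [root_sqfree_part] applies. *)
have : van2 (lead_coef G *: H).
  move=> c y z Vcyz; rewrite ev2Z.
  have [->|lGc] := eqVneq (lead_coef G).[c] 0; first by rewrite mul0r.
  rewrite ev2_map; pose sp Q := map_poly (horner_eval c) Q.
  have spM (P Q : {poly {poly K}}) : sp (P * Q) = sp P * sp Q by exact: rmorphM.
  have spZ (a : {poly K}) (Q : {poly {poly K}}) : sp (a *: Q) = a.[c] *: sp Q.
    by rewrite -[a *: Q]mul_polyC spM {1}/sp map_polyC mul_polyC.
  have gc0 : sp G != 0 by rewrite map_poly_eq0_id0.
  have lx k : ((lead_coef G) ^+ k).[c] != 0 by rewrite horner_exp expf_neq0.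
  have : root (sp H) y.
    apply: (@root_sqfree_part (sp G) _ (sp G * sp H)) => //.
      rewrite mulrC -spM -E1 spZ derivZ deriv_map -/(sp _) dvdpZr //.
      by rewrite -(@dvdpZr _ (((lead_coef G) ^+ scalp Q0^`() G).[c])) // -spZ E2 spM dvdp_mull.
    rewrite mulrC -spM -E1 spZ rootZ // rootE /sp -ev2_map.
    by rewrite (Q0_van (z := z)).
  by rewrite rootE => /eqP ->; rewrite mulr0.
have lGH : lead_coef G *: H != 0 by rewrite -size_poly_eq0 size_scale // size_poly_eq0.
by move/(Q0_min lGH); rewrite size_scale // leqNgt sH.
Qed.

(* Over a generic c, the polynomial Q0 has size Q0 - 1 simple roots, and each of
   them lifts to a point of V by integrality. *)
Lemma generic_fiber M : M \is monic -> van3 M ->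
  exists2 s : {poly K}, s != 0 & forall c, s.[c] != 0 ->
    exists ys : seq K, [/\ uniq ys, size ys = (size Q0).-1 &
      forall y, y \in ys -> exists z, V c y z].
Proof.
move=> monM vM; have [Q01|Q01] := ltnP 1 (size Q0); last first.
  exists 1; first exact: oner_neq0.
  by move=> c _; exists [::]; split=> //=; move: Q01; case: (size Q0) => [|[]].
have R0 := min_resultant Q01.
have D0 : Q0^`() != 0.
  apply: contraNneq R0 => D0; rewrite resultant_eq0 D0 gcdp0 //.
exists (lead_coef Q0 * lead_coef Q0^`() * resultant Q0 Q0^`()).
  by rewrite !mulf_neq0 // lead_coef_eq0.
move=> c; rewrite !hornerM !mulf_eq0 !negb_or => /andP[/andP[l1 l2] r0].
pose q := map_poly (horner_eval c) Q0.
have sq : size q = size Q0 by apply: size_map_poly_id0.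
have q0 : q != 0 by rewrite -size_poly_eq0 sq size_poly_eq0.
have sepq : separable_poly q.
  rewrite separable_poly.unlock /coprimep deriv_map.
  move: r0; rewrite -/(horner_eval c _) map_resultant // resultant_eq0.
  rewrite -leqNgt => le1; rewrite eqn_leq le1 size_poly_gt0 gcdp_eq0 negb_and.
  by rewrite q0.
have [r Er] := closed_field_poly_normal q.
have lq : lead_coef q != 0 by rewrite lead_coef_eq0.
exists r; split.
- by rewrite -separable_prod_XsubC -(eqp_separable (eqp_scale _ lq)) -Er.
- by rewrite -sq Er size_scale // size_prod_XsubC.
move=> y yr; apply: (lying_over monM vM) => N vN; apply: min_vanish => //.
apply/eqP; rewrite ev2_map -rootE -/q Er rootZ //.
by rewrite root_prod_XsubC.
Qed.

End LyingOver.

(** * Spans of functions and integrality with degree control *)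

Section FunctionSpan.
Variables (K : fieldType) (T : Type) (D : set T).
Implicit Types (B : set (T -> K)) (f g h : T -> K).

(** Equality on [D] with a finite linear combination of elements of [B], in a form that permits
    induction on the combination. *)
Inductive fspan B : (T -> K) -> Prop :=
| fspan0 f : (forall x, D x -> f x = 0) -> fspan B f
| fspanS a b g f : B b -> fspan B g -> (forall x, D x -> f x = a * b x + g x) -> fspan B f.

Lemma fspan_ext B f g : fspan B f -> (forall x, D x -> g x = f x) -> fspan B g.
Proof.
case=> {f} [f f0|a b h f Bb Bh E] H; first by apply: fspan0 => x Dx; rewrite H // f0.
by apply: (fspanS (a := a) Bb Bh) => x Dx; rewrite H // E.
Qed.

Lemma fspan_lin B a f g : fspan B f -> fspan B g -> fspan B (fun x => a * f x + g x).
Proof.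
move=> Bf Bg; elim: Bf => {f} [f f0|c b h f Bb _ IH E].
  by apply: fspan_ext Bg _ => x Dx; rewrite f0 // mulr0 add0r.
apply: (fspanS (a := a * c) Bb IH) => x Dx.
by rewrite E // mulrDr addrA mulrA.
Qed.

Lemma fspanD B f g : fspan B f -> fspan B g -> fspan B (fun x => f x + g x).
Proof.
move=> Bf Bg; apply: fspan_ext (fspan_lin 1 Bf Bg) _ => x _; by rewrite mul1r.
Qed.

Lemma fspanZ B a f : fspan B f -> fspan B (fun x => a * f x).
Proof.
move=> Bf; apply: fspan_ext (fspan_lin a Bf (fspan0 (f := fun=> 0) B _)) _ => // x _.
by rewrite addr0.
Qed.

Lemma fspan_mem B b : B b -> fspan B b.
Proof.
move=> Bb; apply: (fspanS (a := 1) Bb (fspan0 (f := fun=> 0) B _)) => // x _.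
by rewrite mul1r addr0.
Qed.

Lemma fspan_sum B (I : Type) (r : seq I) (P : pred I) (F : I -> T -> K) :
  (forall i, P i -> fspan B (F i)) -> fspan B (fun x => \sum_(i <- r | P i) F i x).
Proof.
move=> BF; elim: r => [|i r IH]; first by apply: fspan0 => x _; rewrite big_nil.
case Pi: (P i); last by apply: fspan_ext IH _ => x _; rewrite big_cons Pi.
by apply: fspan_ext (fspanD (BF i Pi) IH) _ => x _; rewrite big_cons Pi.
Qed.

Lemma fspan_mul B B' m f : (forall b, B b -> fspan B' (fun x => m x * b x)) ->
  fspan B f -> fspan B' (fun x => m x * f x).
Proof.
move=> BB; elim=> {f} [f f0|a b g f Bb _ IH E].
  by apply: fspan0 => x Dx; rewrite f0 ?mulr0.
apply: fspan_ext (fspan_lin a (BB b Bb) IH) _ => x Dx.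
by rewrite E // mulrDr mulrCA.
Qed.

Lemma fspan_sub B B' f : (forall b, B b -> fspan B' b) -> fspan B f -> fspan B' f.
Proof.
move=> BB Bf; apply: fspan_ext (@fspan_mul B B' (fun=> 1) f _ Bf) _ => [b Bb|x _].
  by apply: fspan_ext (BB b Bb) _ => x _; rewrite mul1r.
by rewrite mul1r.
Qed.

Lemma fspan_coord (I : finType) (b : I -> T -> K) f :
  fspan (range b) f -> exists c : I -> K, forall x, D x -> f x = \sum_i c i * b i x.
Proof.
elim=> {f} [f f0|a _ g f [i _ <-] _ [c Hc] E].
  by exists (fun=> 0) => x Dx; rewrite f0 // big1 // => i _; rewrite mul0r.
exists (fun j => c j + a * (j == i)%:R) => x Dx; rewrite E // Hc // addrC.
under [RHS]eq_bigr do rewrite mulrDl.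
rewrite big_split /=; congr (_ + _); rewrite (bigD1 i) //= eqxx mulr1 big1 ?addr0 //.
by move=> j /negPf ->; rewrite mulr0 mul0r.
Qed.

(** All monomials of degree at most k except w^k. That w^k lies in their span says that w is
    integral over u through a relation whose total degree is k, so reducing by it never raises
    degrees. *)
Definition low_monomials (u w : T -> K) k : set (T -> K) :=
  [set b | exists i j, [/\ (i + j <= k)%N, (j < k)%N & b = fun x => u x ^+ i * w x ^+ j]].

Lemma low_monomialsS (u w : T -> K) k l : (k <= l)%N ->
  low_monomials u w k `<=` low_monomials u w l.
Proof.
move=> kl b [i [j [ijk jk ->]]]; exists i, j; split=> //; first exact: leq_trans kl.
exact: leq_trans kl.
Qed.

End FunctionSpan.

Definition row2 (K : Type) (a b : K) : 'rV[K]_2 := \row_i (if i == ord0 then a else b).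

Section Integrality.
Variables (K : numFieldType) (T : Type) (D : set T).

(** Noether normalisation by a linear change of variables: for generic s, the relation P becomes
    monic in y2 up to a constant, without increase of degree. *)
Lemma generic_integral (y1 y2 : T -> K) (P : mpoly 2 K) : P != 0 ->
  (forall x, D x -> peval P (row2 (y1 x) (y2 x)) = 0) ->
  exists2 r : {poly K}, r != 0 & forall s, r.[s] != 0 ->
    exists E, fspan D (low_monomials (fun x => y1 x + s * y2 x) y2 E.+1)
      (fun x => y2 x ^+ E.+1).
Proof.
move=> P0 PD; pose E := mdeg (mlead P).
(* r.[s] is the coefficient of y2 ^ E in P (u - s * y2, y2), where u = y1 + s * y2. *)
pose r : {poly K} := \sum_(m <- msupp P | mdeg m == E)
  (mcoeff m P * (-1) ^+ m ord0) *: 'X^(m ord0).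
exists r.
  apply/eqP => /polyP/(_ (mlead P ord0)); rewrite coef0 /r coef_sum.
  rewrite -big_filter (bigD1_seq (mlead P)) ?filter_uniq ?msupp_uniq ?mem_filter ?eqxx ?mlead_supp //=.
  rewrite coefZ coefXn eqxx mulr1 big1_seq ?addr0.
    by move/eqP; rewrite mulf_eq0 signr_eq0 orbF mleadc_eq0 (negPf P0).
  move=> m; rewrite mem_filter => /andP[mP /andP[/eqP mE _]]; rewrite coefZ coefXn.
  case: eqP => [e|]; rewrite ?mulr0 //; exfalso; move/eqP: mP; apply.
  apply/mnmP => i; move: mE; rewrite /E !mdegE !big_ord_recl !big_ord0 !addn0.
  rewrite -e => /addnI e1; case: (unliftP ord0 i) => [j ->|-> //].
  by rewrite (ord1 j) e1.
move=> s rs; exists E.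
set u := fun x => y1 x + s * y2 x; set w := y2.
have Su k f : fspan D (low_monomials u w k) f ->
    fspan D (low_monomials u w k.+1) (fun x => u x * f x).
  apply: fspan_mul => _ [i [j [ijk jk ->]]]; apply: fspan_mem.
  exists i.+1, j; split; [lia|lia|].
  by apply/funext => x; rewrite exprS mulrA.
have Sw k f : fspan D (low_monomials u w k) f ->
    fspan D (low_monomials u w k.+1) (fun x => w x * f x).
  apply: fspan_mul => _ [i [j [ijk jk ->]]]; apply: fspan_mem.
  exists i, j.+1; split; [lia|lia|].
  by apply/funext => x; rewrite exprS mulrCA.
(* Modulo lower monomials y1 equals -s w, since u is one of them in each degree. *)
have mono i j : fspan D (low_monomials u w (i + j))
    (fun x => y1 x ^+ i * y2 x ^+ j - (- s) ^+ i * w x ^+ (i + j)).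
  elim: i => [|i IH].
    by apply: fspan0 => x _; rewrite !expr0 !mul1r subrr.
  have uw : fspan D (low_monomials u w (i.+1 + j)) (fun x => u x * w x ^+ (i + j)).
    apply: fspan_mem; exists 1%N, (i + j)%N; split; [lia|lia|].
    by apply/funext => x; rewrite expr1.
  have := fspanD (fspanZ ((- s) ^+ i) uw) (fspanD (Su _ _ IH) (fspanZ (- s) (Sw _ _ IH))).
  move/fspan_ext; apply => x _; rewrite /u /w !exprS; ring.
have low m : m \in msupp P -> mdeg m != E -> fspan D (low_monomials u w E)
    (fun x => y1 x ^+ m ord0 * y2 x ^+ m (lift ord0 ord0)).
  move=> mP mE; have lt : (mdeg m < E)%N.
    by rewrite ltn_neqAle mE; apply/lemc_mdeg/msupp_le_mlead.
  have e : mdeg m = (m ord0 + m (lift ord0 ord0))%N.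
    by rewrite mdegE !big_ord_recl big_ord0 addn0.
  have wm : fspan D (low_monomials u w E) (fun x => w x ^+ mdeg m).
    apply: fspan_mem; exists 0%N, (mdeg m); split=> //; first by rewrite add0n ltnW.
    by apply/funext => x; rewrite expr0 mul1r.
  have := mono (m ord0) (m (lift ord0 ord0)); rewrite -e => Hm.
  have Hm' : fspan D (low_monomials u w E) (fun x => y1 x ^+ m ord0 *
      y2 x ^+ m (lift ord0 ord0) - (- s) ^+ m ord0 * w x ^+ mdeg m).
    by apply: fspan_sub Hm => b /(low_monomialsS (ltnW lt)); apply: fspan_mem.
  apply: fspan_ext (fspanD Hm' (fspanZ ((- s) ^+ m ord0) wm)) _ => x _.
  by rewrite subrK.
have wE : fspan D (low_monomials u w E) (fun x => - r.[s] * w x ^+ E).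
  have H1 : fspan D (low_monomials u w E) (fun x => \sum_(m <- msupp P | mdeg m == E)
     (mcoeff m P * (y1 x ^+ m ord0 * y2 x ^+ m (lift ord0 ord0) -
      (- s) ^+ m ord0 * w x ^+ E))).
    apply: fspan_sum => m /eqP mE; apply: fspanZ.
    have := mono (m ord0) (m (lift ord0 ord0)).
    by rewrite -mE mdegE !big_ord_recl big_ord0 addn0.
  have H2 : fspan D (low_monomials u w E) (fun x =>
     \sum_(m <- msupp P | (mdeg m != E) && (m \in msupp P))
     (mcoeff m P * (y1 x ^+ m ord0 * y2 x ^+ m (lift ord0 ord0)))).
    by apply: fspan_sum => m /andP[mE mP]; apply/fspanZ/low.
  apply: fspan_ext (fspanD H1 H2) _.
  move=> x Dx; have := PD x Dx; rewrite /peval mevalE.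
  under eq_bigr do rewrite !big_ord_recl big_ord0 mulr1 !mxE /=.
  rewrite (bigID (fun m => mdeg m == E)) /= => e.
  rewrite -[LHS]addr0 -[X in _ + X]e addrA; congr (_ + _); last first.
    rewrite [RHS]big_mkcondr /= [LHS]big_seq_cond [RHS]big_seq_cond.
    by apply: eq_big => [m|m /andP[-> _]] //; rewrite andbC.
  rewrite /r horner_sum -sumrN mulr_suml -big_split /=; apply: eq_bigr => m /eqP mE.
  rewrite hornerZ hornerXn [(- s) ^+ _]exprNn.
  move: (mcoeff m P) ((-1) ^+ m ord0) (s ^+ m ord0) (w x ^+ E) (y1 x ^+ _) (y2 x ^+ _).
  by move=> a1 a2 a3 a4 a5 a6; rewrite mulrBr addrC mulNr !mulrA.
have {}wE : fspan D (low_monomials u w E) (fun x => w x ^+ E).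
  apply: fspan_ext (fspanZ (- r.[s])^-1 wE) _ => x _.
  by rewrite mulKf // oppr_eq0.
(* E may be 0; one more factor w makes the exponent positive. *)
by apply: fspan_ext (Sw _ _ wE) _ => x _; rewrite exprS.
Qed.

End Integrality.

(** * Polynomials of bounded degree on a complex curve *)

Section CurveDim.
Variables (K : numClosedFieldType).

Lemma poly_nonroot (q : {poly K}) : q != 0 -> exists c, q.[c] != 0.
Proof.
move=> q0; apply: contrapT => H; move/eqP: q0; apply; apply: poly_horner0 => t.
by apply/eqP; apply: contrapT => /negP Ht; apply: H; exists t.
Qed.

(** Take a relation Q between u and w of least degree in w. By [generic_fiber], over a generic value
    c of u it has that many distinct roots w, each the image of a point of V in the plane u = c.
    Such a plane contains at most d points of V. *)
Lemma fiber_bound (V : set 'rV[K]_3) (u w z : 'rV[K]_3 -> K) (pt : K -> K -> K -> 'rV[K]_3)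
  (h : 'I_3 -> {poly {poly {poly K}}}) (E d : nat) (P : mpoly 2 K) (g : {poly K}) :
  algebraic_set V ->
  (forall c y t, [/\ u (pt c y t) = c, w (pt c y t) = y & z (pt c y t) = t]) ->
  (forall x, pt (u x) (w x) (z x) = x) ->
  (forall c y t i, ev3 c y t (h i) = pt c y t 0 i) ->
  P != 0 -> (forall x, V x -> peval P (row2 (u x) (w x)) = 0) ->
  fspan V [set b | exists beta j, (j < E)%N /\ b = fun x => ev2 (u x) (w x) beta * z x ^+ j]
    (fun x => z x ^+ E) ->
  g != 0 ->
  (forall c, g.[c] != 0 -> forall s, uniq s -> (forall x, x \in s -> V x /\ u x = c) ->
    (size s <= d)%N) ->
  exists Q : {poly {poly K}}, [/\ Q != 0, (size Q <= d.+1)%N &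
    forall x, V x -> ev2 (u x) (w x) Q = 0].
Proof.
move=> [s Vs] ptP ptK hE P0 PV zint g0 gV.
pose V' c y t := V (pt c y t).
have V'P x : V x <-> V' (u x) (w x) (z x) by rewrite /V' ptK.
have V'closed c y t : (forall G, van3 V' G -> ev3 c y t G = 0) -> V' c y t.
  move=> H; rewrite /V' Vs /= => p ps.
  pose G := mmap (@polyC {poly {poly K}} \o (@polyC {poly K} \o @polyC K)) h p.
  have GE c' y' t' : ev3 c' y' t' G = peval p (pt c' y' t').
    rewrite /G; move: (p); apply: mpoly_ringind => [a|i|p1 p2 H1 H2|p1 p2 H1 H2].
    - by rewrite mmapC /= ev3C ev2C hornerC pevalC.
    - by rewrite mmapX mmap1U hE pevalXU.
    - by rewrite mmapD ev3D H1 H2 pevalD.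
    - by rewrite rmorphM ev3M H1 H2 pevalM.
  by rewrite -GE; apply: H => c' y' t'; rewrite GE /V' Vs /=; apply.
have [M monM vM] : exists2 M, M \is monic & van3 V' M.
  have [Q [sQ HQ]] : exists Q : {poly {poly {poly K}}}, (size Q <= E)%N /\
      forall x, V x -> z x ^+ E = ev3 (u x) (w x) (z x) Q.
    suff H f : fspan V [set b | exists beta j, (j < E)%N /\
          b = fun x => ev2 (u x) (w x) beta * z x ^+ j] f ->
        exists Q : {poly {poly {poly K}}}, (size Q <= E)%N /\
          forall x, V x -> f x = ev3 (u x) (w x) (z x) Q by exact: H zint.
    elim=> {f} [f f0|a b f' f [beta [j [jE ->]]] _ [Q [sQ HQ]] Hf].
      exists 0; split; first by rewrite size_poly0.
      by move=> x Vx; rewrite f0 // rmorph0.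
    exists (a%:P%:P *: (beta *: 'X^j) + Q); split.
      apply: (leq_trans (size_polyD _ _)); rewrite geq_max sQ andbT.
      by do 2!apply: (leq_trans (size_scale_leq _ _)); rewrite size_polyXn.
    move=> x Vx; rewrite Hf // HQ // ev3D; congr (_ + _).
    rewrite -(mul_polyC a%:P%:P) -mul_polyC !ev3M !ev3C ev2C hornerC.
    by rewrite [ev3 _ _ _ 'X^j]rmorphXn /= ev3X.
  exists ('X^E - Q); first by rewrite monicE lead_coefDl ?lead_coefXn // size_polyXn size_polyN.
  move=> c y t V't; have [e1 e2 e3] := ptP c y t.
  by have := HQ _ V't; rewrite e1 e2 e3 ev3B rmorphXn /= ev3X => ->; rewrite subrr.
have [Q' Q'0 vQ'] : exists2 Q, Q != 0 & van2 V' Q.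
  pose Q := mmap (@polyC {poly K} \o @polyC K) (fun i => if i == ord0 then 'X%:P else 'X) P.
  have QE c y : ev2 c y Q = peval P (row2 c y).
    rewrite /Q; move: (P); apply: mpoly_ringind => [a|i|p1 p2 H1 H2|p1 p2 H1 H2].
    - by rewrite mmapC /= ev2C hornerC pevalC.
    - rewrite mmapX mmap1U pevalXU mxE; case: eqP => _; first by rewrite ev2C hornerX.
      by rewrite /ev2 hornerX hornerC.
    - by rewrite mmapD ev2D H1 H2 pevalD.
    - by rewrite rmorphM ev2M H1 H2 pevalM.
  exists Q; last by move=> c y t /PV; have [-> -> _] := ptP c y t; rewrite QE.
  apply: contra_neq P0 => Q0; apply: peval_inj0 => x.
  have -> : x = row2 (x 0 ord0) (x 0 (lift ord0 ord0)).
    apply/rowP => i; rewrite mxE; case: eqP => [-> //|].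
    by case: (unliftP ord0 i) => [j ->|-> //] _; rewrite (ord1 j).
  by rewrite -QE Q0 rmorph0.
have exQ : exists k, `[< exists Q, [/\ Q != 0, van2 V' Q & size Q = k] >].
  by exists (size Q'); apply/asboolP; exists Q'.
case: (ex_minnP exQ) => k /asboolP [Q [Q0 vQ sQ]] kmin.
have Qmin Q1 : Q1 != 0 -> van2 V' Q1 -> (size Q <= size Q1)%N.
  by move=> Q10 vQ1; rewrite sQ; apply: kmin; apply/asboolP; exists Q1.
exists Q; split=> //; last by move=> x /V'P/vQ.
have [r r0 Hr] := generic_fiber V'closed Q0 vQ Qmin monM vM.
have [c] := poly_nonroot (mulf_neq0 r0 g0).
rewrite hornerM mulf_eq0 negb_or => /andP[rc gc].
have [ys [uys sys Hys]] := Hr c rc.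
have /choice [t Ht] : forall y, exists t, y \in ys -> V' c y t.
  by move=> y; case: (boolP (y \in ys)) => [/Hys [t Vt]|_]; [exists t|exists 0].
have := gV c gc [seq pt c y (t y) | y <- ys].
rewrite size_map sys => H; apply: leq_trans (leqSpred _) _; rewrite ltnS; apply: H.
  rewrite map_inj_uniq // => y1 y2 /(congr1 w).
  by have [_ -> _] := ptP c y1 (t y1); have [_ -> _] := ptP c y2 (t y2).
by move=> x /mapP [y yys ->]; split; [exact: Ht|have [] := ptP c y (t y)].
Qed.

End CurveDim.

Section CurveDim.
Variables (K : numClosedFieldType).

Lemma ev2_sum (c y : K) (Q : {poly {poly K}}) d : (size Q <= d)%N ->
  ev2 c y Q = \sum_(j < d) (Q`_j).[c] * y ^+ j.
Proof.
move=> sQ; rewrite ev2_map (@horner_coef_wide _ d).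
  by apply: eq_bigr => j _; rewrite coef_map.
by apply: leq_trans (size_poly _ _) _.
Qed.

(** Pseudo-division of each w^j by Q; a single power of the leading coefficient of Q serves as
    denominator for all j < N. *)
Lemma reduce_powers (T : Type) (D : set T) (u w : T -> K) (Q : {poly {poly K}}) d N :
  Q != 0 -> (size Q <= d.+1)%N -> (forall x, D x -> ev2 (u x) (w x) Q = 0) ->
  exists (r : {poly K}) (B : nat) (a : nat -> nat -> {poly K}), [/\ r != 0,
    forall j k, (j < N)%N -> (k < d)%N -> (size (a j k) <= B)%N &
    forall j x, (j < N)%N -> D x ->
      r.[u x] * w x ^+ j = \sum_(k < d) (a j k).[u x] * w x ^+ k].
Proof.
move=> Q0 sQ QD.
pose e (j : nat) := scalp ('X^j) Q; pose rem (j : nat) := ('X^j : {poly {poly K}}) %% Q.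
pose l := lead_coef Q; have l0 : l != 0 by rewrite lead_coef_eq0.
pose S := (\sum_(j < N) e j)%N.
pose a (j k : nat) := l ^+ (S - e j) * (rem j)`_k.
exists (l ^+ S), (\max_(j < N) \max_(k < d) size (a j k)), a; split.
- by rewrite expf_neq0.
- move=> j k jN kd; apply: (@leq_trans (\max_(k < d) size (a (Ordinal jN) k))).
    exact: (@leq_bigmax _ (fun k : 'I_d => size (a (Ordinal jN) k)) (Ordinal kd)).
  exact: (@leq_bigmax _ (fun j : 'I_N => \max_(k < d) size (a j k)) (Ordinal jN)).
move=> j x jN Dx.
have eS : (e j <= S)%N by rewrite /S (bigD1 (Ordinal jN)) //= leq_addr.
have := Pdiv.Idomain.divp_eq ('X^j : {poly {poly K}}) Q.
move/(congr1 (ev2 (u x) (w x))); rewrite ev2D ev2M QD // mulr0 add0r ev2Z.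
rewrite [ev2 _ _ 'X^j]/ev2 hornerXn -polyC_exp hornerC => E.
rewrite -(subnK eS) exprD hornerM -mulrA E (@ev2_sum _ _ _ d); last first.
  by rewrite -ltnS (leq_trans _ sQ) // ltn_modp.
by rewrite mulr_sumr; apply: eq_bigr => k _; rewrite /a hornerM mulrA.
Qed.

(** Multiplication by a coordinate raises the degree of a spanning monomial by one, and the
    integrality relations then lower large powers of w and z without raising the degree again. So
    the exponent of u stays at most n while those of w and z stay bounded. *)
Lemma curve_span (D : set 'rV[K]_3) (u w z : 'rV[K]_3 -> K) (s : K) (Ew Ez : nat) :
  fspan D (low_monomials u w Ew.+1) (fun x => w x ^+ Ew.+1) ->
  fspan D (low_monomials (fun x => u x - s * w x) z Ez.+1) (fun x => z x ^+ Ez.+1) ->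
  (forall i : 'I_3, exists a b c : K, forall x : 'rV[K]_3, x 0 i = a * u x + b * w x + c * z x) ->
  forall n (f : mpoly 3 K), (mmeasure mdeg f <= n.+1)%N ->
  fspan D [set b | exists i j k, [/\ (i + j + k <= n)%N, (j < Ew.+1)%N, (k < Ez.+1)%N &
    b = fun x => u x ^+ i * w x ^+ j * z x ^+ k]] (peval f).
Proof.
move=> wint zint coord.
pose M n := [set b | exists i j k, [/\ (i + j + k <= n)%N, (j < Ew.+1)%N, (k < Ez.+1)%N &
    b = fun x : 'rV[K]_3 => u x ^+ i * w x ^+ j * z x ^+ k]].
have MS n m f : (n <= m)%N -> fspan D (M n) f -> fspan D (M m) f.
  move=> nm; apply: fspan_sub => _ [i [j [k [ijk jE kE ->]]]]; apply: fspan_mem.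
  by exists i, j, k; split=> //; apply: leq_trans ijk nm.
have Mu n f : fspan D (M n) f -> fspan D (M n.+1) (fun x => u x * f x).
  apply: fspan_mul => _ [i [j [k [ijk jE kE ->]]]]; apply: fspan_mem.
  by exists i.+1, j, k; split=> //; apply/funext => x; rewrite exprS !mulrA.
have Mui n i f : fspan D (M n) f -> fspan D (M (i + n)%N) (fun x => u x ^+ i * f x).
  move=> Hf; elim: i => [|i IH]; first by apply: fspan_ext Hf _ => x _; rewrite expr0 mul1r.
  by apply: fspan_ext (Mu _ _ IH) _ => x _; rewrite exprS mulrA.
have Mw n f : fspan D (M n) f -> fspan D (M n.+1) (fun x => w x * f x).
  apply: fspan_mul => _ [i [j [k [ijk jE kE ->]]]].
  have [jE'|jE'] := ltnP j Ew.
    apply: fspan_mem; exists i, j.+1, k; split=> //; first by lia.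
    by apply/funext => x; rewrite exprS; ring.
  have -> : (fun x => w x * (u x ^+ i * w x ^+ j * z x ^+ k)) =
    (fun x => (u x ^+ i * z x ^+ k) * w x ^+ Ew.+1).
    have -> : Ew = j by lia.
    by apply/funext => x; rewrite exprS; ring.
  apply: fspan_mul wint => _ [i' [j' [ij' j'E ->]]].
  apply: fspan_mem; exists (i + i')%N, j', k; split=> //; first by lia.
  by apply/funext => x; rewrite exprD; ring.
have Mv n f : fspan D (M n) f -> fspan D (M n.+1) (fun x => (u x - s * w x) * f x).
  move=> Hf; apply: fspan_ext (fspanD (Mu _ _ Hf) (fspanZ (- s) (Mw _ _ Hf))) _ => x _.
  by rewrite mulrBl mulNr !mulrA.
have Mvi n i f : fspan D (M n) f -> fspan D (M (i + n)%N) (fun x => (u x - s * w x) ^+ i * f x).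
  move=> Hf; elim: i => [|i IH]; first by apply: fspan_ext Hf _ => x _; rewrite expr0 mul1r.
  by apply: fspan_ext (Mv _ _ IH) _ => x _; rewrite exprS mulrA.
have Mz n f : fspan D (M n) f -> fspan D (M n.+1) (fun x => z x * f x).
  apply: fspan_mul => _ [i [j [k [ijk jE kE ->]]]].
  have [kE'|kE'] := ltnP k Ez.
    apply: fspan_mem; exists i, j, k.+1; split=> //; first by lia.
    by apply/funext => x; rewrite exprS; ring.
  have -> : (fun x => z x * (u x ^+ i * w x ^+ j * z x ^+ k)) =
    (fun x => (u x ^+ i * w x ^+ j) * z x ^+ Ez.+1).
    have -> : Ez = k by lia.
    by apply/funext => x; rewrite exprS; ring.
  (* The relation for z has coefficients in u - s w, whose powers are expanded again with [Mvi]. *)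
  apply: fspan_mul zint => _ [i' [k' [ik' k'E ->]]].
  have : fspan D (M (i + j + k')%N) (fun x => u x ^+ i * w x ^+ j * z x ^+ k').
    by apply: fspan_mem; exists i, j, k'.
  move/(Mvi _ i')/(@MS _ n.+1) => H; apply: fspan_ext (H _) _ => [|x _]; first by lia.
  ring.
have Mx n f i : fspan D (M n) f -> fspan D (M n.+1) (fun x : 'rV[K]_3 => x 0 i * f x).
  move=> Hf; have [a [b [c E]]] := coord i.
  apply: fspan_ext (fspanD (fspanZ a (Mu _ _ Hf)) (fspanD (fspanZ b (Mw _ _ Hf)) (fspanZ c (Mz _ _ Hf)))) _.
  by move=> x _; rewrite E; ring.
have Mx' n f i k : fspan D (M n) f -> fspan D (M (k + n)%N) (fun x : 'rV[K]_3 => x 0 i ^+ k * f x).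
  move=> Hf; elim: k => [|k IH]; first by apply: fspan_ext Hf _ => x _; rewrite expr0 mul1r.
  by apply: fspan_ext (Mx _ _ i IH) _ => x _; rewrite exprS mulrA.
move=> n f Hf; rewrite -/(M n).
have Hm m : m \in msupp f -> fspan D (M n) (fun x : 'rV[K]_3 => \prod_(i < 3) x 0 i ^+ m i).
  move=> mf; have mn : (mdeg m <= n)%N by rewrite -ltnS (leq_trans (msize_mdeg_lt mf)).
  apply: (MS (mdeg m)) => //; rewrite mdegE.
  have M1 : fspan D (M 0%N) (fun=> 1).
    apply: fspan_mem; exists 0%N, 0%N, 0%N; split=> //.
    by apply/funext => x; rewrite !expr0 !mulr1.
  have := Mx' _ _ ord0 (m ord0) (Mx' _ _ (lift ord0 ord0) (m (lift ord0 ord0))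
    (Mx' _ _ (lift ord0 (lift ord0 ord0)) (m (lift ord0 (lift ord0 ord0))) M1)).
  rewrite !big_ord_recl big_ord0 => H; apply: fspan_ext H _ => x _.
  by rewrite !big_ord_recl big_ord0.
have : fspan D (M n) (fun x => \sum_(m <- msupp f | m \in msupp f)
   (mcoeff m f * \prod_(i < 3) x 0 i ^+ m i)).
  by apply: fspan_sum => m mf; apply/fspanZ/Hm.
move/fspan_ext; apply => x _.
by rewrite /peval mevalE big_seq_cond [RHS]big_seq_cond; apply: eq_bigl => m; rewrite andbT andbb.
Qed.

(** Integrality bounds the exponents of w and z only by some constants; after multiplication by r(u)
    the relations of degree at most d bring both below d, at the price of a bounded increase in the
    exponent of u. This yields the factor d * d, and relations valid where r(u) is non-zero. *)
Lemma curve_dim_reduced (D : set 'rV[K]_3) (u w z : 'rV[K]_3 -> K) (s : K) (Ew Ez d : nat)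
   (Qw Qz : {poly {poly K}}) :
  fspan D (low_monomials u w Ew.+1) (fun x => w x ^+ Ew.+1) ->
  fspan D (low_monomials (fun x => u x - s * w x) z Ez.+1) (fun x => z x ^+ Ez.+1) ->
  (forall i : 'I_3, exists a b c : K, forall x : 'rV[K]_3, x 0 i = a * u x + b * w x + c * z x) ->
  Qw != 0 -> (size Qw <= d.+1)%N -> (forall x, D x -> ev2 (u x) (w x) Qw = 0) ->
  Qz != 0 -> (size Qz <= d.+1)%N -> (forall x, D x -> ev2 (u x) (z x) Qz = 0) ->
  exists (r : {poly K}) (C : nat), r != 0 /\
    forall n (I : finType) (f : I -> mpoly 3 K), (forall i, mmeasure mdeg (f i) <= n.+1)%N ->
      ((n + C) * (d * d) < #|I|)%N ->
      exists c : I -> K, (exists i, c i != 0) /\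
        forall x, D x -> r.[u x] * peval (\sum_i c i *: f i) x = 0.
Proof.
move=> wint zint coord Qw0 sQw Qww Qz0 sQz Qzz.
have [rw [Bw [aw [rw0 saw Haw]]]] := reduce_powers Ew.+1 Qw0 sQw Qww.
have [rz [Bz [az [rz0 saz Haz]]]] := reduce_powers Ez.+1 Qz0 sQz Qzz.
exists (rw * rz), (Bw + Bz)%N; split; first by rewrite mulf_neq0.
move=> n I f sf cI.
pose J := ('I_(n + (Bw + Bz)) * ('I_d * 'I_d))%type.
pose bas (t : J) := fun x : 'rV[K]_3 => u x ^+ t.1 * w x ^+ t.2.1 * z x ^+ t.2.2.
have H i : fspan D (range bas) (fun x => (rw * rz).[u x] * peval (f i) x).
  have := curve_span wint zint coord (sf i).
  apply: fspan_mul => _ [e [j [k [ejk jE kE ->]]]].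
  have : fspan D (range bas) (fun x => \sum_(j' < d) \sum_(k' < d) \sum_(l < Bw) \sum_(m < Bz)
     ((aw j j')`_l * (az k k')`_m) * (u x ^+ (e + (l + m)) * w x ^+ j' * z x ^+ k')).
    apply: fspan_sum => j' _; apply: fspan_sum => k' _; apply: fspan_sum => l _; apply: fspan_sum => m _.
    apply/fspanZ/fspan_mem.
    have lt : (e + (l + m) < n + (Bw + Bz))%N by have := ltn_ord l; have := ltn_ord m; lia.
    by exists (Ordinal lt, (j', k')).
  move/fspan_ext; apply => x Dx.
  transitivity (u x ^+ e * (rw.[u x] * w x ^+ j) * (rz.[u x] * z x ^+ k)).
    by rewrite hornerM; ring.
  rewrite Haw // [u x ^+ e * _]mulr_sumr mulr_suml; apply: eq_bigr => j' _.
  rewrite Haz // mulr_sumr; apply: eq_bigr => k' _.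
  rewrite (horner_coef_wide _ (saw j j' jE (ltn_ord _))) (horner_coef_wide _ (saz k k' kE (ltn_ord _))).
  set A := \sum_(l < Bw) (aw j j')`_l * _; set B := \sum_(l < Bz) _.
  have -> : u x ^+ e * (A * w x ^+ j') * (B * z x ^+ k') = A * B * (u x ^+ e * w x ^+ j' * z x ^+ k').
    by ring.
  rewrite /A /B big_distrlr /= mulr_suml; apply: eq_bigr => l _.
  by rewrite mulr_suml; apply: eq_bigr => m _; rewrite !exprD; ring.
have /choice [c Hc] := fun i => fspan_coord (H i).
have [|a [ai aH]] := @fun_dep K I J c; first by rewrite !card_prod !card_ord.
exists a; split=> // x Dx; rewrite peval_sum mulr_sumr.
under eq_bigr do rewrite pevalZ mulrCA Hc // mulr_sumr.
rewrite exchange_big /= big1 // => t _.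
under eq_bigr do rewrite mulrA.
by rewrite -mulr_suml aH mul0r.
Qed.

End CurveDim.

Definition row3 (K : Type) (a b c : K) : 'rV[K]_3 :=
  \row_i (if i == ord0 then a else if i == lift ord0 ord0 then b else c).

Definition dotp (K : fieldType) n (a x : 'rV[K]_n) : K := \sum_i a 0 i * x 0 i.

(** * Choice of a generic projection *)

Section Generic.
Variables (K : numClosedFieldType).
Let i0 : 'I_3 := ord0.
Let i1 : 'I_3 := lift ord0 ord0.
Let i2 : 'I_3 := lift ord0 (lift ord0 ord0).

Lemma I3P (P : 'I_3 -> Prop) : P i0 -> P i1 -> P i2 -> forall i, P i.
Proof.
move=> P0 P1 P2 i; case: (unliftP ord0 i) => [j ->|-> //].
case: (unliftP ord0 j) => [k ->|-> //]; by rewrite (ord1 k).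
Qed.

Lemma row3E (a b c : K) : [/\ row3 a b c 0 i0 = a, row3 a b c 0 i1 = b & row3 a b c 0 i2 = c].
Proof. by split; rewrite mxE. Qed.

Lemma row3_eta (x : 'rV[K]_3) : row3 (x 0 i0) (x 0 i1) (x 0 i2) = x.
Proof. by apply/rowP; apply: I3P; rewrite mxE. Qed.

Lemma dotp3 (a x : 'rV[K]_3) :
  dotp a x = a 0 i0 * x 0 i0 + a 0 i1 * x 0 i1 + a 0 i2 * x 0 i2.
Proof. by rewrite /dotp !big_ord_recl big_ord0 addr0 addrA. Qed.

Let row4 (a b c e : K) : 'rV[K]_(3 + 1) := row_mx (row3 a b c) (const_mx e).

Let row4_line a b c e a' b' c' e' (t : K) :
  row4 a b c e + t *: row4 a' b' c' e' =
  row4 (a + t * a') (b + t * b') (c + t * c') (e + t * e').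
Proof.
rewrite /row4 scale_row_mx add_row_mx; congr row_mx; apply/rowP.
  by apply: I3P; rewrite !mxE.
by move=> i; rewrite !mxE.
Qed.

(** The linear form u = x0 + s x1 + t x2 is fixed one coefficient at a time. Each of s and t avoids
    the zeros of a product of non-zero polynomials, one for integrality, one for genericity with
    respect to [G], and one for each vector of [T]. *)
Lemma curve_dim_complex (V : set 'rV[K]_3) (G : mpoly (3 + 1) K) (d : nat)
    (T : seq 'rV[K]_3) :
  algebraic_set V ->
  (forall W e, irreducible_algebraic_set W -> W `<=` V -> irreducible_dim W e -> (e <= 1)%N) ->
  G != 0 ->
  (forall a c, a != 0 -> peval G (row_mx a (const_mx c)) != 0 ->
    forall s, uniq s -> (forall x, x \in s -> V x /\ dotp a x = c) -> (size s <= d)%N) ->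
  (forall v, v \in T -> v != 0) ->
  exists (a : 'rV[K]_3) (r : {poly K}) (C : nat), [/\ r != 0,
    forall v, v \in T -> dotp a v != 0 &
    forall n (I : finType) (f : I -> mpoly 3 K), (forall i, mmeasure mdeg (f i) <= n.+1)%N ->
      ((n + C) * (d * d) < #|I|)%N ->
      exists c : I -> K, (exists i, c i != 0) /\
        forall x, V x -> r.[dotp a x] * peval (\sum_i c i *: f i) x = 0].
Proof.
move=> aV dV G0 GV T0.
pose x0 (x : 'rV[K]_3) := x 0 i0; pose x1 (x : 'rV[K]_3) := x 0 i1.
pose x2 (x : 'rV[K]_3) := x 0 i2.
pose X i := mpolyX K (mnm1 i) : mpoly 3 K.
have dep (f g : mpoly 3 K) : exists2 P, P != 0 &
    forall x, V x -> peval P (row2 (peval f x) (peval g x)) = 0.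
  have [P P0 HP] := curve_dependent [tuple f; g] aV dV.
  exists P => // x Vx; have := HP x Vx; rewrite /peval comp_mpoly_meval => <-.
  apply: meval_eq => i; rewrite mxE; case: (unliftP ord0 i) => [j ->|->] /=.
    by rewrite (ord1 j).
  by [].
have [al Gal al0] : exists2 al, peval G al != 0 & al 0 (lshift 1 i0) != 0.
  have : G * mpolyX K (mnm1 (lshift 1 i0)) != 0.
    by rewrite mulf_neq0 // -mleadc_eq0 mleadXm mcoeffX eqxx oner_eq0.
  move=> GX; have [al Hal] : exists al, peval (G * mpolyX K (mnm1 (lshift 1 i0))) al != 0.
    apply: contrapT => H; move/eqP: GX; apply; apply: peval_inj0 => x.
    by apply/eqP; apply: contrapT => /negP Hx; apply: H; exists x.
  by move: Hal; rewrite pevalM mulf_eq0 negb_or pevalXU => /andP[]; exists al.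
(* [G] may be inhomogeneous, so the scale l of the hyperplane equation is fixed and only the ratios
   vary. *)
have [l [s0 [t0 [c0 [l0 Gl]]]]] : exists l s0 t0 c0, l != 0 /\
    peval G (row4 l (l * s0) (l * t0) (l * c0)) != 0.
  set l := al 0 (lshift 1 i0) in al0.
  exists l, (al 0 (lshift 1 i1) / l), (al 0 (lshift 1 i2) / l), (al 0 (rshift 3 ord0) / l).
  split=> //; rewrite !(mulrC l) !divfK //.
  rewrite (_ : row4 _ _ _ _ = al) //; apply/rowP => i.
  rewrite -(splitK i); case: (fintype.split i) => j /=.
    by rewrite row_mxEl; move: j; apply: I3P; rewrite mxE.
  by rewrite row_mxEr mxE (ord1 j).
pose g1 := line_poly (row4 l 0 (l * t0) (l * c0)) (row4 0 l 0 0) G.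
have g1E s : g1.[s] = peval G (row4 l (l * s) (l * t0) (l * c0)).
  by rewrite horner_line row4_line !mulr0 !addr0 add0r mulrC.
have g10 : g1 != 0 by apply: contraNneq Gl => g10; rewrite -g1E g10 horner0.
have eX i : peval (X i) = fun x => x 0 i by apply/funext => x; rewrite pevalXU.
have [P1 P10 HP1] := dep (X i0) (X i1).
have [r1 r10 Hr1] := generic_integral P10 HP1; rewrite !eX in Hr1.
(* Vectors on the third axis put no constraint on s; for them the choice of t decides. *)
pose tau (v : 'rV[K]_3) : {poly K} := if (v 0 i0 == 0) && (v 0 i1 == 0) then 1
  else (v 0 i0)%:P + v 0 i1 *: 'X : {poly K}.
have tau0 v : tau v != 0.
  rewrite /tau; case: ifP => [_|/negbT H]; first exact: oner_neq0.
  apply: contraNneq H => /polyP H.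
  have := H 0%N; have := H 1%N; rewrite !coefD !coefC !coefZ !coefX /= !(mulr0, mulr1, addr0, add0r).
  by move=> -> ->; rewrite eqxx.
have [s] : exists s, (r1 * g1 * \prod_(v <- T) tau v).[s] != 0.
  apply: poly_nonroot; rewrite !mulf_neq0 //.
  by rewrite prodf_seq_neq0; apply/allP => v _; rewrite tau0.
rewrite !hornerM !mulf_eq0 !negb_or horner_prod => /andP[/andP[r1s g1s]].
rewrite prodf_seq_neq0 => /allP taus.
have [E1 Hint1] := Hr1 _ r1s.
pose g2 := line_poly (row4 l (l * s) 0 (l * c0)) (row4 0 0 l 0) G.
have g2E t : g2.[t] = peval G (row4 l (l * s) (l * t) (l * c0)).
  by rewrite horner_line row4_line !mulr0 !addr0 add0r (mulrC t).
have g20 : g2 != 0.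
  by move: g1s; rewrite g1E -g2E; apply: contraNneq => ->; rewrite horner0.
have [P2 P20 HP2] := dep (X i0 + s *: X i1) (X i2).
have [r2 r20 Hr2] := generic_integral P20 HP2; rewrite !eX in Hr2.
pose tau' (v : 'rV[K]_3) : {poly K} := (v 0 i0 + s * v 0 i1)%:P + v 0 i2 *: 'X.
have tau'0 v : v \in T -> tau' v != 0.
  move=> vT; apply: contraNneq (T0 v vT) => /polyP H.
  have := H 0%N; have := H 1%N; rewrite !coefD !coefC !coefZ !coefX /= !(mulr0, mulr1, addr0, add0r).
  move=> v2 v01; have := taus v vT; rewrite /tau; case: ifP => [/andP[/eqP v0 /eqP v1] _|_].
    by rewrite -(row3_eta v) v0 v1 v2; apply/eqP/rowP; apply: I3P; rewrite !mxE.
  by rewrite !hornerE mulrC v01 eqxx.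
have [t] : exists t, (r2 * g2 * \prod_(v <- T) tau' v).[t] != 0.
  apply: poly_nonroot; rewrite !mulf_neq0 //.
  by rewrite prodf_seq_neq0; apply/allP => v vT; rewrite tau'0.
rewrite !hornerM !mulf_eq0 !negb_or horner_prod => /andP[/andP[r2t g2t]].
rewrite prodf_seq_neq0 => /allP taut.
have [E2 Hint2] := Hr2 _ r2t.
pose g3 := line_poly (row4 l (l * s) (l * t) 0) (row4 0 0 0 l) G.
have g3E c : g3.[c] = peval G (row4 l (l * s) (l * t) (l * c)).
  by rewrite horner_line row4_line !mulr0 !addr0 add0r (mulrC c).
have g30 : g3 != 0.
  by move: g2t; rewrite g2E -g3E; apply: contraNneq => ->; rewrite horner0.
pose a := row3 1 s t; pose u (x : 'rV[K]_3) := dotp a x.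
have uE x : u x = x0 x + s * x1 x + t * x2 x.
  by rewrite /u dotp3 /a; have [-> -> ->] := row3E 1 s t; rewrite mul1r.
have fib c : g3.[c] != 0 -> forall q, uniq q -> (forall x, x \in q -> V x /\ u x = c) -> (size q <= d)%N.
  rewrite g3E => Gc q uq Hq; apply: (GV (l *: a) (l * c)) uq _.
  - rewrite scaler_eq0 negb_or l0 /=; apply/eqP => /rowP/(_ i0).
    by rewrite /a !mxE eqxx => /eqP; rewrite oner_eq0.
  - rewrite (_ : row_mx _ _ = row4 l (l * s) (l * t) (l * c)) //; congr row_mx.
    by apply/rowP; apply: I3P; rewrite !mxE //= mulr1.
  - move=> x /Hq [Vx <-]; split=> //; rewrite /u /dotp mulr_sumr.
    by apply: eq_bigr => i _; rewrite mxE mulrA.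
pose pta (c y z : K) := row3 (c - s * z - t * y) z y.
pose ptb (c y z : K) := row3 (c - s * y - t * z) y z.
have zint1 : fspan V (low_monomials (fun x => u x - t * x2 x) x1 E1.+1) (fun x => x1 x ^+ E1.+1).
  have -> : (fun x => u x - t * x2 x) = (fun x => x0 x + s * x1 x) by apply/funext => x; rewrite uE addrK.
  exact: Hint1.
have zint2 : fspan V (low_monomials u x2 E2.+1) (fun x => x2 x ^+ E2.+1).
  have -> : u = (fun x => peval (X i0 + s *: X i1) x + t * x2 x).
    by apply/funext => x; rewrite uE pevalD pevalZ !eX.
  exact: Hint2.
pose U := X i0 + s *: X i1 + t *: X i2.
have eU x : peval U x = u x by rewrite uE !pevalD !pevalZ !eX.
have [PA PA0 HPA] := dep U (X i2).
have [PB PB0 HPB] := dep U (X i1).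
have u3 (A B C : K) : u (row3 A B C) = A + s * B + t * C.
  by rewrite uE /x0 /x1 /x2; have [-> -> ->] := row3E A B C.
have [QA [QA0 sQA HQA]] : exists Q : {poly {poly K}}, [/\ Q != 0, (size Q <= d.+1)%N &
    forall x, V x -> ev2 (u x) (x2 x) Q = 0].
  pose h i : {poly {poly {poly K}}} := if i == i0 then 'X%:P%:P - s%:P%:P%:P * 'X - t%:P%:P%:P * 'X%:P
    else if i == i1 then 'X else 'X%:P.
  apply: (@fiber_bound K V u x2 x1 pta h E1.+1 d PA g3) => //.
  - move=> c y z; rewrite u3 /x1 /x2; have [_ -> ->] := row3E (c - s * z - t * y) z y.
    by split=> //; ring.
  - by move=> x; rewrite -[RHS]row3_eta /pta uE /x0; congr (row3 _ _ _); rewrite /x1 /x2; ring.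
  - move=> c y z; rewrite /h /pta; have [e0 e1 e2] := row3E (c - s * z - t * y) z y.
    apply: I3P; rewrite ?e0 ?e1 ?e2 /=; last 2 first.
    + by rewrite ev3X.
    + by rewrite ev3C /ev2 hornerX hornerC.
    by rewrite !ev3B !ev3M !ev3C ev3X !ev2C !hornerC hornerX /ev2 hornerX hornerC.
  - by move=> x /HPA; rewrite eU eX.
  - apply: fspan_sub zint1 => _ [i [j [ij jE ->]]]; apply: fspan_mem.
    exists (('X%:P - t%:P%:P * 'X) ^+ i), j; split=> //; apply/funext => x.
    congr (_ * _); rewrite /ev2 horner_exp hornerD hornerN hornerM !hornerC hornerX.
    by rewrite horner_exp !hornerE.
have [QB [QB0 sQB HQB]] : exists Q : {poly {poly K}}, [/\ Q != 0, (size Q <= d.+1)%N &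
    forall x, V x -> ev2 (u x) (x1 x) Q = 0].
  pose h i : {poly {poly {poly K}}} := if i == i0 then 'X%:P%:P - s%:P%:P%:P * 'X%:P - t%:P%:P%:P * 'X
    else if i == i1 then 'X%:P else 'X.
  apply: (@fiber_bound K V u x1 x2 ptb h E2.+1 d PB g3) => //.
  - move=> c y z; rewrite u3 /x1 /x2; have [_ -> ->] := row3E (c - s * y - t * z) y z.
    by split=> //; ring.
  - by move=> x; rewrite -[RHS]row3_eta /ptb uE /x0; congr (row3 _ _ _); rewrite /x1 /x2; ring.
  - move=> c y z; rewrite /h /ptb; have [e0 e1 e2] := row3E (c - s * y - t * z) y z.
    apply: I3P; rewrite ?e0 ?e1 ?e2 /=; last 2 first.
    + by rewrite ev3C /ev2 hornerX hornerC.
    + by rewrite ev3X.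
    by rewrite !ev3B !ev3M !ev3C ev3X !ev2C !hornerC hornerX /ev2 hornerX hornerC.
  - by move=> x /HPB; rewrite eU eX.
  - apply: fspan_sub zint2 => _ [i [j [ij jE ->]]]; apply: fspan_mem.
    exists ('X ^+ i)%:P, j; split=> //; apply/funext => x.
    by rewrite ev2C hornerXn.
have coord (i : 'I_3) : exists a b c : K, forall x : 'rV[K]_3, x 0 i = a * u x + b * x2 x + c * x1 x.
  move: i; apply: I3P.
  - by exists 1, (- t), (- s) => x; rewrite uE /x0; ring.
  - by exists 0, 0, 1 => x; rewrite /x1; ring.
  - by exists 0, 1, 0 => x; rewrite /x2; ring.
have [r [C [r0 HC]]] := curve_dim_reduced zint2 zint1 coord QA0 sQA HQA QB0 sQB HQB.
exists a, r, C; split=> // v vT.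
have := taut v vT; rewrite /tau' -[dotp a v]/(u v) uE !hornerE /x0 /x1 /x2.
by rewrite (mulrC t).
Qed.
End Generic.

(** * Descent to real curves and their arcs *)

Section RealCurve.
Variable R : realType.

(* Unlike the ideal of polynomials vanishing on g, this one ignores finite subsets
   of g when 0 is not in T, because an arc with a non-zero tangent leaves every
   point at once. *)
Definition germ_ideal (g : set 'rV[R]_3) (T : set 'rV[R]_3) : set (mpoly 3 R) :=
  [set f | forall (a : R -> 'rV[R]_3) v, T v -> a @` `[0, 1[ `<=` g ->
    h^-1 *: (a h - a 0) @[h --> (0 : R)^'+] --> v ->
    \forall h \near (0 : R)^'+, peval f (a h) = 0].

Lemma dotp_cvg n (l : 'rV[R]_n) (T : Type) (F : set_system T) {FF : Filter F}
    (w : T -> 'rV[R]_n) v : w x @[x --> F] --> v ->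
  dotp l (w x) @[x --> F] --> dotp l v.
Proof.
move=> wv; apply: cvg_sumr => i _; apply: cvgM; first exact: cvg_cst.
by apply: (@cvg_comp _ _ _ w (fun x : 'rV[R]_n => x 0 i)); [exact: wv|exact: coord_continuous].
Qed.

Lemma dotpD n (K : fieldType) (l x y : 'rV[K]_n) : dotp l (x + y) = dotp l x + dotp l y.
Proof. by rewrite /dotp -big_split /=; apply: eq_bigr => i _; rewrite mxE mulrDr. Qed.

Lemma dotpZ n (K : fieldType) (l x : 'rV[K]_n) c : dotp l (c *: x) = c * dotp l x.
Proof. by rewrite /dotp mulr_sumr; apply: eq_bigr => i _; rewrite mxE mulrCA. Qed.

(** The form [l] changes along the arc at the non-zero rate [dotp l v], so its initial value is left
    at once; other values are avoided by continuity. *)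
Lemma arc_avoids n (l : 'rV[R]_n) (a : R -> 'rV[R]_n) v (s : seq R) :
  dotp l v != 0 -> h^-1 *: (a h - a 0) @[h --> (0 : R)^'+] --> v ->
  \forall h \near (0 : R)^'+, dotp l (a h) \notin s.
Proof.
move=> lv av; set w := fun h => h^-1 *: (a h - a 0).
have lw : dotp l (w h) @[h --> (0 : R)^'+] --> dotp l v by exact: dotp_cvg.
have aE h : 0 < h -> dotp l (a h) = dotp l (a 0) + h * dotp l (w h).
  move=> h0; rewrite -dotpZ /w scalerA mulfV ?gt_eqF // scale1r -dotpD.
  by rewrite addrC subrK.
have cv : dotp l (a 0) + h * dotp l (w h) @[h --> (0 : R)^'+] --> dotp l (a 0).
  rewrite -[X in _ --> X]addr0 -[X in _ --> _ + X](mul0r (dotp l v)).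
  apply: cvgD; first exact: cvg_cst.
  by apply: cvgM => //; apply: cvg_at_right_filter; exact: cvg_id.
elim: s => [|x s IH]; first by near=> h.
have H : \forall h \near (0 : R)^'+, dotp l (a h) != x.
  have [->|xa] := eqVneq x (dotp l (a 0)).
    have W : \forall h \near (0 : R)^'+, dotp l (w h) != 0.
      by apply: (cvgr_neq0 (dotp l v)).
    near=> h; have h0 : 0 < h by [].
    rewrite aE // -subr_eq0 addrAC subrr add0r.
    by apply: mulf_neq0; [rewrite gt_eqF|near: h].
  have W : \forall h \near (0 : R)^'+, dotp l (a 0) + h * dotp l (w h) - x != 0.
    apply: (cvgr_neq0 (dotp l (a 0) - x)); last by rewrite subr_eq0 eq_sym.
    by apply: cvgB => //; exact: cvg_cst.
  near=> h; have h0 : 0 < h by [].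
  by rewrite aE // -subr_eq0; near: h.
near=> h; rewrite inE negb_or; apply/andP; split; by near: h.
Unshelve. all: by end_near.
Qed.

(** For k = 0 the polynomial 1 would lie in the local ideal, and s = g + u h evaluated at p would
    give s(p) = 0. Hence an intersection number bounds the number of points. *)
Lemma intersection_mult_gt0 (K : fieldType) n (V : set 'rV[K]_n) (a : 'rV[K]_n) (c : K) p k :
  V p -> hyperplane a c p -> intersection_mult V (hyperplane_poly a c) p k -> (0 < k)%N.
Proof.
move=> Vp Hp [e He]; rewrite lt0n; apply/eqP => k0; subst k.
have [x [[s [f [u [sp Vf E]]]] _]] := He 1.
have : peval (s * (1 - \sum_(i < 0) x 0 i *: e i)) p = 0.
  rewrite E pevalD Vf // add0r pevalM [X in _ * X](_ : _ = 0) ?mulr0 //.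
  rewrite /hyperplane_poly pevalB pevalC peval_sum -Hp.
  by apply/eqP; rewrite subr_eq0; apply/eqP/eq_bigr => i _; rewrite pevalZ pevalXU.
by rewrite big_ord0 subr0 mulr1 => /eqP; rewrite (negPf sp).
Qed.

Lemma intersection_number_bound (K : fieldType) n (V : set 'rV[K]_n) (a : 'rV[K]_n) (c : K) d :
  intersection_number V a c d ->
  forall s, uniq s -> (forall x, x \in s -> V x /\ dotp a x = c) -> (size s <= d)%N.
Proof.
move=> [finF [m [mV <-]]] s us sV; set F := V `&` hyperplane a c in finF mV *.
have sF x : x \in s -> F x by move=> /sV [].
rewrite fsbig_finite //=.
apply: (@leq_trans #|` fset_set F|).
  by apply: (uniq_leq_size us) => x /sF Fx; rewrite in_fset_set // inE.
change (size (fset_set F) <= \sum_(x <- fset_set F) m x)%N.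
rewrite -sum1_size big_seq [leqRHS]big_seq; apply: leq_sum => p.
rewrite in_fset_set // inE => -[Vp Hp].
exact: (intersection_mult_gt0 Vp Hp (mV p (conj Vp Hp))).
Qed.

Lemma Re_sum (I : Type) (r : seq I) (F : I -> R[i]) :
  complex.Re (\sum_(i <- r) F i) = \sum_(i <- r) complex.Re (F i).
Proof. by apply: big_morph => // -[x1 y1] [x2 y2]. Qed.

Lemma Im_sum (I : Type) (r : seq I) (F : I -> R[i]) :
  complex.Im (\sum_(i <- r) F i) = \sum_(i <- r) complex.Im (F i).
Proof. by apply: big_morph => // -[x1 y1] [x2 y2]. Qed.

Lemma Re_mulr (z : R[i]) (x : R) : complex.Re (z * real_complex R x) = complex.Re z * x.
Proof. by case: z => u v /=; rewrite mulr0 subr0. Qed.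

Lemma Im_mulr (z : R[i]) (x : R) : complex.Im (z * real_complex R x) = complex.Im z * x.
Proof. by case: z => u v /=; rewrite mulr0 add0r mulrC. Qed.

Lemma peval_map (K K' : fieldType) (phi : {rmorphism K -> K'}) n (f : mpoly n K) (x : 'rV[K]_n) :
  peval (map_mpoly phi f) (map_mx phi x) = phi (peval f x).
Proof.
move: f; apply: mpoly_ringind => [c|i|f g Hf Hg|f g Hf Hg].
- by rewrite map_mpolyC !pevalC.
- by rewrite map_mpolyX !pevalXU mxE.
- by rewrite (raddfD (map_mpoly phi)) !pevalD Hf Hg rmorphD.
- by rewrite (rmorphM (map_mpoly phi)) !pevalM Hf Hg rmorphM.
Qed.

Lemma peval_complexify n (f : mpoly n R) (x : 'rV[R]_n) :
  peval (map_mpoly (real_complex R) f) (complexify x) = real_complex R (peval f x).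
Proof. exact: peval_map. Qed.

(** A complex relation on V splits into its real and imaginary parts on g, one of which has a
    non-zero coefficient. The factor r(u) disappears because arcs with tangents in [T] avoid its
    zeros near their start. *)
Lemma curve_dim_real (g : set 'rV[R]_3) (d : nat) (T : seq 'rV[R]_3) :
  real_curve_degree g d -> (forall v, v \in T -> v != 0) ->
  exists C, forall n (I : finType) (f : I -> mpoly 3 R),
    (forall i, mmeasure mdeg (f i) <= n.+1)%N -> ((n + C) * (d * d) < #|I|)%N ->
    exists c : I -> R, (exists i, c i != 0) /\
      germ_ideal g [set` T] (\sum_i c i *: f i).
Proof.
move=> [V [[aV dV] gV Vmin] [G G0 HG]] T0.
have cx0 (x : 'rV[R]_3) : x != 0 -> complexify x != 0.
  apply: contra_neq => /rowP H; apply/rowP => i; have := H i.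
  by rewrite !mxE => -[].
have [|v /mapP [w wT ->]|a [r [C [r0 aT HC]]]] := @curve_dim_complex R[i] V G d [seq complexify v | v <- T]
    aV dV.2 G0 _.
- by move=> a c a0 Gac; apply: intersection_number_bound (HG _ _ a0 Gac).
- exact/cx0/T0.
have [rs Ers] := closed_field_poly_normal r.
have rE y : (y \notin rs) -> r.[y] != 0.
  move=> yr; rewrite Ers hornerZ mulf_neq0 ?lead_coef_eq0 //.
  by rewrite -[_ == 0]/(root _ y) root_prod_XsubC.
pose lre : 'rV[R]_3 := \row_i complex.Re (a 0 i); pose lim : 'rV[R]_3 := \row_i complex.Im (a 0 i).
have dre x : complex.Re (dotp a (complexify x)) = dotp lre x.
  by rewrite /dotp Re_sum; apply: eq_bigr => i _; rewrite !mxE Re_mulr.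
have dim x : complex.Im (dotp a (complexify x)) = dotp lim x.
  by rewrite /dotp Im_sum; apply: eq_bigr => i _; rewrite !mxE Im_mulr.
have avoid (al : R -> 'rV[R]_3) v : v \in T ->
    h^-1 *: (al h - al 0) @[h --> (0 : R)^'+] --> v ->
    \forall h \near (0 : R)^'+, r.[dotp a (complexify (al h))] != 0.
  move=> vT av; have [v1|v1] := eqVneq (dotp lre v) 0; last first.
    have := arc_avoids [seq complex.Re z | z <- rs] v1 av.
    apply: filterS => h; rewrite -dre => H; apply: rE.
    by apply: contraNN H => H; apply: map_f.
  have v2 : dotp lim v != 0.
    have := aT _ (map_f _ vT); apply: contra_neqN => /eqP v2.
    by apply/eqP; rewrite eq_complex dre dim v1 v2 !eqxx.
  have := arc_avoids [seq complex.Im z | z <- rs] v2 av.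
  apply: filterS => h; rewrite -dim => H; apply: rE.
  by apply: contraNN H => H; apply: map_f.
exists C => n I f sf cI.
pose cf i : mpoly 3 R[i] := map_mpoly (real_complex R) (f i).
have [i|c [[i0 ci0] Hc]] := HC n I cf _ cI.
  apply/msizeP => m; rewrite mcoeff_map_mpoly => H.
  by move/msizeP: (sf i); apply; apply: contra_neq H => /= ->.
have key x : g x -> r.[dotp a (complexify x)] != 0 ->
    peval (\sum_i complex.Re (c i) *: f i) x = 0 /\ peval (\sum_i complex.Im (c i) *: f i) x = 0.
  move=> gx rx; have := Hc (complexify x) (gV _ (ex_intro2 _ _ x gx erefl)).
  move/eqP; rewrite mulf_eq0 (negPf rx) /= peval_sum.
  have -> : \sum_i peval (c i *: cf i) (complexify x) =
      \sum_i c i * real_complex R (peval (f i) x).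
    by apply: eq_bigr => i _; rewrite -peval_complexify; apply: pevalZ.
  rewrite eq_complex Re_sum Im_sum => /andP[/eqP Re0 /eqP Im0].
  split; rewrite peval_sum -[RHS]/(complex.Re (0 : R[i])).
    by rewrite -Re0; apply: eq_bigr => i _; rewrite pevalZ Re_mulr.
  by rewrite -[RHS]Im0; apply: eq_bigr => i _; rewrite pevalZ Im_mulr.
have arcs (al : R -> 'rV[R]_3) v : v \in T -> al @` `[0, 1[ `<=` g ->
    h^-1 *: (al h - al 0) @[h --> (0 : R)^'+] --> v ->
    \forall h \near (0 : R)^'+, peval (\sum_i complex.Re (c i) *: f i) (al h) = 0 /\
      peval (\sum_i complex.Im (c i) *: f i) (al h) = 0.
  move=> vT alg av; have H := avoid al v vT av.
  near=> h; apply: key; last by near: h.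
  by apply: alg; exists h => //=; rewrite in_itv /=; apply/andP; split.
have [c1|c1] := pselect (exists i, complex.Re (c i) != 0).
  exists (fun i => complex.Re (c i)); split=> // al v vT alg av.
  by apply: filterS (arcs al v vT alg av) => h [].
exists (fun i => complex.Im (c i)); split.
  exists i0; move: ci0; apply: contra_neq => Im0; apply/eqP; rewrite eq_complex Im0 eqxx andbT.
  by apply: contrapT => /negP H; apply: c1; exists i0.
by move=> al v vT alg av; apply: filterS (arcs al v vT alg av) => h [].
Unshelve. all: by end_near.
Qed.

End RealCurve.

(** * Handicaps *)

Section SubspaceDim.
Variables (K : fieldType) (vT : vectType K).

Definition lin_closed (A : set vT) := A 0 /\ forall a u v, A u -> A v -> A (a *: u + v).

(** Turns a linear condition into a subspace with a dimension; the default value is avoided for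
    [lin_closed] sets ([vspace_ofP]). *)
Definition vspace_of (A : set vT) : {vspace vT} :=
  xget 0%VS [set U : {vspace vT} | forall v, v \in U <-> A v].

Lemma vspace_ofP A v : lin_closed A -> v \in vspace_of A <-> A v.
Proof.
move=> [A0 Al]; move: v.
suff [U HU] : exists U : {vspace vT}, forall v, v \in U <-> A v.
  exact: (@xgetPex _ 0%VS [set U : {vspace vT} | forall v, v \in U <-> A v]
    (ex_intro _ U HU)).
pose P k := `[< exists U : {vspace vT}, (\dim U = k) /\ forall v, v \in U -> A v >].
have exP : exists k, P k.
  by exists 0%N; apply/asboolP; exists 0%VS; rewrite dimv0; split=> // v; rewrite memv0 => /eqP ->.
have bP k : P k -> (k <= \dim {: vT})%N.
  by move/asboolP => [U [<- _]]; apply/dimvS/subvf.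
case: (ex_maxnP exP bP) => k /asboolP [U [dU UA]] kmax.
exists U => v; split; first exact: UA.
move=> Av; apply: contrapT => /negP vU.
have : P (\dim (U + <[v]>)).
  apply/asboolP; exists (U + <[v]>)%VS; split=> // w /memv_addP [u uU [x /vlineP [c ->] ->]].
  by rewrite addrC; apply: Al => //; apply: UA.
move/kmax; rewrite -dU leqNgt => /negP; apply; rewrite ltn_neqAle dimvS ?addvSl // andbT.
apply: contra vU => /eqP dUv.
have /eqP -> : U == (U + <[v]>)%VS by rewrite eqEdim addvSl -dUv leqnn.
by rewrite memvE addvSr.
Qed.

Lemma vspace_ofS (A B : set vT) : lin_closed A -> lin_closed B -> A `<=` B ->
  (vspace_of A <= vspace_of B)%VS.
Proof.
by move=> lA lB AB; apply/subvP => v /(vspace_ofP _ lA)/AB/(vspace_ofP _ lB).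
Qed.

(** [f] induces an injection of A/B into A'/B'; a complement of B in A stands for the quotient. All
    comparisons of shares and Hilbert functions rest on this. *)
Lemma dim_jump_le (wT : vectType K) (A B : {vspace vT}) (A' B' : {vspace wT})
    (f : {linear vT -> wT}) :
  (B <= A)%VS -> (B' <= A')%VS -> (forall v, v \in A -> f v \in A') ->
  (forall v, v \in A -> f v \in B' -> v \in B) ->
  (\dim A - \dim B <= \dim A' - \dim B')%N.
Proof.
move=> BA BA' fA fB; pose g := linfun f; pose C := (A :\: B)%VS.
have CA : (C <= A)%VS by apply: diffvSl.
have CB : (C :&: B = 0)%VS by apply: capv_diff.
have gC0 v : v \in C -> g v \in B' -> v = 0.
  move=> vC; rewrite lfunE => gv; apply/eqP; rewrite -memv0 -CB memv_cap vC.
  by apply: fB => //; apply: subvP CA _ vC.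
have kerC : (C :&: lker g = 0)%VS.
  apply/eqP; rewrite -subv0; apply/subvP => v; rewrite memv_cap memv_ker => /andP[vC /eqP gv].
  by rewrite (gC0 v) ?mem0v // gv mem0v.
have dC : (\dim A - \dim B)%N = \dim C.
  by rewrite -(dimv_cap_compl A B) (capv_idPr BA) addKn.
have dgC : \dim (g @: C) = \dim C.
  by rewrite -[RHS](limg_ker_dim g C) kerC dimv0 add0n.
rewrite dC -dgC leq_subRL ?dimvS // addnC.
have disj : (g @: C :&: B' = 0)%VS.
  apply/eqP; rewrite -subv0; apply/subvP => w; rewrite memv_cap => /andP[/memv_imgP [v vC ->] gv].
  by rewrite (gC0 v vC gv) linear0 mem0v.
rewrite -(dimv_disjoint_sum disj) dimvS // subv_add BA' andbT.
by apply/subvP => w /memv_imgP [v vC ->]; rewrite lfunE; apply/fA/(subvP CA).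
Qed.

End SubspaceDim.

Section BoundedPolys.
Variables (K : fieldType) (N n : nat).

(** Coordinates for the polynomials of degree less than [n], which is what [mmeasure mdeg f <= n]
    expresses. *)
Definition bpoly_vec := 'rV[K]_(#|{: bmultinom N n}|).

Definition to_mpoly (v : bpoly_vec) : mpoly N K :=
  \sum_i v 0 i *: mpolyX K (bmnm (enum_val i)).
Definition of_mpoly (f : mpoly N K) : bpoly_vec :=
  \row_i mcoeff (bmnm (enum_val i)) f.

Fact to_mpoly_linear : linear to_mpoly.
Proof.
move=> a u v; rewrite /to_mpoly scaler_sumr -big_split; apply: eq_bigr => i _ /=.
by rewrite !mxE scalerDl scalerA.
Qed.
HB.instance Definition _ := GRing.isLinear.Build K bpoly_vec (mpoly N K) _ to_mpoly to_mpoly_linear.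

Fact of_mpoly_linear : linear of_mpoly.
Proof. by move=> a u v; apply/rowP => i; rewrite !mxE mcoeffD mcoeffZ. Qed.
HB.instance Definition _ := GRing.isLinear.Build K (mpoly N K) bpoly_vec _ of_mpoly of_mpoly_linear.

Lemma msize_to_mpoly v : (mmeasure mdeg (to_mpoly v) <= n)%N.
Proof.
apply: msize_sum => i _; apply: msize_scale; rewrite mmeasureX; exact: bmdeg.
Qed.

Lemma mcoeff_to_mpoly v i : mcoeff (bmnm (enum_val i)) (to_mpoly v) = v 0 i.
Proof.
rewrite /to_mpoly raddf_sum (bigD1 i) //= mcoeffZ mcoeffX eqxx mulr1 big1 ?addr0 // => j ji.
rewrite mcoeffZ mcoeffX; case: eqP => [/val_inj/enum_val_inj e|]; last by rewrite mulr0.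
by rewrite e eqxx in ji.
Qed.

Lemma of_mpolyK f : (mmeasure mdeg f <= n)%N -> to_mpoly (of_mpoly f) = f.
Proof.
move=> fn; apply/mpolyP => m; have [mn|mn] := ltnP (mdeg m) n.
  have := mcoeff_to_mpoly (of_mpoly f) (enum_rank (BMultinom mn : {: bmultinom N n})).
  by rewrite mxE enum_rankK.
rewrite !memN_msupp_eq0 //; first by apply: msize_mdeg_ge; apply: leq_trans mn.
by apply: msize_mdeg_ge; apply: leq_trans (msize_to_mpoly _) mn.
Qed.

End BoundedPolys.

(** Three exponents below k add up to less than 3k. *)
Lemma card_bmultinom_ge k : (k ^ 3 <= #|{: bmultinom 3 (3 * k)}|)%N.
Proof.
have [->|k0] := posnP k; first by rewrite muln0 exp0n.
pose m (t : {ffun 'I_3 -> 'I_k}) := Multinom [tuple val (t i) | i < 3].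
have mE t i : m t i = t i by rewrite multinomE tnth_mktuple.
have mk t : (mdeg (m t) < 3 * k)%N.
  rewrite mdegE !big_ord_recl big_ord0 !mE.
  have := ltn_ord (t ord0); have := ltn_ord (t (lift ord0 ord0)).
  by have := ltn_ord (t (lift ord0 (lift ord0 ord0))); lia.
have fi : injective (fun t => BMultinom (mk t)).
  move=> t u /(congr1 (fun x => bmnm x)) E; apply/ffunP => i; apply/val_inj => /=.
  by rewrite -!mE (E : m t = m u).
by have := leq_card _ fi; rewrite card_ffun !card_ord.
Qed.

Section Iterated.
Variables (K : numFieldType) (n : nat).
Implicit Types (f : mpoly n K) (p : 'rV[K]_n).
Variables (I : eqType) (e : I -> 'rV[K]_n).

Definition dirds (s : seq I) f := foldr (fun i => dird (e i)) f s.

Lemma dirds_perm s t f : perm_eq s t -> dirds s f = dirds t f.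
Proof.
have dirdsC i s' g : dirds s' (dird (e i) g) = dird (e i) (dirds s' g).
  by elim: s' => //= j s' ->; rewrite dird_comm.
elim: s t => [|x s IH] t st.
  by move: st; rewrite perm_sym => /perm_nilP ->.
have xt : x \in t by rewrite -(perm_mem st) mem_head.
move: st; case/splitPr: xt => t1 t2.
rewrite -[x :: t2]cat1s perm_sym perm_catCA /= perm_cons perm_sym => /IH /= ->.
by rewrite /dirds !foldr_cat /= -/(dirds _ _) -/(dirds t1 _) dirdsC.
Qed.

Lemma ordge_dirds p k s f : ordge p k f -> ordge p (k - size s)%N (dirds s f).
Proof.
by elim: s => [|i s IH] Hf; rewrite ?subn0 //= subnS; apply/ordge_dird/IH.
Qed.

Lemma msize_dirds s f k : (mmeasure mdeg f <= k)%N -> (mmeasure mdeg (dirds s f) <= k)%N.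
Proof.
move=> Hf; elim: s => //= i s IH; apply: leq_trans (msize_dird (e i) IH) _; exact: leq_pred.
Qed.

Lemma dirds_cat s t f : dirds (s ++ t) f = dirds s (dirds t f).
Proof. exact: foldr_cat. Qed.

Lemma dirds_nseq k i f : dirds (nseq k i) f = iter k (dird (e i)) f.
Proof. by elim: k => //= k ->. Qed.

End Iterated.

(** * Orders of vanishing modulo an ideal *)

Section Ideals.
Variables (K : numFieldType) (n : nat) (I : set (mpoly n K)).
Hypotheses (I0 : I 0) (Ilin : forall a f g, I f -> I g -> I (a *: f + g))
  (Imul : forall f g, I g -> I (f * g)).

(* Membership in I + m_p^k, where m_p is the maximal ideal of p. *)
Definition ordge_mod (p : 'rV[K]_n) k (f : mpoly n K) : Prop :=
  exists2 g, I g & ordge p k (f - g).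

Lemma ordge_mod_lin p k a f g : ordge_mod p k f -> ordge_mod p k g -> ordge_mod p k (a *: f + g).
Proof.
move=> [f1 If1 Hf] [g1 Ig1 Hg]; exists (a *: f1 + g1); first exact: Ilin.
rewrite (_ : _ - _ = a *: (f - f1) + (g - g1)); first exact: ordge_lin.
by rewrite scalerBr opprD addrACA.
Qed.

Lemma ordge_mod_leq p k l f : (l <= k)%N -> ordge_mod p k f -> ordge_mod p l f.
Proof. by move=> lk [g Ig H]; exists g => //; apply: ordge_leq H. Qed.

Lemma ordge_mod_ideal p k f : I f -> ordge_mod p k f.
Proof. by move=> If; exists f => //; rewrite subrr; apply: ordge0. Qed.

Lemma ordge_modW p k f : ordge p k f -> ordge_mod p k f.
Proof. by move=> Hf; exists 0 => //; rewrite subr0. Qed.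

Lemma ordge_mod_mul p k f g : ordge_mod p k f -> ordge_mod p k (g * f).
Proof.
move=> [f1 If1 Hf]; exists (g * f1); first exact: Imul.
by rewrite -mulrBr; apply: ordge_mull.
Qed.

Lemma ordge_mod_mulS p k f g : peval g p = 0 -> ordge_mod p k f -> ordge_mod p k.+1 (g * f).
Proof.
move=> g0 [f1 If1 Hf]; exists (g * f1); first exact: Imul.
by rewrite -mulrBr; apply: ordge_mulS.
Qed.

(** A truncated geometric series in 1 - g / g(p) inverts g modulo the k-th power of the maximal
    ideal. *)
Lemma ordge_mod_unit p k f g : peval g p != 0 -> ordge_mod p k (g * f) -> ordge_mod p k f.
Proof.
set c := peval g p => c0 H; pose u := 1 - c^-1 *: g.
have up : peval u p = 0 by rewrite pevalB peval1 pevalZ mulVf // subrr.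
have -> : f = 1 *: (c^-1 *: (\sum_(i < k) u ^+ i) * (g * f)) + u ^+ k * f.
  have e : c^-1 *: (\sum_(i < k) u ^+ i) * g = 1 - u ^+ k.
    rewrite -[RHS]opprB subrX1 -mulNr opprB.
    rewrite -scalerAl mulrC scalerAl.
    by have -> : c^-1 *: g = 1 - u by rewrite opprB addrC subrK.
  by rewrite scale1r mulrA e mulrBl mul1r subrK.
apply: ordge_mod_lin; first exact: ordge_mod_mul.
by apply/ordge_modW; rewrite mulrC; apply/ordge_mull/ordge_exp.
Qed.

End Ideals.

Section Levels.
Variable N : nat.
Hypothesis N0 : (0 < N)%N.

(* The least k such that b + N k >= kappa. *)
Definition lev (b kappa : nat) := ((kappa - b + N.-1) %/ N)%N.

Lemma lev_le b kappa k : (lev b kappa <= k)%N = (kappa <= N * k + b)%N.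
Proof.
rewrite /lev -ltnS ltn_divLR // mulSn; case: N N0 => // M _; rewrite mulnC.
by apply/idP/idP; move: (M.+1 * k)%N => x; lia.
Qed.

Lemma lev_mono b k l : (k <= l)%N -> (lev b k <= lev b l)%N.
Proof. by move=> kl; rewrite lev_le (leq_trans kl) // -lev_le. Qed.

Lemma lev_eqS b r : lev b (N * r + b).+1 = r.+1.
Proof.
apply/eqP; rewrite eqn_leq lev_le mulnS; apply/andP; split; first by lia.
by rewrite ltnNge lev_le; lia.
Qed.

Lemma lev_add b k : (lev b (k + N) <= (lev b k).+1)%N.
Proof. by rewrite lev_le mulnS; have := lev_le b k (lev b k); rewrite leqnn => /esym; lia. Qed.

Lemma lev_addb b k : lev (b + N) (k + N) = lev b k.
Proof. by rewrite /lev subnDr. Qed.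

Lemma lev_shift b k : (lev (b + N) k <= lev b k)%N.
Proof. by rewrite lev_le; have := lev_le b k (lev b k); rewrite leqnn => /esym; lia. Qed.

Lemma lev_neq b b' r : (b %% N != b' %% N)%N -> lev b (N * r + b').+1 = lev b (N * r + b').
Proof.
move=> bb; apply/eqP; rewrite eqn_leq [X in _ && X]lev_mono // andbT lev_le.
rewrite ltn_neqAle -lev_le leqnn andbT.
apply: contra bb => /eqP e; have := congr1 (modn^~ N) e.
by rewrite ![(N * _)%N]mulnC !modnMDl => ->.
Qed.

End Levels.

Lemma sum_drop (d : nat -> nat) K : {homo d : i j / (i <= j)%N >-> (j <= i)%N} ->
  (\sum_(k < K) (d k - d k.+1) = d 0 - d K)%N.
Proof.
move=> dm; elim: K => [|K IH]; first by rewrite big_ord0 subnn.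
rewrite big_ord_recr /= IH; have := dm 0%N K isT; have := dm K K.+1 (leqnSn K); lia.
Qed.

Lemma sum_inj_le (T S : finType) (g : T -> S) (F : S -> nat) : injective g ->
  (\sum_t F (g t) <= \sum_s F s)%N.
Proof.
move=> gi; rewrite -(big_imset F (h := g) (A := T)) /=; last by move=> x y _ _; apply: gi.
by rewrite [leqRHS](bigID (fun s : S => s \in imset g (mem T))) /= leq_addr.
Qed.

(** * The filtration, the shares and the effect of a bump *)

Section Budget.
Variables (K : numFieldType) (N dim n : nat).
Hypothesis N0 : (0 < N)%N.
Variables (J : finType) (pt : J -> 'rV[K]_dim) (I : set (mpoly dim K)).
Hypotheses (I0 : I 0) (Ilin : forall a f g, I f -> I g -> I (a *: f + g))
  (Imul : forall f g, I g -> I (f * g)).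
Implicit Types (beta : J -> nat) (m kappa : nat).

Local Notation phi := (@to_mpoly K dim n).

(** At level [kappa] the order demanded at q is about (kappa - beta q) / N. The ambient bound [n] is
    kept apart from the degree bound [m], so that different degrees are compared in one space. *)
Definition level_set beta m kappa : set (bpoly_vec K dim n) :=
  [set v | (mmeasure mdeg (phi v) <= m)%N /\
    forall q, ordge_mod I (pt q) (lev N (beta q) kappa) (phi v)].

Lemma level_set_lin beta m kappa : lin_closed (level_set beta m kappa).
Proof.
split; first split=> [|q]; rewrite ?linear0 ?mmeasure0 //.
  by apply: ordge_mod_ideal.
move=> a u v [um Hu] [vm Hv]; rewrite /level_set /= linearP; split.
  by apply: msize_add => //; apply: msize_scale.
by move=> q; apply: ordge_mod_lin.
Qed.

Definition level_space beta m kappa := vspace_of (level_set beta m kappa).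

Lemma level_spaceP beta m kappa v :
  v \in level_space beta m kappa <-> level_set beta m kappa v.
Proof. exact/vspace_ofP/level_set_lin. Qed.

Lemma level_spaceS beta m k l : (k <= l)%N ->
  (level_space beta m l <= level_space beta m k)%VS.
Proof.
move=> kl; apply: vspace_ofS; [exact: level_set_lin|exact: level_set_lin|].
move=> v [vm Hv]; split=> // q; apply: ordge_mod_leq (Hv q); exact: lev_mono.
Qed.

Definition jump beta m kappa :=
  (\dim (level_space beta m kappa) - \dim (level_space beta m kappa.+1))%N.

(* Passing from level k to k + 1 strengthens only the condition at the point p
   with beta p = k modulo N. *)
Definition share beta m p := (\sum_(r < n) jump beta m (N * r + beta p))%N.

Definition small_set m : set (bpoly_vec K dim n) := [set v | (mmeasure mdeg (phi v) <= m)%N].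
Definition small_ideal m : set (bpoly_vec K dim n) :=
  [set v | (mmeasure mdeg (phi v) <= m)%N /\ I (phi v)].

Lemma small_set_lin m : lin_closed (small_set m).
Proof.
split; first by rewrite /small_set /= linear0 mmeasure0.
by move=> a u v um vm; rewrite /small_set /= linearP; apply: msize_add => //; apply: msize_scale.
Qed.

Lemma small_ideal_lin m : lin_closed (small_ideal m).
Proof.
split; first by rewrite /small_ideal /= linear0 mmeasure0.
move=> a u v [um Iu] [vm Iv]; rewrite /small_ideal /= linearP; split; last exact: Ilin.
by apply: msize_add => //; apply: msize_scale.
Qed.

(** The Hilbert function of [I], counting polynomials of degree below [m] modulo [I]. *)
Definition hilb m := (\dim (vspace_of (small_set m)) - \dim (vspace_of (small_ideal m)))%N.

Lemma small_ideal_sub beta m kappa : (vspace_of (small_ideal m) <= level_space beta m kappa)%VS.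
Proof.
apply: vspace_ofS; [exact: small_ideal_lin|exact: level_set_lin|].
by move=> v [vm Iv]; split=> // q; apply: ordge_mod_ideal.
Qed.

Lemma level_space_sub beta m kappa : (level_space beta m kappa <= vspace_of (small_set m))%VS.
Proof.
apply: vspace_ofS; [exact: level_set_lin|exact: small_set_lin|].
by move=> v [].
Qed.

Lemma sum_jump beta m M : (\sum_(k < M) jump beta m k =
  \dim (level_space beta m 0) - \dim (level_space beta m M))%N.
Proof.
apply: (@sum_drop (fun k => \dim (level_space beta m k))) => k l kl.
exact/dimvS/level_spaceS.
Qed.

Definition distinct_mod beta := forall p q, p != q -> (beta p %% N != beta q %% N)%N.

(** Handicaps that differ modulo N make the levels N r + beta p pairwise distinct, so the shares are
    part of one telescoping sum; every level contains the ideal. *)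
Lemma sum_share beta m : distinct_mod beta -> (\sum_p share beta m p <= hilb m)%N.
Proof.
move=> bd; pose M := (N * n + \sum_p beta p).+1.
have ltM (t : J * 'I_n) : (N * t.2 + beta t.1 < M)%N.
  rewrite ltnS leq_add ?leq_mul // ?(ltnW (ltn_ord _)) //.
  by rewrite (bigD1 t.1) //= leq_addr.
pose g t := Ordinal (ltM t).
have gi : injective g.
  move=> [p r] [q s] /(congr1 val) /= e.
  have pq : p = q.
    apply/eqP; apply: contraT => /bd; have := congr1 (modn^~ N) e.
    by rewrite ![(N * _)%N]mulnC !modnMDl => ->; rewrite eqxx.
  subst q; move: e => /addIn /eqP; rewrite eqn_pmul2l // => /eqP/val_inj -> //.
rewrite /share pair_bigA /=.
apply: (leq_trans (sum_inj_le (fun k : 'I_M => jump beta m k) gi)).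
rewrite sum_jump leq_sub //; apply: dimvS; [exact: level_space_sub|exact: small_ideal_sub].
Qed.

Lemma jump_mono_size beta m l kappa : (m <= l)%N -> (jump beta m kappa <= jump beta l kappa)%N.
Proof.
move=> ml; apply: (@dim_jump_le _ _ _ _ _ _ _ idfun).
- exact: level_spaceS.
- exact: level_spaceS.
- move=> v /level_spaceP [vm Hv]; apply/level_spaceP; split=> //; exact: leq_trans ml.
move=> v /level_spaceP [vm Hv] /level_spaceP [vl Hv']; apply/level_spaceP; split=> //.
Qed.

(** Each jump grows with the degree bound, so the increase in one share is at most the increase in
    the sum of all jumps. *)
Lemma share_size beta m l p : (m <= l)%N ->
  (share beta l p <= share beta m p + (hilb l - hilb m))%N.
Proof.
move=> ml; rewrite -leq_subLR /share -sumnB; last by move=> r _; apply: jump_mono_size.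
pose M := (N * n + beta p).+1.
have ltM (r : 'I_n) : (N * r + beta p < M)%N.
  by rewrite ltnS leq_add2r leq_mul // ltnW.
have gi : injective (fun r => Ordinal (ltM r)).
  by move=> r s [/addIn/eqP]; rewrite eqn_pmul2l // => /eqP/val_inj.
apply: leq_trans (sum_inj_le (fun k : 'I_M => jump beta l k - jump beta m k)%N gi) _.
rewrite sumnB; last by move=> r _; apply: jump_mono_size.
rewrite !sum_jump.
have E k : vspace_of (small_set k) = level_space beta k 0.
  apply/vspaceP => v; apply/idP/idP => [/(vspace_ofP _ (small_set_lin k)) vk|].
    apply/level_spaceP; split=> // q; exists 0 => //; rewrite /lev sub0n.
    by rewrite divn_small //; case: N N0.
  by move/level_spaceP => [vk _]; apply/(vspace_ofP _ (small_set_lin k)).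
rewrite /hilb !E.
(* The last level contains the ideal, hence grows at least as much as it does. *)
have H : (\dim (vspace_of (small_ideal l)) - \dim (vspace_of (small_ideal m)) <=
    \dim (level_space beta l M) - \dim (level_space beta m M))%N.
  apply: (@dim_jump_le _ _ _ _ _ _ _ idfun).
  - apply: vspace_ofS; [exact: small_ideal_lin|exact: small_ideal_lin|].
    by move=> v [vm Iv]; split=> //; apply: leq_trans ml.
  - apply: vspace_ofS; [exact: level_set_lin|exact: level_set_lin|].
    by move=> v [vm Iv]; split=> //; apply: leq_trans ml.
  - by move=> v; apply/subvP/small_ideal_sub.
  move=> v /(vspace_ofP _ (small_ideal_lin l)) [_ Iv] /level_spaceP [vm _].
  by apply/(vspace_ofP _ (small_ideal_lin m)).
have h1 := dimvS (level_spaceS beta m (leq0n M)).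
have h2 := dimvS (level_spaceS beta l (leq0n M)).
have h3 := dimvS (small_ideal_sub beta m M).
have h4 := dimvS (small_ideal_sub beta l M).
have h5 : (\dim (vspace_of (small_ideal m)) <= \dim (vspace_of (small_ideal l)))%N.
  apply/dimvS/vspace_ofS; [exact: small_ideal_lin|exact: small_ideal_lin|].
  by move=> v [vm Iv]; split=> //; apply: leq_trans ml.
have h6 : (\dim (level_space beta m M) <= \dim (level_space beta l M))%N.
  apply/dimvS/vspace_ofS; [exact: level_set_lin|exact: level_set_lin|].
  by move=> v [vm Iv]; split=> //; apply: leq_trans ml.
lia.
Qed.

Definition bump beta p q := (beta q + N * (q == p))%N.

Lemma bump_distinct beta p : distinct_mod beta -> distinct_mod (bump beta p).
Proof.
move=> bd q r /bd; rewrite /bump.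
by rewrite !(addnC (beta _)) ![(N * _)%N]mulnC !modnMDl.
Qed.

(** The bump weakens the condition at p. Between consecutive levels belonging to q only the
    condition at q changes, so inclusion remains injective on the quotients. *)
Lemma share_bump_other beta p q m : distinct_mod beta -> q != p ->
  (share beta m q <= share (bump beta p) m q)%N.
Proof.
move=> bd qp; apply: leq_sum => r _.
have bq : bump beta p q = beta q by rewrite /bump (negPf qp) muln0 addn0.
rewrite bq; apply: (@dim_jump_le _ _ _ _ _ _ _ idfun).
- exact: level_spaceS.
- exact: level_spaceS.
- move=> v /level_spaceP [vm Hv]; apply/level_spaceP; split=> // s.
  apply: ordge_mod_leq (Hv s); rewrite /bump.
  by case: eqP => _; rewrite ?muln0 ?addn0 // muln1; apply: lev_shift.
move=> v /level_spaceP [vm Hv] /level_spaceP [_ Hv']; apply/level_spaceP; split=> // s.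
have [->|sq] := eqVneq s q; first by have := Hv' q; rewrite bq.
by rewrite lev_neq // bd.
Qed.

(** Multiplication by Q maps the old filtration into the new one at a level higher by N. At q != p
    this demands at most one more order, which the zero of Q supplies; at p the order demanded is
    unchanged and Q is a local unit, so quotients inject. The price is the degree of Q. *)
Lemma share_bump_same beta p m l (Q : mpoly dim K) : distinct_mod beta ->
  (m <= l)%N -> (l <= n)%N ->
  (forall f, (mmeasure mdeg f <= m)%N -> (mmeasure mdeg (Q * f) <= l)%N) ->
  peval Q (pt p) != 0 -> (forall q, q != p -> peval Q (pt q) = 0) ->
  (share beta m p <= share (bump beta p) l p)%N.
Proof.
move=> bd ml ln Qs Qp Qq; apply: leq_sum => r _.
have bp : bump beta p p = (beta p + N)%N by rewrite /bump eqxx muln1.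
pose mu (v : bpoly_vec K dim n) := of_mpoly n (Q * phi v).
have mul_lin : linear mu.
  by move=> a u v; rewrite /mu linearP mulrDr -scalerAr linearP.
pose mu' := GRing.isLinear.Build K _ _ _ mu mul_lin.
pose muL : {linear bpoly_vec K dim n -> bpoly_vec K dim n} := HB.pack mu mu'.
have muE v : (mmeasure mdeg (phi v) <= m)%N -> phi (mu v) = Q * phi v.
  by move=> vm; rewrite of_mpolyK // (leq_trans (Qs _ vm)).
rewrite bp addnA; set k := (N * r + beta p)%N.
apply: (@dim_jump_le _ _ _ _ _ _ _ muL).
- exact: level_spaceS.
- exact: level_spaceS.
- move=> v /level_spaceP [vm Hv]; apply/level_spaceP; split; rewrite muE //; first exact: Qs.
  move=> q; have [->|qp] := eqVneq q p.
    by rewrite bp lev_addb; apply: ordge_mod_mul.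
  rewrite /bump (negPf qp) muln0 addn0.
  by apply: ordge_mod_leq (lev_add N0 _ _) _; apply: ordge_mod_mulS => //; apply: Qq.
move=> v /level_spaceP [vm Hv] /level_spaceP [_ Hv']; apply/level_spaceP; split=> // q.
have [->|qp] := eqVneq q p; last by rewrite lev_neq // bd.
have := Hv' p; rewrite muE // bp -addSn lev_addb.
exact: ordge_mod_unit.
Qed.

End Budget.

(** * Counting vanishing conditions along the branches *)

Section Vanishing.
Variables (K : numFieldType) (N dim n : nat).
Hypothesis N0 : (0 < N)%N.
Variables (J B : finType) (pt : J -> 'rV[K]_dim) (I : J -> B -> set (mpoly dim K))
  (e : J -> B -> 'rV[K]_dim) (beta : J -> nat) (U : {set J}).
Hypotheses (I0 : forall p i, I p i 0)
  (Ilin : forall p i a f g, I p i f -> I p i g -> I p i (a *: f + g))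
  (U0 : exists p, p \in U)
  (gap : forall p q, p \in U -> q \notin U -> (beta p + N * n <= beta q)%N)
  (basis : forall p v, p \in U -> exists c : B -> K, v = \sum_i c i *: e p i)
  (tangent : forall p i f r, p \in U -> I p i f -> ordge (pt p) r f ->
    (line_poly (pt p) (e p i) f)`_r = 0).

Definition multi_seq (r : B -> nat) := flatten [seq nseq (r i) i | i <- index_enum B].

Lemma count_multi_seq r i : count_mem i (multi_seq r) = r i.
Proof.
rewrite count_flatten sumnE !big_map (bigD1_seq i) ?mem_index_enum ?index_enum_uniq //=.
rewrite count_nseq /= eqxx mul1n big1 ?addn0 // => j /negPf ji.
by rewrite count_nseq /= ji.
Qed.

Definition jumps p i : {set 'I_n} :=
  [set r : 'I_n | jump N n pt (I p i) beta n (N * r + beta p) != 0%N].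

Lemma card_jumps p i : (#|jumps p i| <= share N n pt (I p i) beta n p)%N.
Proof.
rewrite -sum1_card big_mkcond /=; apply: leq_sum => r _; rewrite inE.
by case: ifP => //; rewrite lt0n.
Qed.

(* If fewer conditions sufficed, some F != 0 would satisfy them all.  Choose p in U
   with N * mu p + beta p least, where mu p is the order of F at p; a non-zero
   iterated derivative of F at p along the e p i then contradicts one of them. *)
Lemma vanishing : (#|{: bmultinom dim n}| <=
  \sum_(p in U) \prod_i share N n pt (I p i) beta n p)%N.
Proof.
have [U1 pU] := U0.
rewrite leqNgt; apply/negP => small.
(* One condition for each p in U and each choice, for every branch, of an order at which the
   dimension jumps: the mixed derivative with these multiplicities vanishes at p. *)
pose C : {set J * {ffun B -> 'I_n}} := finset (fun t => (t.1 \in U) && (t.2 \in family (jumps t.1))).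
have cC : (#|C| < #|{: bmultinom dim n}|)%N.
  apply: leq_ltn_trans small; rewrite -sum1_card.
  under eq_bigl do rewrite inE.
  rewrite -(pair_big_dep (fun p => p \in U) (fun p r => r \in family (jumps p)) (fun _ _ => 1%N)) /=.
  apply: leq_sum => p _; rewrite sum1_card card_family foldrE big_map -big_enum /=.
  by apply: leq_prod => i _; apply: card_jumps.
pose phi := @to_mpoly K dim n.
pose lam (t : J * {ffun B -> 'I_n}) f := peval (dirds (e t.1) (multi_seq (fun i => t.2 i)) f) (pt t.1).
have [c [[m cm] cC0]] := @fun_dep K {: bmultinom dim n} {t | t \in C}
  (fun m t => lam (val t) (mpolyX K (bmnm m))) (leq_ltn_trans (eq_leq (card_sig _)) cC).
pose F := \sum_(m : bmultinom dim n) c m *: mpolyX K (bmnm m).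
have F0 : F != 0.
  apply: contraNneq cm => /mpolyP/(_ (bmnm m)); rewrite mcoeff0 raddf_sum (bigD1 m) //=.
  rewrite mcoeffZ mcoeffX eqxx mulr1 big1 ?addr0 => [->//|m' /negPf m'm].
  by rewrite mcoeffZ mcoeffX -bmeqP m'm mulr0.
have Fn : (mmeasure mdeg F <= n)%N.
  by apply: msize_sum => m' _; apply: msize_scale; rewrite mmeasureX; apply: bmdeg.
have dirds_lin p s : linear (dirds (e p) s : mpoly dim K -> mpoly dim K).
  by elim: s => [|i s IH] a f g //=; rewrite IH linearP.
have dirds_sum p s (X : finType) (G : X -> mpoly dim K) :
    dirds (e p) s (\sum_x G x) = \sum_x dirds (e p) s (G x).
  apply: (big_morph (dirds (e p) s)) => [f g|].
    by have := dirds_lin p s 1 f g; rewrite !scale1r.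
  by have := dirds_lin p s (-1) 0 0; rewrite !scaleN1r oppr0 addr0 addNr.
have dirdsZ p s a f : dirds (e p) s (a *: f) = a *: dirds (e p) s f.
  have z : dirds (e p) s 0 = 0.
    by have := dirds_lin p s (-1) 0 0; rewrite !scaleN1r oppr0 addr0 addNr.
  by have := dirds_lin p s a f 0; rewrite z !addr0.
have lamF t : t \in C -> lam t F = 0.
  move=> tC; rewrite -[RHS](cC0 (exist _ t tC)) /lam dirds_sum peval_sum.
  by apply: eq_bigr => m' _; rewrite dirdsZ pevalZ.
have ordF p : exists2 k, (k < n)%N & ordge (pt p) k F /\ ~ ordge (pt p) k.+1 F.
  pose P k := `[< ordge (pt p) k F >].
  have P0 : exists k, P k by exists 0%N; apply/asboolP.
  have Pb k : P k -> (k <= (mmeasure mdeg F).-1)%N.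
    move/asboolP => Hk; rewrite leqNgt; apply/negP => ltk; move/eqP: F0; apply.
    apply: (@ordge_msize _ _ (pt p)); apply: ordge_leq Hk.
    by move: ltk; case: (mmeasure _ _).
  case: (ex_maxnP P0 Pb) => k /asboolP Hk kmax; exists k.
    apply: leq_trans Fn; have := kmax k; move/(_ _): (Pb k) => /(_ (asboolT Hk)).
    have : mmeasure mdeg F != 0%N by rewrite mmeasure_poly_eq0.
    by case: (mmeasure _ _).
  by split=> // Hk1; have := kmax k.+1 (asboolT Hk1); rewrite ltnn.
have /choice [mu Hmu] : forall p, exists k, (k < n)%N /\ (ordge (pt p) k F /\ ~ ordge (pt p) k.+1 F).
  by move=> p; have [k kn Hk] := ordF p; exists k.
have [p [pU' pmin]] : exists p, p \in U /\
    forall q, q \in U -> (N * mu p + beta p <= N * mu q + beta q)%N.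
  exists [arg min_(p < U1 in U) (N * mu p + beta p)].
  by case: arg_minnP.
rename pU into pU1; rename pU' into pU.
have [mun [ordp nordp]] := Hmu p.
have [s ss Fs] : exists2 s : seq B, size s = mu p & peval (dirds (e p) s F) (pt p) != 0.
  apply: contrapT => H; apply: nordp; apply: (ordge_basis (e := e p)) => [v|s ss].
    exact: basis.
  have [lt|ge] := ltnP (size s) (mu p).
    have := ordge_dirds (e p) s ordp; rewrite -(subnSK lt).
    by case.
  apply/eqP; apply: contrapT => /negP Fs; apply: H; exists s => //.
  by apply/eqP; rewrite eqn_leq ge andbT -ltnS.
have cn i : (count_mem i s < n)%N by rewrite (leq_ltn_trans (count_size _ _)) // ss.
pose r : {ffun B -> 'I_n} := [ffun i => Ordinal (cn i)].
have permr : perm_eq s (multi_seq (fun i => r i)).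
  by apply/allP => i _ /=; rewrite count_multi_seq ffunE.
(* If every multiplicity is a jump, the non-zero derivative violates an imposed condition. Otherwise
   some branch i has no jump at its multiplicity. *)
have [rJ|/forallPn [i ri]] := boolP [forall i, r i \in jumps p i].
  have rC : (p, r) \in C by rewrite inE /= pU; apply/familyP => i; move/forallP: rJ.
  by move: Fs; rewrite (dirds_perm _ _ permr) -[peval _ _]/(lam (p, r) F) lamF ?eqxx.
(* Apply the derivatives along the other branches first; the resulting F' has order k at p and a
   non-zero k-th coefficient along the tangent of branch i. *)
pose s' := [seq j <- s | predC1 i j]; pose k := count_mem i s.
have perms : perm_eq s (nseq k i ++ s').
  rewrite -(perm_filterC (pred1 i)) perm_cat2r (_ : [seq x <- s | pred1 i x] = nseq k i) //.
  by rewrite /k -size_filter; apply/all_pred1P/filter_all.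
have sizek : (k + size s' = mu p)%N by rewrite -ss (perm_size perms) size_cat size_nseq.
pose F' := dirds (e p) s' F.
have F'n : (mmeasure mdeg F' <= n)%N by apply: msize_dirds.
have F'p : (line_poly (pt p) (e p i) F')`_k != 0.
  by rewrite coef_line_eq0 -dirds_nseq -dirds_cat -(dirds_perm _ _ perms).
have F'ord q : ordge (pt q) (mu q - size s') F'.
  by apply: ordge_dirds; have [_ []] := Hmu q.
move: ri; rewrite inE ffunE /= -/k negbK /jump subn_eq0 => le.
pose v := of_mpoly n F'; have phiv : phi v = F' by apply: of_mpolyK.
set kap := (N * k + beta p)%N in le.
have lvl kk := @level_spaceP K N dim n J pt (I p i) (I0 p i) (Ilin (p := p) (i := i)) beta n kk v.
(* For q in U the order of F' suffices by the minimality of p; for q outside U the gap means that no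
   order is demanded. *)
have vin : v \in level_space N n pt (I p i) beta n kap.
  apply/lvl; split; first exact: msize_to_mpoly.
  move=> q; apply: ordge_modW => //; rewrite -/phi phiv.
  have [qU|qU] := boolP (q \in U); last first.
    apply: ordge_leq (F'ord q); rewrite lev_le // /kap.
    have kn : (N * k <= N * n)%N by rewrite leq_mul // ltnW // cn.
    apply: leq_trans (leq_addl _ _); apply: leq_trans (gap pU qU).
    by rewrite addnC leq_add2l.
  apply: ordge_leq (F'ord q); rewrite lev_le // /kap mulnBr.
  have := pmin q qU; rewrite -sizek mulnDr.
  move: (N * k)%N (N * size s')%N (N * mu q)%N (beta p) (beta q) => x1 x2 x3 x4 x5; lia.
(* As there is no jump, F' agrees up to order k + 1 at p with some g in the ideal of branch i, whose
   k-th coefficient along the tangent is zero. *)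
have : v \in level_space N n pt (I p i) beta n kap.+1.
  have := level_spaceS n N0 pt (I0 p i) (Ilin (p := p) (i := i)) beta n (leqnSn kap).
  move=> sub; have : level_space N n pt (I p i) beta n kap.+1 = level_space N n pt (I p i) beta n kap.
    by apply/eqP; rewrite eqEdim sub.
  by move=> ->.
move/lvl => [_ /(_ p)]; rewrite -/phi phiv lev_eqS // => -[g Ig Hg].
have ordF' : ordge (pt p) k F' by have := F'ord p; rewrite -sizek addnK.
have ordg : ordge (pt p) k g.
  rewrite (_ : g = F' - (F' - g)); last by rewrite opprB addrC subrK.
  by apply: ordgeB => //; apply: ordge_leq Hg.
move/eqP: F'p; apply; have := tangent pU Ig ordg.
rewrite {1}(_ : g = F' - (F' - g)); last by rewrite opprB addrC subrK.
by rewrite rmorphB coefB (coef_line_ordge _ Hg) // subr0.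
Qed.
End Vanishing.

(** * Termination of the balancing procedure *)

Lemma gap_exists (J : finType) (c : J -> nat) n :
  exists2 i, (i <= #|J|)%N & forall q, (c q <= i * n.+1)%N \/ (i.+1 * n.+1 < c q)%N.
Proof.
apply: contrapT => H.
(* Pigeonhole: there are |J| + 1 disjoint windows for |J| values. *)
have /choice [f Hf] : forall i : 'I_#|J|.+1, exists q, (i * n.+1 < c q <= i.+1 * n.+1)%N.
  move=> i; apply: contrapT => Hi; apply: H; exists i => [|q]; first by rewrite -ltnS.
  have [|lt] := leqP (c q) (i * n.+1); [by left|right].
  by rewrite ltnNge; apply/negP => le; apply: Hi; exists q; rewrite lt.
have fle i j : f i = f j -> (i <= j)%N.
  move=> fij; have /andP[a1 _] := Hf i; have /andP[_ a2] := Hf j.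
  by rewrite -ltnS -(ltn_pmul2r (ltn0Sn n)) (leq_trans _ a2) // -fij.
have fi : injective f.
  by move=> i j fij; apply/val_inj/eqP; rewrite eqn_leq !fle.
by have := leq_card f fi; rewrite card_ord ltnn.
Qed.

(* Repeatedly bump an index that is over its target, inside the cluster of least
   handicaps below the first gap.  A bumped index stays good, and as long as some
   index has never been bumped, only boundedly many bumps are possible. *)
Lemma bump_until_good (J : finType) (N n : nat) (valid : (J -> nat) -> Prop)
    (good over : (J -> nat) -> J -> Prop) (beta0 : J -> nat) :
  (forall beta p, valid beta -> valid (bump N beta p)) ->
  (forall beta p, valid beta -> over beta p -> good (bump N beta p) p) ->
  (forall beta p q, valid beta -> q != p -> good beta q -> good (bump N beta p) q) ->
  (forall beta (U : {set J}), valid beta -> (exists p, p \in U) ->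
    (forall p q, p \in U -> q \notin U -> (beta p + N * n <= beta q)%N) ->
    exists2 p, p \in U & over beta p) ->
  valid beta0 -> (forall p, (beta0 p <= N)%N) ->
  exists2 beta, valid beta & forall p, good beta p.
Proof.
(* Only indices below the gap are bumped, and these have been bumped fewer than X times; so each
   bump decreases the sum of the X - c q. *)
move=> vb og gb ex v0 b0; pose X := (#|J| * n.+1).+1.
suff H m (beta c : J -> nat) : (forall q, beta q = beta0 q + N * c q)%N -> valid beta ->
    (forall p, (0 < c p)%N -> good beta p) -> (\sum_q (X - c q) < m)%N ->
    exists2 beta, valid beta & forall p, good beta p.
  by apply: (H (\sum_(q : J) (X - 0)).+1 beta0 (fun=> 0%N)) => // q; rewrite muln0 addn0.
elim: m beta c => // m IH beta c bE vbeta gc mc.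
have [[z /eqP cz]|allc] := pselect (exists z, c z == 0%N); last first.
  by exists beta => // p; apply: gc; rewrite lt0n; apply/negP => cp; apply: allc; exists p.
have [i iJ Hi] := gap_exists c n.
pose U : {set J} := finset (fun q => (c q <= i * n.+1)%N).
have [||p pU op] := ex beta U vbeta.
- by exists z; rewrite inE cz.
(* A gap of n + 1 bumps amounts to N (n + 1), of which the initial handicaps consume at most N. *)
- move=> p q; rewrite !inE => pU qU; have [qU'|cq] := Hi q; first by rewrite qU' in qU.
  rewrite !bE; have := b0 p; have := leq_mul (leqnn N) pU; have := leq_mul (leqnn N) (ltnW cq).
  by rewrite mulSn !mulnDr mulnS; lia.
move: pU; rewrite inE => pU.
have cX : (c p < X)%N by rewrite ltnS (leq_trans pU) // leq_mul2r iJ orbT.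
apply: (IH (bump N beta p) (fun q => c q + (q == p))%N).
- by move=> q; rewrite /bump bE mulnDr addnA.
- exact: vb.
- move=> q; have [->|qp] := eqVneq q p; first by move=> _; apply: og.
  by rewrite addn0 => cq; apply: gb => //; apply: gc.
move: mc; rewrite (bigD1 p) //= => mc; rewrite (bigD1 p) //= eqxx.
rewrite (eq_bigr (fun q => X - c q)%N); last by move=> q /negPf ->; rewrite addn0.
by move: mc; move: (\sum_(_ | _) _)%N => s; lia.
Qed.

(** * Hilbert functions *)

Section HilbertBound.
Variables (K : numFieldType) (dim : nat) (I : set (mpoly dim K)).
Hypotheses (I0 : I 0) (Ilin : forall a f g, I f -> I g -> I (a *: f + g)).

Lemma ideal_sub n m :
  (vspace_of (small_ideal (n := n) I m) <= vspace_of (small_set (K := K) (dim := dim) (n := n) m))%VS.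
Proof. by apply: vspace_ofS; [exact: small_ideal_lin|exact: small_set_lin|move=> v []]. Qed.

Lemma hilb_bound n m M : (m <= n)%N ->
  (forall (X : finType) (f : X -> mpoly dim K), (forall i, mmeasure mdeg (f i) <= m)%N ->
     (M < #|X|)%N -> exists c : X -> K, (exists i, c i != 0) /\ I (\sum_i c i *: f i)) ->
  (hilb n I m <= M)%N.
Proof.
move=> mn H; rewrite leqNgt; apply/negP => lt.
pose P := vspace_of (small_set (K := K) (dim := dim) (n := n) m).
pose Q := vspace_of (small_ideal (n := n) I m).
have PP := vspace_ofP _ (@small_set_lin K dim n m).
have QP := vspace_ofP _ (@small_ideal_lin K dim n I I0 Ilin m).
have QS : (Q <= P)%VS by apply: ideal_sub.
pose C := (P :\: Q)%VS.
have dC : \dim C = hilb n I m by rewrite /hilb -/P -/Q -(dimv_cap_compl P Q) (capv_idPr QS) addKn.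
pose b := vbasis C.
have [||c [[i ci] Ic]] := H 'I_(\dim C) (fun i => to_mpoly (tnth b i)).
- move=> i; have /PP : tnth b i \in P.
    by apply: (subvP (diffvSl P Q)); apply: vbasis_mem; apply: mem_tnth.
  by [].
- by rewrite card_ord dC.
pose v := \sum_i c i *: tnth b i.
have vC : v \in C.
  by apply: memv_suml => j _; apply/memvZ/vbasis_mem/mem_tnth.
have vQ : v \in Q.
  apply/QP; split.
    by have /PP := subvP (diffvSl P Q) v vC.
  by rewrite /v linear_sum /=; under eq_bigr do rewrite linearZ.
have v0 : v = 0.
  by apply/eqP; rewrite -memv0 -(capv_diff P Q) memv_cap vC.
have := basis_free (vbasisP C) => /freeP/(_ c) H'.
move/eqP: ci; apply; apply: H'.
by rewrite -[RHS]v0 /v; apply: eq_bigr => j _; rewrite (tnth_nth 0).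
Qed.

Lemma hilb_ambient n m : (m <= n)%N -> hilb n I m = hilb m I m.
Proof.
move=> mn; apply/eqP; rewrite eqn_leq; apply/andP; split.
all: pose sP k v := vspace_ofP v (@small_set_lin K dim k m).
all: pose iP k v := vspace_ofP v (@small_ideal_lin K dim k I I0 Ilin m).
  apply: (dim_jump_le (f := @of_mpoly K dim m \o @to_mpoly K dim n)).
  - exact: ideal_sub.
  - exact: ideal_sub.
  - by move=> v /sP vm; apply/sP; rewrite /small_set /= of_mpolyK.
  by move=> v /sP vm /iP [_]; rewrite /= of_mpolyK // => Iv; apply/iP.
apply: (dim_jump_le (f := @of_mpoly K dim n \o @to_mpoly K dim m)).
- exact: ideal_sub.
- exact: ideal_sub.
- move=> v /sP vm; apply/sP; rewrite /small_set /= of_mpolyK //; exact: leq_trans mn.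
move=> v /sP vm /iP [_]; rewrite /= of_mpolyK // => [Iv|]; [exact/iP|exact: leq_trans mn].
Qed.

Lemma hilb_mono n m l : (m <= l)%N -> (hilb n I m <= hilb n I l)%N.
Proof.
pose sP k v := vspace_ofP v (@small_set_lin K dim n k).
pose iP k v := vspace_ofP v (@small_ideal_lin K dim n I I0 Ilin k).
move=> ml; apply: (@dim_jump_le _ _ _ _ _ _ _ idfun).
- exact: ideal_sub.
- exact: ideal_sub.
- by move=> v /sP vm; apply/sP; apply: leq_trans ml.
by move=> v /sP vm /iP [_ Iv]; apply/iP.
Qed.

End HilbertBound.

(** * The number of tangents of one curve at a point *)

Section TangentCount.
Variables (K : numFieldType) (dim : nat) (p : 'rV[K]_dim).

Definition lin_form (a : 'rV[K]_dim) : mpoly dim K :=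
  \sum_i a 0 i *: (mpolyX K (mnm1 i) - mpolyC dim (p 0 i)).

Lemma lin_form0 a : peval (lin_form a) p = 0.
Proof.
by rewrite peval_sum big1 // => i _; rewrite pevalZ pevalB pevalXU pevalC subrr mulr0.
Qed.

Lemma msize_lin_form a : (mmeasure mdeg (lin_form a) <= 2)%N.
Proof.
apply: msize_sum => i _; apply/msize_scale/msize_add; first by rewrite mmeasureX /= mdeg1.
by rewrite mmeasureN mmeasureC; case: (_ != 0).
Qed.

Lemma line_lin_form a v : line_poly p v (lin_form a) = dotp a v *: 'X.
Proof.
rewrite /lin_form rmorph_sum /= scaler_suml; apply: eq_bigr => i _.
rewrite line_polyZ rmorphB /= line_polyX line_polyC addrAC subrr add0r scalerA //.
Qed.

Lemma msize_prod (X : Type) (s : seq X) (P : pred X) (f : X -> mpoly dim K) :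
  (forall x, mmeasure mdeg (f x) <= 2)%N ->
  (mmeasure mdeg (\prod_(x <- s | P x) f x) <= (size s).+1)%N.
Proof.
move=> f2; elim: s => [|x s IH]; first by rewrite big_nil mmeasure1.
rewrite big_cons; case: ifP => _ /=; last exact: leqW.
by rewrite -[X in (_ <= X.+1)%N]add1n; apply: msizeM_leq.
Qed.

Lemma ordge_prod (X : Type) (s : seq X) (f : X -> mpoly dim K) k g :
  (forall x, peval (f x) p = 0) -> ordge p k g -> ordge p (size s + k) (\prod_(x <- s) f x * g).
Proof.
move=> f0 Hg; elim: s => [|x s IH]; first by rewrite big_nil mul1r.
by rewrite big_cons -mulrA; apply: ordge_mulS.
Qed.

(* Modulo I, the products of linear forms below are independent: each vanishes at p
   to order k + r and its leading form vanishes on all tangents but one. *)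
Lemma tangent_count (I : set (mpoly dim K)) (D C k : nat) (v : 'I_k -> 'rV[K]_dim) :
  (forall n (X : finType) (f : X -> mpoly dim K), (forall i, mmeasure mdeg (f i) <= n.+1)%N ->
     ((n + C) * D < #|X|)%N -> exists c : X -> K, (exists i, c i != 0) /\ I (\sum_i c i *: f i)) ->
  (forall i, v i != 0) ->
  (forall i j, i != j -> exists a, dotp a (v j) = 0 /\ dotp a (v i) != 0) ->
  (forall i f r, I f -> ordge p r f -> (line_poly p (v i) f)`_r = 0) ->
  (k <= D)%N.
Proof.
move=> dimI v0 indep tan; rewrite leqNgt; apply/negP => Dk.
have /choice [a Ha] : forall ij : 'I_k * 'I_k, exists a : 'rV[K]_dim,
    dotp a (v ij.1) != 0 /\ (ij.1 != ij.2 -> dotp a (v ij.2) = 0).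
  move=> [i j] /=; have [<-|ij] := eqVneq i j; last first.
    by have [a [a1 a2]] := indep i j ij; exists a.
  have /rV0Pn [l vl] := v0 i; exists (delta_mx 0 l); split=> //.
  rewrite /dotp (bigD1 l) //= big1 ?addr0 => [|m ml]; rewrite mxE ?eqxx ?mul1r //=.
  by rewrite (negPf ml) mul0r.
(* Since k > D, this makes the number k M of products exceed (k + M - 1 + C) D, so they are
   dependent modulo I. *)
pose M := ((k + C) * D).+1.
pose f (t : 'I_k * 'I_M) := \prod_(j < k) lin_form (a (t.1, j)) * lin_form (a (t.1, t.1)) ^+ t.2.
have sz (T : finType) : size (index_enum T) = #|T| by rewrite -sum1_size sum1_card.
have fs t : (mmeasure mdeg (f t) <= (k + M.-1).+1)%N.
  have -> : (k + M.-1).+1 = ((k + M).-1).+1 by rewrite /M addnS.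
  have M0 : (0 < M)%N by [].
  apply: leq_trans (_ : (k + t.2).+1 <= _)%N; last first.
    by have := ltn_ord t.2; move: M0 (ltn_ord t.2); lia.
  apply: msizeM_leq.
    have := @msize_prod _ (index_enum 'I_k) xpredT (fun j => lin_form (a (t.1, j))) (fun j => msize_lin_form _).
    by rewrite sz card_ord.
  rewrite -[X in _ ^+ X]card_ord -prodr_const.
  have := @msize_prod _ (index_enum 'I_t.2) xpredT (fun j => lin_form (a (t.1, t.1))) (fun j => msize_lin_form _).
  by rewrite sz card_ord.
have ford (t : 'I_k * 'I_M) : ordge p (k + t.2) (f t).
  rewrite -[X in (X + _)%N]card_ord -(sz 'I_k); apply: ordge_prod => [j|].
    exact: lin_form0.
  exact/ordge_exp/lin_form0.
have fline (t : 'I_k * 'I_M) i : line_poly p (v i) (f t) =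
    (\prod_(j < k) dotp (a (t.1, j)) (v i) * dotp (a (t.1, t.1)) (v i) ^+ t.2) *: 'X^(k + t.2).
  rewrite rmorphM rmorph_prod rmorphXn /= line_lin_form.
  under eq_bigr do rewrite line_lin_form.
  rewrite scaler_prod exprZn big_const_ord iter_mulr_1 -scalerAl -scalerAr scalerA exprD //.
have [|c [[t1 ct1] Ic]] := dimI (k + M.-1)%N _ f fs.
  rewrite card_prod !card_ord /M /=; nia.
have [t0 ct0 tmin] : exists2 t0, c t0 != 0 & forall t, c t != 0 -> (t0.2 <= t.2)%N.
  have [t0 ct0 tmin] :=
    @arg_minnP _ t1 (fun t => c t != 0) (fun t : 'I_k * 'I_M => nat_of_ord t.2) ct1.
  by exists t0.
have ordc : ordge p (k + t0.2) (\sum_t c t *: f t).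
  apply: (big_ind (ordge p (k + t0.2))) => [|x y Hx Hy|t _]; [exact: ordge0|exact: ordgeD|].
  have [->|ct] := eqVneq (c t) 0; first by rewrite scale0r; apply: ordge0.
  by apply: ordgeZ; apply: ordge_leq (ford t); rewrite leq_add2l tmin.
have /eqP := tan t0.1 _ _ Ic ordc; apply/negP.
rewrite rmorph_sum coef_sum (bigD1 t0) //= big1 ?addr0 => [|t tt0].
  rewrite line_polyZ coefZ fline coefZ coefXn eqxx mulr1 !mulf_neq0 ?expf_neq0 //.
    by apply/prodf_neq0 => j _; have [] := Ha (t0.1, j).
  by have [] := Ha (t0.1, t0.1).
rewrite line_polyZ coefZ fline coefZ coefXn.
have [e1|n1] := eqVneq t.1 t0.1; last first.
  by rewrite (bigD1 t0.1) //= (proj2 (Ha (t.1, t0.1)) n1) !mul0r mulr0.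
rewrite eqn_add2l; case: eqP => [/val_inj e2|]; last by rewrite !mulr0.
by case/eqP: tt0; rewrite [t]surjective_pairing e1 -e2 -surjective_pairing.
Qed.

End TangentCount.

(** Gaining at least a d + 1 on every step of length d beyond k0 would eventually beat the linear
    bound. *)
Lemma slow_growth (h : nat -> nat) a c d : (forall k, h k <= a * k + c)%N ->
  forall k0, exists2 k, (k0 <= k)%N & (h (k + d) <= h k + a * d)%N.
Proof.
move=> hb k0; apply: contrapT => H.
have step k : (k0 <= k)%N -> (h k + a * d < h (k + d))%N.
  by move=> kk; rewrite ltnNge; apply/negP => le; apply: H; exists k.
have iter_step j : (j * (a * d).+1 <= h (k0 + j * d))%N.
  elim: j => // j IH; rewrite !mulSn addnCA.
  have := step (k0 + j * d)%N (leq_addr _ _); rewrite [(d + _)%N]addnC; move: IH.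
  by move: (h _) (h _) (j * _)%N => x y z; lia.
(* After j steps h is at least j (a d + 1), which exceeds a (k0 + j d) + c as soon as j > a k0 +
   c. *)
have := iter_step (a * k0 + c).+1; have := hb (k0 + (a * k0 + c).+1 * d)%N.
move: (h _) => x le1 le2; have := leq_trans le2 le1; nia.
Qed.

Lemma prod3_shift (x : 'I_3 -> nat) M E : (forall i, x i <= M)%N ->
  (\prod_i (x i + E) <= \prod_i x i + 3 * E * (M + E) ^ 2)%N.
Proof.
move=> xM; rewrite !big_ord_recl !big_ord0.
move: (xM ord0) (xM (lift ord0 ord0)) (xM (lift ord0 (lift ord0 ord0))).
move: (x _) (x _) (x _) => a b c aM bM cM; rewrite !muln1.
have h1 : (a * b <= M * M)%N by apply: leq_mul.
have h2 : (a * c <= M * M)%N by apply: leq_mul.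
have h3 : (b * c <= M * M)%N by apply: leq_mul.
have h4 : (a * E <= M * E)%N by apply: leq_mul.
have h5 : (b * E <= M * E)%N by apply: leq_mul.
have h6 : (c * E <= M * E)%N by apply: leq_mul.
have : (E * (a * b + a * c + b * c + (a * E + b * E + c * E) + E * E) <=
  E * (3 * (M * M) + 3 * (M * E) + E * E))%N by rewrite leq_mul2l; apply/orP; right; lia.
nia.
Qed.

Section Separate.
Variables (K : numFieldType) (dim : nat) (J : finType) (pt : J -> 'rV[K]_dim).
Hypothesis pt_inj : injective pt.

Lemma separating_poly p : exists Q : mpoly dim K,
  [/\ (mmeasure mdeg Q <= #|J|.+1)%N, peval Q (pt p) != 0 &
      forall q, q != p -> peval Q (pt q) = 0].
Proof.
have /choice [f Hf] : forall q, exists f : mpoly dim K, [/\ (mmeasure mdeg f <= 2)%N,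
    q != p -> peval f (pt p) != 0 & peval f (pt q) = 0].
  move=> q; have [->|qp] := eqVneq q p.
    by exists 0; rewrite mmeasure0 peval0.
  have /eqP/rowP/existsNP [i /eqP di] : pt p != pt q.
    by rewrite (inj_eq pt_inj) eq_sym.
  exists (mpolyX K (mnm1 i) - mpolyC dim (pt q 0 i)); rewrite !pevalB !pevalXU !pevalC subrr subr_eq0.
  split=> //; apply: msize_add; first by rewrite mmeasureX /= mdeg1.
  by rewrite mmeasureN mmeasureC; case: (_ != 0).
exists (\prod_(q | q != p) f q); split.
- have := @msize_prod K dim _ (index_enum J) (fun q => q != p) f (fun q => let: And3 a _ _ := Hf q in a).
  by rewrite -sum1_size sum1_card.
- by rewrite peval_prod; apply/prodf_neq0 => q qp; have [_ /(_ qp)] := Hf q.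
move=> q qp; rewrite peval_prod (bigD1 q) //=.
by have [_ _ ->] := Hf q; rewrite mul0r.
Qed.

End Separate.

(** Cube roots turn the hypothesis into a linear inequality between x w(p) and s(p). Summed over p
    it gives S / (4 S)^{1/3} <= D L, which is cubed again. *)
Lemma cube_sum_bound (R : realType) (J : finType) (w s : J -> R) (D x L S : R) :
  0 < S -> S = \sum_p w p -> 0 < x -> 0 <= D -> (forall p, 0 <= w p) -> (forall p, 0 <= s p) ->
  (forall p, (x * w p) ^+ 3 / (4 * S) <= (D * s p) ^+ 3) ->
  \sum_p s p <= L * x -> S ^+ 2 <= 4 * (D * L) ^+ 3.
Proof.
move=> S0 SE x0 D0 w0 s0 H sL; pose u := (4 * S)^-1 `^ 3^-1.
have u0 : 0 < u by rewrite powR_gt0 // invr_gt0 mulr_gt0.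
have u3 : u ^+ 3 = (4 * S)^-1.
  by rewrite -powR_mulrn ?ltW // -powRrM mulVf // powRr1 // invr_ge0 mulr_ge0 // ltW.
have uw p : u * (x * w p) <= D * s p.
  rewrite -(@ler_pXn2r _ 3) ?nnegrE ?mulr_ge0 ?(ltW x0) ?(ltW u0) //.
  by rewrite exprMn u3 mulrC.
have : u * S * x <= D * L * x.
  rewrite SE -mulrA [_ * x]mulrC !mulr_sumr.
  apply: le_trans (_ : \sum_p D * s p <= _); first exact: ler_sum.
  by rewrite -mulr_sumr -mulrA ler_wpM2l.
rewrite ler_pM2r // => uS.
have : (u * S) ^+ 3 <= (D * L) ^+ 3.
  by rewrite ler_pXn2r ?nnegrE //; [apply: mulr_ge0; apply: ltW|apply: le_trans uS; apply: mulr_ge0; apply: ltW].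
rewrite exprMn u3 => le; apply: le_trans (_ : 4 * ((4 * S)^-1 * S ^+ 3) <= _); last by rewrite ler_pM2l.
by rewrite le_eqVlt; apply/orP; left; apply/eqP; field; rewrite gt_eqF.
Qed.

(** * The inequality for abstract branches *)

Section Core.
Variables (R : realType) (J G : finType) (pt : J -> 'rV[R]_3) (I : G -> set (mpoly 3 R)).
Variables (D C : nat) (m : J -> nat) (v : forall p, 'I_(m p) -> 'rV[R]_3)
  (gam : forall p, 'I_(m p) -> G).
Hypothesis pt_inj : injective pt.
Hypotheses (I0 : forall g, I g 0)
  (Ilin : forall g a f h, I g f -> I g h -> I g (a *: f + h))
  (Imul : forall g f h, I g h -> I g (f * h)).
Hypothesis dimI : forall g n (X : finType) (f : X -> mpoly 3 R),
  (forall i, mmeasure mdeg (f i) <= n.+1)%N -> ((n + C) * D < #|X|)%N ->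
  exists c : X -> R, (exists i, c i != 0) /\ I g (\sum_i c i *: f i).
Hypotheses (v0 : forall p (i : 'I_(m p)), v i != 0)
  (indep : forall p (i j : 'I_(m p)), i != j -> exists a, dotp a (v j) = 0 /\ dotp a (v i) != 0)
  (tangent : forall p (i : 'I_(m p)) f r, I (gam i) f -> ordge (pt p) r f ->
     (line_poly (pt p) (v i) f)`_r = 0).

(** Ordered triples; the overcount compared with N(p) is harmless in an upper bound. *)
Definition indep_triple p (t : {ffun 'I_3 -> 'I_(m p)}) := free [tuple v (t i) | i < 3].

Definition triple_count p := #|[pred t | indep_triple (p := p) t]|.

Hypothesis triple_gt0 : forall p, (0 < triple_count p)%N.

Let N := #|J|.

Lemma hilb_diag g k : (hilb k (I g) k <= (k + C) * D)%N.
Proof.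
apply: (hilb_bound (@I0 g) (@Ilin g)) => // X f Hf; apply: dimI => i.
exact: leq_trans (Hf i) _.
Qed.

Section FixedDegree.
Variables (k E : nat).
(** The factor 3 gives at least (k + N)^3 monomials; the distance 3 N from 3 k leaves room for
    multiplication by a separating polynomial. *)
Let n := (3 * (k + N))%N.
Let M := ((n + C) * D)%N.
Let s beta g p := share N n pt (I g) beta n p.
Hypothesis growth : forall g, (hilb n (I g) n <= hilb n (I g) (3 * k) + E)%N.
Hypothesis N0 : (0 < N)%N.

Lemma share_le beta g p : distinct_mod N beta -> (s beta g p <= M)%N.
Proof.
move=> bd; apply: leq_trans (hilb_diag g n); apply: leq_trans (sum_share n N0 pt (@I0 g) (@Ilin g) n bd).
by rewrite (bigD1 p) //= leq_addr.
Qed.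

Lemma share_bump beta g p : distinct_mod N beta -> (s beta g p <= s (bump N beta p) g p + E)%N.
Proof.
move=> bd; have [Q [Qm Qp Qq]] := separating_poly pt_inj p.
have mn : (3 * k <= n)%N by rewrite leq_mul2l leq_addr.
apply: leq_trans (_ : share N n pt (I g) beta (3 * k) p + E <= _)%N.
  apply: leq_trans (share_size n N0 pt (@I0 g) (@Ilin g) beta p mn) _.
  by rewrite leq_add2l leq_subLR.
rewrite leq_add2r; apply: (share_bump_same N0 (@I0 g) (@Ilin g) (@Imul g) bd mn (leqnn n) _ Qp Qq).
move=> f fm; have [k0|k0] := posnP k.
  have -> : f = 0 by apply/eqP; rewrite -(mmeasure_poly_eq0 mdeg) -leqn0 (leq_trans fm) ?k0.
  by rewrite mulr0 mmeasure0.
apply: leq_trans (msizeM_leq Qm (_ : _ <= (3 * k).-1.+1)%N) _.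
  by rewrite prednK // muln_gt0.
by rewrite -/N /n; move: k0 N0; lia.
Qed.

(** A joint is [over] if all its independent triples reach the target; bumping it costs at most E
    per share, hence at most the stated error in a product. Some joint of every low cluster U is
    [over]: otherwise triples below target exist throughout U, and [vanishing] bounds (k + N)^3 by
    the sum of the targets. *)
Lemma handicaps (t : J -> R) : \sum_p t p < (k + N)%:R ^+ 3 -> (forall p, 0 <= t p) ->
  exists2 beta, distinct_mod N beta & forall p (tau : {ffun 'I_3 -> 'I_(m p)}), indep_triple tau ->
    t p <= (\prod_i s beta (gam (tau i)) p + 3 * E * (M + E) ^ 2)%:R.
Proof.
move=> tsum t0.
pose ok c beta p := forall tau : {ffun 'I_3 -> 'I_(m p)}, indep_triple tau ->
    t p <= (\prod_i s beta (gam (tau i)) p + c)%:R.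
pose over (beta : J -> nat) p := ok 0%N beta p.
pose beta0 (p : J) : nat := enum_rank p.
suff [beta bd Hb] : exists2 beta, distinct_mod N beta & forall p, ok (3 * E * (M + E) ^ 2)%N beta p.
  by exists beta.
have := @bump_until_good J N n (distinct_mod N (J:=J)) (ok (3 * E * (M + E) ^ 2)%N) over beta0; apply.
- by move=> beta p; apply: bump_distinct.
- move=> beta p bd ov tau /ov; rewrite addn0 => /le_trans; apply; rewrite ler_nat.
  apply: leq_trans (prod3_shift E (fun i => share_le (gam (tau i)) p (bump_distinct p bd))).
  by apply: leq_prod => i _; apply: share_bump.
- move=> beta p q bd qp gq tau /gq /le_trans; apply; rewrite ler_nat leq_add2r.
  by apply: leq_prod => i _; exact: (share_bump_other n N0 pt (@I0 (gam (tau i))) (@Ilin (gam (tau i))) n bd qp).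
- move=> beta U bd U0 gap; apply: contrapT => H.
  have tauP p : exists tau : {ffun 'I_3 -> 'I_(m p)}, indep_triple tau /\
      (p \in U -> (\prod_i s beta (gam (tau i)) p)%:R < t p).
    have [pU|pU] := boolP (p \in U); last first.
      by have /card_gt0P [tau] := triple_gt0 p; rewrite inE => Htau; exists tau.
    apply: contrapT => H'; apply: H; exists p => // tau Htau; rewrite addn0 leNgt.
    by apply/negP => lt; apply: H'; exists tau.
  pose tau p := sval (cid (tauP p)).
  have Htau p : indep_triple (tau p) /\
      (p \in U -> (\prod_i s beta (gam (tau p i)) p)%:R < t p) by exact: svalP (cid (tauP p)).
  have basis p w : p \in U -> exists c : 'I_3 -> R, w = \sum_i c i *: v (tau p i).
    move=> _; have [free_tau _] := Htau p; pose X := [tuple v (tau p i) | i < 3]; rewrite /indep_triple -/X in free_tau.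
    have bX : basis_of fullv X by rewrite basisEfree free_tau subvf dimvf size_tuple /dim /=.
    exists (fun i => coord X i w); rewrite {1}(coord_basis bX (memvf w)).
    by apply: eq_bigr => i _; rewrite -tnth_nth tnth_mktuple.
  have := @vanishing R N 3 n N0 J 'I_3 pt (fun p i => I (gam (tau p i)))
    (fun p i => v (tau p i)) beta U (fun p i => @I0 _) (fun p i => @Ilin _) U0 gap basis
    (fun p i f r _ => @tangent p (tau p i) f r).
  move/(leq_trans (card_bmultinom_ge (k + N))).
  apply/negP; rewrite -ltnNge -(ltr_nat R) natrX natr_sum; apply: le_lt_trans tsum.
  rewrite [leRHS](bigID (fun p => p \in U)) /= -[leLHS]addr0 lerD ?sumr_ge0 //.
  by apply: ler_sum => p pU; have [_ /(_ pU) /ltW] := Htau p.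
- move=> p q; rewrite !modn_small ?ltn_ord //.
  by apply: contraNneq => /val_inj/enum_rank_inj ->.
by move=> p; rewrite ltnW // ltn_ord.
Qed.

End FixedDegree.

Lemma gam_count p g : (#|[pred j | gam (p := p) j == g]| <= D)%N.
Proof.
set P := [pred j | _]; pose w (i : 'I_#|P|) := v (enum_val i).
have gamE (i : 'I_#|P|) : gam (enum_val i) = g.
  by have := enum_valP i; rewrite inE => /eqP.
apply: (@tangent_count R 3 (pt p) (I g) D C #|P| w).
- exact: dimI.
- by move=> i; apply: v0.
- by move=> i j ij; apply: indep; rewrite (inj_eq enum_val_inj).
by move=> i f r; rewrite -(gamE i); apply: tangent.
Qed.

(** One k must serve all curves, so [slow_growth] is applied to the sum of their Hilbert functions;
    every summand is monotone and therefore grows by no more than the sum. *)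
Lemma growth_step k0 : exists2 k, (k0 <= k)%N & forall g,
  (hilb (3 * (k + N)) (I g) (3 * (k + N)) <=
   hilb (3 * (k + N)) (I g) (3 * k) + 3 * #|G| * D * N)%N.
Proof.
pose h k := (\sum_g hilb (3 * k) (I g) (3 * k))%N.
have hb k : (h k <= 3 * #|G| * D * k + #|G| * C * D)%N.
  apply: leq_trans (_ : \sum_(g : G) (3 * k + C) * D <= _)%N.
    by apply: leq_sum => g _; apply: hilb_diag.
  rewrite sum_nat_const -[#|xpredT|]/#|G|; move: #|G| => x; apply: eq_leq; ring.
have [k kk Hk] := slow_growth N hb k0; exists k => // g.
have mn : (3 * k <= 3 * (k + N))%N by rewrite leq_mul2l leq_addr.
move: Hk; rewrite /h.
under [X in (_ <= X + _)%N -> _]eq_bigr do rewrite -(hilb_ambient (@I0 _) (@Ilin _) mn).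
rewrite (bigD1 g) //= [X in (_ <= X + _)%N -> _](bigD1 g) //=.
have : (\sum_(i | i != g) hilb (3 * (k + N)) (I i) (3 * k) <=
    \sum_(i | i != g) hilb (3 * (k + N)) (I i) (3 * (k + N)))%N.
  by apply: leq_sum => i _; apply: (hilb_mono (@I0 i) (@Ilin i)).
move: (\sum_(i | _) _)%N (\sum_(i | _) _)%N (hilb _ _ _) (hilb _ _ _) (3 * _ * _ * _)%N => a b c d e.
lia.
Qed.

(** The sum over all triples, independent or not, is the cube of a sum over branches, in which each
    curve occurs at most D times. *)
Lemma sum_triples beta n p : (\sum_(tau | indep_triple (p := p) tau)
    \prod_i share N n pt (I (gam (tau i))) beta n p <=
  (D * \sum_g share N n pt (I g) beta n p) ^ 3)%N.
Proof.
pose F g := share N n pt (I g) beta n p.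
apply: leq_trans (_ : (\sum_(j < m p) F (gam j)) ^ 3 <= _)%N.
  rewrite -[X in (_ ^ X)%N]card_ord -prod_nat_const bigA_distr_bigA /=.
  by rewrite [leqRHS](bigID (fun tau => indep_triple (p := p) tau)) /= leq_addr.
rewrite leq_exp2r // (partition_big (@gam p) xpredT) //= big_distrr /=.
apply: leq_sum => g _; rewrite (eq_bigr (fun=> F g)) => [|j /eqP -> //].
by rewrite sum_nat_const leq_mul2r gam_count orbT.
Qed.

Lemma joints_bound :
  (\sum_p Num.sqrt (triple_count p)%:R) ^+ 2 <= (256 * D ^ 6 * #|G| ^ 3)%:R :> R.
Proof.
have [N0|N0] := posnP N.
  rewrite big1 ?expr0n ?ler0n // => p _; by move: N0; rewrite /N (cardD1 p).
pose w p : R := Num.sqrt (triple_count p)%:R; pose S := \sum_p w p.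
pose S0 := (\sum_p triple_count p)%N; pose E := (3 * #|G| * D * N)%N.
pose A := ((3 + C) * D + E)%N.
have w1 p : 1 <= w p by rewrite -sqrtr1 ler_wsqrtr // ler1n.
have w0 p : 0 < w p by apply: lt_le_trans (w1 p).
have wE p : w p ^+ 2 = (triple_count p)%:R by rewrite sqr_sqrtr // ler0n.
(* Large enough for the error eps, quadratic in k + N, to be at most x^3 / (4 S), and for k to
   absorb C at the end. *)
have [k k_ge growth] := growth_step (12 * S0 * E * A ^ 2 + C + 1).
set x : R := (k + N)%:R; pose eps := (3 * E * ((3 * (k + N) + C) * D + E) ^ 2)%N.
have x0 : 0 < x by rewrite ltr0n addn_gt0 N0 orbT.
have [p0 _] : exists p0 : J, p0 \in J by apply/card_gt0P.
have Sp : 0 < S.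
  rewrite /S (bigD1 p0) //=; apply: ltr_pwDl => //.
  by apply: sumr_ge0 => p _; apply: ltW.
have SS0 : S <= S0%:R.
  rewrite natr_sum; apply: ler_sum => p _; rewrite -wE expr2.
  by apply: ler_peMr (ltW _) (w1 _).
have eps_nat : (4 * S0 * eps <= (k + N) ^ 3)%N.
  have MA : ((3 * (k + N) + C) * D + E <= A * (k + N))%N.
    by rewrite /A; move: (E) => e; nia.
  apply: leq_trans (_ : 4 * S0 * (3 * E * (A * (k + N)) ^ 2) <= _)%N.
    by rewrite leq_mul // leq_mul // leq_exp2r.
  rewrite (expnS _ 2) (_ : (4 * _ * _)%N = (12 * S0 * E * A ^ 2 * (k + N) ^ 2)%N); last by ring.
  by apply: leq_mul => //; move: (12 * _ * _ * _)%N k_ge => y; lia.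
have eps_le : eps%:R <= x ^+ 3 / (4 * S).
  rewrite ler_pdivlMr ?mulr_gt0 // -natrX; apply: le_trans (_ : (4 * S0 * eps)%:R <= _); last by rewrite ler_nat.
  by rewrite !natrM mulrC ler_wpM2r // ler_wpM2l.
(* The targets add up to x^3 / 2, strictly less than x^3. *)
have [||beta bd Hb] := handicaps growth N0 (t := fun p => x ^+ 3 * w p / (2 * S)).
- rewrite -mulr_suml -mulr_sumr -/S -/x -subr_gt0.
  rewrite (_ : _ - _ = x ^+ 3 / 2); first by rewrite divr_gt0 // exprn_gt0.
  by field; rewrite gt_eqF.
- by move=> p; rewrite divr_ge0 ?mulr_ge0 ?exprn_ge0 // ltW.
(* Each curve has total share at most (3 (k + N) + C) D <= 4 D x. *)
suff : S ^+ 2 <= 4 * (D%:R * (4 * D * #|G|)%:R) ^+ 3.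
  move/le_trans; apply; rewrite -natrM -natrX -natrM ler_nat; apply/eq_leq; ring.
apply: (@cube_sum_bound R J w (fun p => (\sum_g share N (3 * (k + N)) pt (I g) beta (3 * (k + N)) p)%:R) _ x) => //.
- by move=> p; apply: ltW.
- move=> p; set sg := (\sum_g _)%N.
  have : (triple_count p)%:R * (x ^+ 3 * w p / (2 * S)) <= (D%:R * sg%:R) ^+ 3 + (triple_count p)%:R * eps%:R.
    rewrite -natrM -natrX -natrM -natrD.
    apply: le_trans (_ : (\sum_(tau | indep_triple (p := p) tau)
      (\prod_i share N (3 * (k + N)) pt (I (gam (tau i))) beta (3 * (k + N)) p + eps))%:R <= _).
      rewrite natr_sum mulr_natl -sumr_const; apply: ler_sum => tau Ht; exact: Hb.
    by rewrite ler_nat big_split /= sum_nat_const leq_add2r sum_triples.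
  rewrite -wE => le.
  have le2 : w p ^+ 2 * eps%:R <= (x * w p) ^+ 3 / (4 * S).
    apply: le_trans (_ : w p ^+ 2 * (x ^+ 3 / (4 * S)) <= _).
      by rewrite ler_wpM2l // exprn_ge0 // ltW.
    rewrite exprMn [in leRHS]exprS; apply: le_trans (_ : w p ^+ 2 * (x ^+ 3 / (4 * S)) * w p <= _).
      by rewrite ler_peMr // mulr_ge0 ?divr_ge0 ?exprn_ge0 ?mulr_ge0 // ltW.
    by rewrite le_eqVlt; apply/orP; left; apply/eqP; ring.
  (* One half pays for the errors of the triples, the other half is the cube to be kept. *)
  have e : w p ^+ 2 * (x ^+ 3 * w p / (2 * S)) = (x * w p) ^+ 3 / (4 * S) + (x * w p) ^+ 3 / (4 * S).
    by field; rewrite gt_eqF.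
  by rewrite -(lerD2r ((x * w p) ^+ 3 / (4 * S))) -e; apply: le_trans le _; rewrite lerD2l.
rewrite -natr_sum -natrM ler_nat exchange_big /=.
apply: leq_trans (_ : \sum_(g : G) (3 * (k + N) + C) * D <= _)%N.
  apply: leq_sum => g _; apply: leq_trans (hilb_diag g _).
  exact: (sum_share (3 * (k + N)) N0 pt (@I0 g) (@Ilin g) _ bd).
rewrite sum_nat_const -[#|xpredT|]/#|G|; move: #|G| (12 * _ * _ * _)%N k_ge => y z k_ge.
have : (3 * (k + N) + C <= 4 * (k + N))%N by lia.
move=> le; rewrite (_ : (4 * D * y * _)%N = (y * (4 * (k + N) * D))%N); last by ring.
by rewrite !leq_mul.
Qed.

End Core.

(** * Joints *)

Section GermIdeal.
Variables (R : realType) (g T : set 'rV[R]_3).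

Lemma germ_ideal0 : germ_ideal g T 0.
Proof. by move=> a v _ _ _; near=> h; rewrite peval0. Unshelve. all: by end_near. Qed.

Lemma germ_ideal_lin c (f1 f2 : mpoly 3 R) :
  germ_ideal g T f1 -> germ_ideal g T f2 -> germ_ideal g T (c *: f1 + f2).
Proof.
move=> H1 H2 a v Tv ag av; have := H1 a v Tv ag av; have := H2 a v Tv ag av.
by apply: filterS2 => h e2 e1; rewrite pevalD pevalZ e1 e2 mulr0 addr0.
Qed.

Lemma germ_ideal_mul (f1 f2 : mpoly 3 R) : germ_ideal g T f2 -> germ_ideal g T (f1 * f2).
Proof.
move=> H a v Tv ag av; have := H a v Tv ag av.
by apply: filterS => h e; rewrite pevalM e mulr0.
Qed.

Lemma germ_ideal_tangent (x v : 'rV[R]_3) (f : mpoly 3 R) r :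
  tangent_direction g x v -> T v -> germ_ideal g T f -> ordge x r f ->
  (line_poly x v f)`_r = 0.
Proof.
move=> [gx v0 [B [[_ _ Bg _] [C [a [BC [a0 _ aC _] av]]]]]] Tv Hf.
apply: (arc_coef a0 av); apply: Hf av => //.
by rewrite aC => y Cy; apply: Bg; exists C.
Qed.

End GermIdeal.

Section Lines.
Variable R : realType.
Implicit Types x u w : 'rV[R]_3.

Lemma lineP x u w : w != 0 -> line x u = line x w -> exists c, c != 0 /\ w = c *: u.
Proof.
move=> w0 E; have [t _ tE] : line x u (x + w) by rewrite E; exists 1 => //; rewrite scale1r.
have wE : w = t *: u by apply: (addrI x).
by exists t; split=> //; apply: contraNneq w0 => t0; rewrite wE t0 scale0r.
Qed.

Lemma lineZ x c u : c != 0 -> line x (c *: u) = line x u.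
Proof.
move=> c0; apply/seteqP; split=> _ [t _ <-].
  by exists (t * c) => //; rewrite scalerA.
by exists (t / c) => //; rewrite scalerA mulfVK.
Qed.

Lemma separating_form x u w : u != 0 -> w != 0 -> line x u != line x w ->
  exists a, dotp a w = 0 /\ dotp a u != 0.
Proof.
move=> u0 w0 uw; have /rV0Pn [l wl] := w0.
have /eqP/rowP/existsNP [j /eqP uj] : u != (u 0 l / w 0 l) *: w.
  apply: contra uw => /eqP uE; rewrite uE lineZ //.
  by apply: contraNneq u0 => c0; rewrite uE c0 scale0r.
(* A two-by-two minor against w, at indices where u and w are not proportional. *)
exists (w 0 l *: delta_mx 0 j - w 0 j *: delta_mx 0 l).
have dE z : dotp (w 0 l *: delta_mx 0 j - w 0 j *: delta_mx 0 l) z = w 0 l * z 0 j - w 0 j * z 0 l.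
  rewrite /dotp; under eq_bigr do rewrite !mxE /= mulrBl.
  rewrite sumrB (bigD1 j) //= big1 => [|i /negPf ij]; last by rewrite ij mulr0 mul0r.
  rewrite [X in _ - X](bigD1 l) //= big1 => [|i /negPf ij]; last by rewrite ij mulr0 mul0r.
  by rewrite !eqxx !mulr1 !addr0.
rewrite !dE; split; first by rewrite mulrC subrr.
apply: contra uj; rewrite subr_eq0 mxE => /eqP e; apply/eqP; apply: (mulfI wl).
by rewrite e; field.
Qed.

Lemma free_scale (u w : 'I_3 -> 'rV[R]_3) (c : 'I_3 -> R) : (forall i, c i != 0) ->
  (forall i, w i = c i *: u i) -> free [tuple u i | i < 3] -> free [tuple w i | i < 3].
Proof.
move=> c0 wE /freeP Hu; apply/freeP => k Hk i.
suff /eqP : k i * c i = 0 by rewrite mulf_eq0 (negPf (c0 i)) orbF => /eqP.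
apply: (Hu (fun i => k i * c i)); rewrite -[RHS]Hk; apply: eq_bigr => j _.
by rewrite -!tnth_nth !tnth_mktuple wE scalerA.
Qed.

End Lines.

(** * From tangent lines to branches *)

Section Joints.
Variables (R : realType) (G : set (set 'rV[R]_3)) (D : nat).
Hypothesis finG : finite_set G.
Hypothesis degG : forall g, G g -> exists2 d, real_curve_degree g d & (d * d <= D)%N.

Local Notation Gt := (fset_set G).

Lemma G_val (g : Gt) : G (val g).
Proof. by have := valP g; rewrite in_fset_set // inE. Qed.

Lemma germ_dim (T : seq 'rV[R]_3) : (forall v, v \in T -> v != 0) -> exists C,
  forall (g : Gt) n (X : finType) (f : X -> mpoly 3 R),
    (forall i, mmeasure mdeg (f i) <= n.+1)%N -> ((n + C) * D < #|X|)%N ->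
    exists c : X -> R, (exists i, c i != 0) /\ germ_ideal (val g) [set` T] (\sum_i c i *: f i).
Proof.
move=> T0; have /choice [C HC] : forall g : Gt, exists C,
  forall n (X : finType) (f : X -> mpoly 3 R),
    (forall i, mmeasure mdeg (f i) <= n.+1)%N -> ((n + C) * D < #|X|)%N ->
    exists c : X -> R, (exists i, c i != 0) /\ germ_ideal (val g) [set` T] (\sum_i c i *: f i).
  move=> g; have [d gd dD] := degG (G_val g).
  have [C HC] := curve_dim_real gd T0; exists C => n X f fn lt; apply: HC fn _.
  by apply: leq_ltn_trans lt; rewrite leq_mul.
exists (\sum_g C g)%N => g n X f fn lt; apply: HC fn _; apply: leq_ltn_trans lt.
by rewrite leq_mul2r leq_add2l (bigD1 g) //= leq_addr orbT.
Qed.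

Definition tangent_lines x : set (set 'rV[R]_3) := line x @` tangent_directions G x.

(** [germ_dim] takes finitely many tangents at a time, and its C depends on them; the tangent bound
    D does not, so bounding finite sets of lines makes the set of all tangent lines finite. *)
Lemma card_tangent_lines x (A : {fset set 'rV[R]_3}) :
  [set` A] `<=` tangent_lines x -> (#|` A| <= D * #|` Gt|)%N.
Proof.
move=> AL.
have /choice [vg Hvg] : forall l : A, exists vg : 'rV[R]_3 * Gt,
    tangent_direction (val vg.2) x vg.1 /\ line x vg.1 = val l.
  move=> l; have [v [g Gg tv] vl] := AL _ (valP l).
  have gG : g \in Gt by rewrite in_fset_set // inE.
  by exists (v, [` gG]%fset).
have v0 l : (vg l).1 != 0 by have [[]] := Hvg l.
have [|C HC] := @germ_dim (codom (fun l => (vg l).1)); first by move=> v /codomP [l ->].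
have fib g : (#|[pred l | (vg l).2 == g]| <= D)%N.
  set P := [pred l | _]; pose w (i : 'I_#|P|) := (vg (enum_val i)).1.
  have gE (i : 'I_#|P|) : (vg (enum_val i)).2 = g by apply/eqP; apply: (enum_valP i).
  apply: (@tangent_count R 3 x _ D C #|P| w (HC g)).
  - by move=> i; apply: v0.
  - move=> i j ij; apply: (@separating_form _ x); [exact: v0|exact: v0|].
    rewrite /w; have [_ ->] := Hvg (enum_val i); have [_ ->] := Hvg (enum_val j).
    by apply: contra ij => /eqP/val_inj/enum_val_inj ->.
  move=> i f r; apply: germ_ideal_tangent; last exact: (codom_f (fun l => (vg l).1)).
  by have [+ _] := Hvg (enum_val i); rewrite gE.
rewrite -[X in (X <= _)%N]/(size (enum_fset A)) cardfE -sum1_card (partition_big (fun l => (vg l).2) xpredT) //=.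
apply: leq_trans (_ : \sum_(g : Gt) D <= _)%N.
  by apply: leq_sum => g _; rewrite sum1_card; apply: fib.
by rewrite sum_nat_const mulnC leq_mul2l /= -[leqRHS]/(size (enum_fset Gt)) cardfE leqnn orbT.
Qed.

Lemma finite_tangent_lines x : finite_set (tangent_lines x).
Proof.
apply: contrapT => /(infinite_set_fset (D * #|` Gt|).+1) [A AL].
by rewrite ltnNge (card_tangent_lines AL).
Qed.

Lemma joint_free x : joint G x -> exists u v w, [/\ tangent_directions G x u,
  tangent_directions G x v, tangent_directions G x w & free [:: u; v; w]].
Proof.
move=> [_ [u [v [w [tu tv tw E]]]]]; exists u, v, w; split=> //.
by rewrite /free E dimvf /dim /=.
Qed.

Lemma sum_joint_mult (A : {fset 'rV[R]_3}) : [set` A] `<=` joint G ->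
  (\sum_(x <- A) joint_mult G x `^ 2^-1 <= ((16 * D ^ 3)%:R * #|` Gt|%:R `^ (3 / 2))%:E)%E.
Proof.
(* Branches at p are indexed by its tangent lines, with one direction and one curve chosen for each
   line. *)
move=> AJ; pose m (p : A) := #|` fset_set (tangent_lines (val p))|.
have inL (p : A) l : l \in fset_set (tangent_lines (val p)) <-> tangent_lines (val p) l.
  by rewrite in_fset_set ?inE //; exact: finite_tangent_lines.
have exvg (p : A) (i : 'I_(m p)) : exists vg : 'rV[R]_3 * Gt,
    tangent_direction (val vg.2) (val p) vg.1 /\
    line (val p) vg.1 = nth set0 (fset_set (tangent_lines (val p))) i.
  have /inL [v [g Gg tv] vl] := mem_nth set0 (ltn_ord i).
  have gG : g \in Gt by rewrite in_fset_set // inE.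
  by exists (v, [` gG]%fset).
pose v p i := (sval (cid (exvg p i))).1; pose gam p i := (sval (cid (exvg p i))).2.
have vgP p i : tangent_direction (val (gam p i)) (val p) (v p i) /\
    line (val p) (v p i) = nth set0 (fset_set (tangent_lines (val p))) i.
  exact: svalP (cid (exvg p i)).
have v0 p i : v p i != 0 by have [[]] := vgP p i.
have lineE (p : A) u : tangent_directions G (val p) u ->
    exists i, line (val p) u = line (val p) (v p i).
  move=> tu; have : line (val p) u \in fset_set (tangent_lines (val p)).
    by apply/inL; exists u.
  move=> ul; have lt := ul; rewrite -index_mem in lt.
  by exists (Ordinal lt); have [_ ->] := vgP p (Ordinal lt); rewrite nth_index.
pose L p (tau : {ffun 'I_3 -> 'I_(m p)}) : set (set 'rV[R]_3) :=
  [set line (val p) (v p (tau i)) | i in [set: 'I_3]].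
have triple (p : A) u1 u2 u3 : tangent_directions G (val p) u1 ->
    tangent_directions G (val p) u2 -> tangent_directions G (val p) u3 -> free [:: u1; u2; u3] ->
    exists2 tau, indep_triple v (p := p) tau &
      [set line (val p) u1] `|` [set line (val p) u2] `|` [set line (val p) u3] = L p tau.
  move=> t1 t2 t3 fr; pose U := [tuple u1; u2; u3].
  have tU i : tangent_directions G (val p) (tnth U i).
    by rewrite (tnth_nth 0); case: i => [[|[|[|]]]].
  have /choice [j Hj] i := lineE p _ (tU i).
  have /choice [c Hc] i := lineP (v0 p (j i)) (Hj i).
  exists [ffun i => j i].
    apply: (@free_scale R (tnth U) _ c) => [i|i|].
    - by have [] := Hc i.
    - by rewrite ffunE; have [] := Hc i.
    rewrite (_ : mktuple _ = U) //.
    by apply: eq_from_tnth => i; rewrite tnth_mktuple.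
  rewrite /L; apply/seteqP; split=> [l [[->|->]|->]|l [i _ <-]].
  - by exists ord0 => //; rewrite ffunE -Hj.
  - by exists (lift ord0 ord0) => //; rewrite ffunE -Hj (tnth_nth 0).
  - by exists (lift ord0 (lift ord0 ord0)) => //; rewrite ffunE -Hj (tnth_nth 0).
  rewrite ffunE -Hj (tnth_nth 0).
  by case: i => [[|[|[|]]] //= _]; [left; left|left; right|right].
(* All chosen tangents at all joints of A enter at once, so that each curve has a single ideal. *)
have [|C HC] := @germ_dim (codom (fun t : {p : A & 'I_(m p)} => v (tag t) (tagged t))).
  by move=> w /codomP [t ->]; apply: v0.
set T := [set` _] in HC.
have mult_le (p : A) : (joint_mult G (val p) <= (triple_count v p)%:R%:E)%E.
  pose S := [seq L p tau | tau <- enum (indep_triple v (p := p))].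
  have sub : joint_triples G (val p) `<=` [set` S].
    move=> _ [u1 [u2 [u3 [t1 t2 t3 fr ->]]]].
    have [tau it ->] := triple p u1 u2 u3 t1 t2 t3 fr.
    by apply: map_f; rewrite mem_enum.
  have fin := sub_finite_set sub (finite_seq S).
  rewrite /joint_mult /counting asboolT // lee_fin ler_nat.
  rewrite (_ : triple_count v p = size S); last by rewrite size_map -cardE.
  apply: uniq_leq_size; first exact: fset_uniq.
  by move=> l; rewrite in_fset_set // inE => /sub.
have bound := @joints_bound R A Gt val (fun g => germ_ideal (val g) T) D C m v gam val_inj
  (fun g => @germ_ideal0 R (val g) T) (fun g => @germ_ideal_lin R (val g) T)
  (fun g => @germ_ideal_mul R (val g) T) HC v0.
have {}bound : (\sum_p Num.sqrt (triple_count v p)%:R) ^+ 2 <= (256 * D ^ 6 * #|{: Gt}| ^ 3)%:R :> R.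
  apply: bound => [p i j ij|p i f r|p].
  - apply: (@separating_form _ (val p)) => //.
    have [_ ->] := vgP p i; have [_ ->] := vgP p j.
    by rewrite nth_uniq ?fset_uniq.
  - apply: germ_ideal_tangent; first by have [] := vgP p i.
    exact: (codom_f (fun t : {p : A & 'I_(m p)} => v (tag t) (tagged t)) (Tagged _ i)).
  have [u1 [u2 [u3 [t1 t2 t3 fr]]]] := joint_free (AJ _ (valP p)).
  have [tau it _] := triple p u1 u2 u3 t1 t2 t3 fr.
  by apply/card_gt0P; exists tau.
rewrite big_seq_fsetE /=.
apply: (@le_trans _ _ (\sum_(p : A) (Num.sqrt (triple_count v p)%:R)%:E)%E).
  apply: lee_sum => p _; rewrite -powR12_sqrt ?ler0n // -poweR_EFin.
  apply: gt0_ler_poweR; rewrite ?invr_ge0 ?in_itv /= ?leey ?andbT //.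
    by rewrite /joint_mult /counting; case: ifP; rewrite ?leey // lee_fin ler0n.
  exact: mult_le.
(* Both sides are squared; 16 D^3 is the square root of 256 D^6. *)
rewrite sumEFin lee_fin -(@ler_pXn2r _ 2) ?nnegrE ?mulr_ge0 ?powR_ge0 //; last first.
  by apply: sumr_ge0 => p _; apply: sqrtr_ge0.
apply: le_trans bound _; rewrite exprMn -[X in _ * X]powR_mulrn ?powR_ge0 // -powRrM mulfVK //.
rewrite powR_mulrn // -!natrX -natrM ler_nat -[X in (_ <= _ * X ^ _)%N]/(size (enum_fset Gt)) cardfE.
by apply/eq_leq; ring.
Qed.

End Joints.

Theorem theorem6p1p2 (R : realType) (b : R) :
  0 < b ->
  exists c : R, forall G : set (set 'rV[R]_3),
    finite_set G ->
    (forall g, G g -> algebraic_curve g /\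
       exists2 d : nat, real_curve_degree g d & d%:R <= b) ->
    (\esum_(x in joint G) joint_mult G x `^ 2^-1
       <= (c * #|` fset_set G|%:R `^ (3 / 2))%:E)%E.
Proof.
move=> b0; pose D := (Num.bound b * Num.bound b)%N.
exists (16 * D ^ 3)%:R => G finG curveG.
have degG g : G g -> exists2 d, real_curve_degree g d & (d * d <= D)%N.
  move=> /curveG [_ [d gd db]]; exists d => //.
  have dB : (d <= Num.bound b)%N.
    by rewrite ltnW // -(ltr_nat R); apply: le_lt_trans db (archi_boundP (ltW b0)).
  exact: leq_mul.
(* The sum is a supremum over finite sets of joints, and the constant is the same for all of
   them. *)
apply: ub_ereal_sup => _ [A [finA AJ] <-].
rewrite fsbig_finite //; apply: sum_joint_mult => //.
by rewrite fset_setK.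
Qed.
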